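(* Let $n$ be a positive even integer. For every configuration of $n$ points in general position in $\mathbb{R}^2$, the number of halving lines is at most $$\sqrt[3]{\binom{n}{2}\frac{135\,n^2}{16}}.$$
   Context: General position means that no three of the points are collinear. A halving line of a configuration of $n$ points ($n$ even) is a line through two of the points such that exactly $(n-2)/2$ of the remaining $n-2$ points lie on each side of it. *)

(* Defs.v *)
From mathcomp Require Import all_boot all_order all_algebra finmap.
From mathcomp Require Import all_classical all_reals all_analysis.

Set Implicit Arguments.
Unset Strict Implicit.
Unset Printing Implicit Defensive.

Import Order.TTheory GRing.Theory Num.Theory.

Local Open Scope classical_set_scope.
Local Open Scope fset_scope.
Local Open Scope ring_scope.

(* Twice the signed area of the triangle p q r: its sign tells on which side of
   the directed line from p to q the point r lies. *)
Definition orient (R : realType) (p q r : R * R) : R :=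
  (q.1 - p.1) * (r.2 - p.2) - (q.2 - p.2) * (r.1 - p.1).

(* This is a line only when p != q. *)
Definition line (R : realType) (p q : R * R) : set (R * R) :=
  [set r | orient p q r = 0].

Definition general_position (R : realType) (S : {fset R * R}) : Prop :=
  forall p q r : R * R, p \in S -> q \in S -> r \in S ->
    p != q -> p != r -> q != r -> ~ line p q r.

(* The filters below skip p and q, since orient p q vanishes at both. *)
Definition halving_line (R : realType) (S : {fset R * R})
    (L : set (R * R)) : Prop :=
  exists p q : R * R,
    [/\ p \in S, q \in S, p != q & L = line p q] /\
    #|` [fset r in S | 0 < orient p q r] | = ((#|` S | - 2) %/ 2)%N /\
    #|` [fset r in S | orient p q r < 0] | = ((#|` S | - 2) %/ 2)%N.

Lemma finite_halving_lines (R : realType) (S : {fset R * R}) :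
  finite_set [set L | halving_line S L].
Proof.
apply: (@sub_finite_set _ _
  ((fun pq : (R * R) * (R * R) => line pq.1 pq.2) @`
     ([set` S] `*` [set` S]))); last first.
  by apply: finite_image; apply: finite_setX; exact: finite_fset.
by move=> L [p [q [[pS qS _ ->] _]]]; exists (p, q).
Qed.

(* fset_set returns the empty set on infinite sets, which finite_halving_lines
   rules out here. *)
Definition num_halving_lines (R : realType) (S : {fset R * R}) : nat :=
  #|` fset_set [set L | halving_line S L] |.

(* Main.v *)
Require Import Defs.
From Stdlib Require Import BinNat.
From HB Require Import structures.
From mathcomp Require Import all_boot all_order all_algebra.
From mathcomp Require Import boolp.
From mathcomp Require Import ring lra zify.

Set Implicit Arguments.
Unset Strict Implicit.
Unset Printing Implicit Defensive.

Import Order.TTheory GRing.Theory Num.Theory.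

Local Open Scope ring_scope.

(** The halving lines of [n] points in general position are the lines of the
    edges of a geometric graph with, say, [e] edges and [c] crossings. The bound
    compares two estimates of [c].

    From above, [4 c <= 'C(n, 2) - e] ([halving_crossings]). Turn a direction and
    look at the half of the points on its right, the lower half. It changes only
    when the direction passes a halving edge, and then by one point ([low_next]).
    A token on a point of the lower half, handed along the edge when this point
    leaves, describes a convex chain of halving edges. If the edges passed at
    times [t < t'] cross, they lie on the chains of two tokens, whose order is
    reversed between the two times; at that moment the direction is that of a
    common tangent [p q] of the chains, and fewer than [n / 2 - 1] points lie on
    its right ([tangent_exists], [tangent_right]). The tangent determines the
    crossing ([tangent_determines]), and each crossing has four of them, one for
    each way to direct its edges with the second turning left of the first. Every
    pair of points that is not halving has one direction with fewer than
    [n / 2 - 1] points on its right, a halving pair has none.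

    From below, [e ^ 3 <= 33.75 n ^ 2 c] if [e >= 7.5 n] ([crossing_lemma]). As
    usual, this comes from [c >= 5 e - 25 n] applied to a random induced subgraph,
    and the linear bound comes from removing much crossed edges one by one, once
    it is known that a graph whose edges have at most [k <= 4] crossings has at
    most [(k + 3) n] edges ([k_planar], a theorem of Pach and Toth). For the
    latter, let [T] be a maximal plane set of edges that contains as many edges of
    the graph [G] as possible. An edge of [G] outside [T] begins and ends with the
    crossing of an empty triangle of [T], from a vertex to the opposite side.
    Counting in each triangle ([local_bound]) compares the number of these edges
    with that of the triangles, hence with the at most [3 n] edges of [T]
    ([plane_bound]).

    The counting needs that at most [k] edges leave a vertex of a triangle through
    the opposite side ([class_le]). This is clear if that side belongs to [G], but
    it may not. Therefore [T] is chosen around a set [X] that is safe: at most [k]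
    edges leave a vertex together and then cross the same edge of [X]. If the edges
    in question are separated by a point visible from the vertex, some edge to such
    a point can be added to [X] without losing safety ([extend_safe]); otherwise
    they leave together, and safety bounds their number.

    Both estimates give [e ^ 3 <= 'C(n, 2) * 135 n ^ 2 / 16] when [e >= 7.5 n]. For
    smaller [e] the claim is immediate if [n > 100], and else it follows from the
    removal inequalities and the upper estimate of [c]. *)

(** * Orientations, segments and crossings *)

(** Locked, so that unification never compares expanded coordinates. *)
HB.lock Definition turn (R : realFieldType) (p q r : R * R) : R :=
  (q.1 - p.1) * (r.2 - p.2) - (q.2 - p.2) * (r.1 - p.1).

(** The point that divides [p q] in the ratio [t : 1 - t]. *)
HB.lock Definition seg (R : realFieldType) (p q : R * R) (t : R) : R * R :=
  (p.1 + t * (q.1 - p.1), p.2 + t * (q.2 - p.2)).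

Section Plane.
Variable R : realFieldType.
Implicit Types p q r a b c d v o y z m l : R * R.

Definition cross a b c d : bool :=
  (turn a b c * turn a b d < 0) && (turn c d a * turn c d b < 0).

Lemma turn_rot a b c : turn b c a = turn a b c.
Proof. rewrite turn.unlock; ring. Qed.

Lemma turn_swap a b c : turn b a c = - turn a b c.
Proof. rewrite turn.unlock; ring. Qed.

Lemma turn_swapr a b c : turn a c b = - turn a b c.
Proof. rewrite turn.unlock; ring. Qed.

Lemma turn_aab a b : turn a a b = 0.
Proof. rewrite turn.unlock; ring. Qed.

Lemma turn_aba a b : turn a b a = 0.
Proof. rewrite turn.unlock; ring. Qed.

Lemma turn_abb a b : turn a b b = 0.
Proof. rewrite turn.unlock; ring. Qed.

Lemma turn_seg a b c d (t : R) :
  turn a b (seg c d t) = (1 - t) * turn a b c + t * turn a b d.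
Proof. rewrite turn.unlock seg.unlock /=; ring. Qed.

Lemma seg0 a b : seg a b 0 = a.
Proof. by case: a => x y; rewrite seg.unlock /= !mul0r !addr0. Qed.

Lemma seg1 a b : seg a b 1 = b.
Proof. by case: a b => x y [z t]; rewrite seg.unlock /=; congr (_, _); ring. Qed.

Lemma seg_rev a b (t : R) : seg b a t = seg a b (1 - t).
Proof. rewrite seg.unlock; congr (_, _); ring. Qed.

Lemma seg_seg a b (s t w : R) : seg (seg a b s) (seg a b t) w = seg a b (s + w * (t - s)).
Proof. rewrite seg.unlock /=; congr (_, _); ring. Qed.

Lemma crossC a b c d : cross a b c d = cross c d a b.
Proof. by rewrite /cross andbC. Qed.

Lemma cross_swapl a b c d : cross b a c d = cross a b c d.
Proof. by rewrite /cross !(turn_swap a b) mulrNN [turn c d b * _]mulrC. Qed.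

Lemma cross_swapr a b c d : cross a b d c = cross a b c d.
Proof. by rewrite crossC cross_swapl crossC. Qed.

(** Grassmann-Plücker relation for the directions of [q], [r], [s], [t] seen from
    [p]; it makes the order of directions transitive inside a half-plane. *)
Lemma plucker p q r s t :
  turn p q r * turn p s t + turn p q t * turn p r s = turn p q s * turn p r t.
Proof. rewrite turn.unlock; ring. Qed.

Lemma cross_meet a b c d : cross a b c d ->
  exists s t, [/\ 0 < s < 1, 0 < t < 1 & seg a b s = seg c d t].
Proof.
case/andP; set A := turn a b c; set B := turn a b d; set C := turn c d a;
  set D := turn c d b => AB CD.
have EQ : C - D = B - A by rewrite /A /B /C /D turn.unlock; ring.
have nCD : C - D != 0 by apply/eqP => h; nra.
(* Cramer's rule *)
exists (C / (C - D)), (A / (A - B)).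
have nAB : A - B != 0 by apply/eqP => h; nra.
have sgn (x y : R) : x * y < 0 -> x - y != 0 -> 0 < x / (x - y) < 1.
  move=> xy nxy.
  have e : x / (x - y) = x * x / (x * x - x * y) .
    have x0 : x != 0 by apply/eqP => h; move: xy; rewrite h mul0r ltxx.
    by field; rewrite nxy -mulrBr mulf_neq0.
  have h : 0 < x * x - x * y by nra.
  rewrite e divr_gt0 //=; last by nra.
  rewrite ltr_pdivrMr // mul1r; nra.
split; [exact: sgn | exact: sgn|].
have e1 : forall X Y : R, (C - D) * (X - Y) = 0 -> X = Y.
  move=> X Y /eqP; rewrite mulf_eq0 (negPf nCD) /= subr_eq0 => /eqP //.
rewrite seg.unlock; congr (_, _); apply: e1.
  rewrite [A / _](_ : _ = - A / (C - D)); last by rewrite EQ; field; rewrite nAB -opprB oppr_eq0 nAB.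
  rewrite (_ : _ * _ = (C - D) * (a.1 - c.1) + C * (b.1 - a.1) + A * (d.1 - c.1)); last by field.
  rewrite /A /B /C /D turn.unlock; ring.
rewrite [A / _](_ : _ = - A / (C - D)); last by rewrite EQ; field; rewrite nAB -opprB oppr_eq0 nAB.
rewrite (_ : _ * _ = (C - D) * (a.2 - c.2) + C * (b.2 - a.2) + A * (d.2 - c.2)); last by field.
rewrite /A /B /C /D turn.unlock; ring.
Qed.

Lemma conv0_lt (x y t : R) : 0 < t < 1 -> (1 - t) * x + t * y = 0 -> x != 0 -> x * y < 0.
Proof.
move=> /andP[t0 t1] e x0.
have x2 : 0 < x * x by rewrite -expr2 exprn_even_gt0.
have h : t * (x * y) = - ((1 - t) * (x * x)) by have := congr1 ( *%R x) e; rewrite mulr0 => E; lra.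
have : t * (x * y) < 0 by rewrite h oppr_lt0 mulr_gt0 // subr_gt0.
by rewrite pmulr_rlt0.
Qed.

Lemma meet_cross a b c d (s t : R) : 0 < s < 1 -> 0 < t < 1 ->
  seg a b s = seg c d t -> turn a b c != 0 -> cross a b c d.
Proof.
move=> s01 t01 E n1.
have h1 : (1 - t) * turn a b c + t * turn a b d = 0.
  by rewrite -turn_seg -E turn_seg turn_aba turn_abb; ring.
have h2 : (1 - s) * turn c d a + s * turn c d b = 0.
  by rewrite -turn_seg E turn_seg turn_aba turn_abb; ring.
have k1 := conv0_lt t01 h1 n1.
rewrite /cross k1 /=; apply: (conv0_lt s01 h2).
apply/eqP => h3.
have h4 : turn c d b = 0 by move: h2; rewrite h3; move: s01 => /andP[s0 _]; nra.
have h5 : turn a b c + turn c d a = turn a b d + turn c d b by rewrite turn.unlock; ring.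
move: k1; rewrite h3 h4 !addr0 in h5; rewrite h5; nra.
Qed.

Lemma mul_lt0_ge (x y : R) : x * y < 0 -> 0 <= x -> y < 0.
Proof. by move=> xy x0; rewrite ltNge; apply: contraTN xy => y0; rewrite -leNgt mulr_ge0. Qed.

Lemma mul_lt0_le (x y : R) : x * y < 0 -> x <= 0 -> 0 < y.
Proof. by move=> xy x0; rewrite ltNge; apply: contraTN xy => y0; rewrite -leNgt mulr_le0. Qed.

(** An affine path leaves the positive quadrant where the first of its two
    coordinates vanishes. *)
Lemma first_exit (A0 A1 B0 B1 : R) : 0 < A0 -> 0 < B0 -> (A1 <= 0) || (B1 <= 0) ->
  exists t, [/\ 0 < t <= 1, 0 <= (1 - t) * A0 + t * A1, 0 <= (1 - t) * B0 + t * B1 &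
    ((1 - t) * A0 + t * A1 == 0) || ((1 - t) * B0 + t * B1 == 0)].
Proof.
have key : forall A0 A1 B0 B1 : R, 0 < A0 -> 0 < B0 -> A1 <= 0 -> A1 * B0 <= A0 * B1 ->
  exists t, [/\ 0 < t <= 1, 0 <= (1 - t) * A0 + t * A1, 0 <= (1 - t) * B0 + t * B1 &
    ((1 - t) * A0 + t * A1 == 0)].
  move=> {A0 A1 B0 B1} A0 A1 B0 B1 a0 b0 a1 h.
  have d0 : 0 < A0 - A1 by lra.
  have E : (1 - A0 / (A0 - A1)) * A0 + A0 / (A0 - A1) * A1 = 0 by field; lra.
  exists (A0 / (A0 - A1)); rewrite E lexx eqxx; split => //.
    by rewrite divr_gt0 //= ler_pdivrMr // mul1r; lra.
  have -> : (1 - A0 / (A0 - A1)) * B0 + A0 / (A0 - A1) * B1 = (A0 * B1 - A1 * B0) / (A0 - A1).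
    by field; lra.
  by rewrite divr_ge0 //; lra.
move=> a0 b0 ab.
case: (lerP (A1 * B0) (A0 * B1)) => h.
  have a1 : A1 <= 0.
    case/orP: ab => // b1; have h2 : A0 * B1 <= 0 by nra.
    have h3 : A1 * B0 <= 0 by lra.
    by move: h3; rewrite pmulr_lle0.
  by have [t [t1 t2 t3 t4]] := key _ _ _ _ a0 b0 a1 h; exists t; rewrite t4.
have b1 : B1 <= 0.
  case/orP: ab => // a1; have h2 : A1 * B0 <= 0 by nra.
  have h3 : A0 * B1 <= 0 by lra.
  by move: h3; rewrite pmulr_rle0.
have h' : B1 * A0 <= B0 * A1 by lra.
have [t [t1 t2 t3 t4]] := key _ _ _ _ b0 a0 b1 h'.
by exists t; rewrite t4 orbT.
Qed.

End Plane.

(** * Points visible across a triangle *)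

Section Cut.
Variables (R : realFieldType) (V : finType) (pt : V -> R * R).

Definition visible (X : rel V) (v x : V) : bool :=
  [forall a, forall b, X a b ==> ~~ cross (pt v) (pt x) (pt a) (pt b)].

Lemma visibleP (X : rel V) (v x : V) :
  reflect (forall a b, X a b -> ~~ cross (pt v) (pt x) (pt a) (pt b)) (visible X v x).
Proof.
by apply: (iffP forallP) => [h a b ab|h a]; [move/forallP/(_ b)/implyP: (h a); apply
  | apply/forallP => b; apply/implyP; exact: h].
Qed.

Lemma visiblePn (X : rel V) (v x : V) : ~~ visible X v x ->
  exists a b, X a b /\ cross (pt v) (pt x) (pt a) (pt b).
Proof.
by rewrite negb_forall => /existsP[a]; rewrite negb_forall => /existsP[b];
  rewrite negb_imply negbK => /andP[ab c]; exists a, b.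
Qed.

Definition in_triangle (v o y z : R * R) : bool :=
  [&& 0 < turn o y z, 0 < turn y v z & 0 < turn v o z].

Variable X : rel V.
Hypothesis Xsym : symmetric X.

(** An edge of [X] may meet the sides [v o] and [o y] only if it stays beyond the
    line [o y]; so an edge that is inside the triangle cannot leave it there. *)
Definition walls (v o y : R * R) : Prop :=
  forall a b t h, X a b -> 0 <= t <= 1 ->
    (0 < h <= 1) && (seg (pt a) (pt b) t == seg v o h) ||
    (0 <= h < 1) && (seg (pt a) (pt b) t == seg o y h) ->
    turn o y (pt a) <= 0 /\ turn o y (pt b) <= 0.

Variables v o y : R * R.
Hypothesis D0 : 0 < turn v o y.
Hypothesis W : walls v o y.

Lemma bary z : turn o y z + turn y v z + turn v o z = turn v o y.
Proof. rewrite turn.unlock; ring. Qed.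

Lemma on_vo z : turn v o z = 0 -> z = seg v o (turn y v z / turn v o y).
Proof.
move=> h; have d0 : turn v o y != 0 by rewrite gt_eqF.
have e : forall a b : R, (a - b) * turn v o y = 0 -> a = b.
  by move=> a b /eqP; rewrite mulf_eq0 (negPf d0) orbF subr_eq0 => /eqP.
rewrite {1}(surjective_pairing z) seg.unlock /=; congr (_, _); apply: e.
  rewrite (_ : _ * _ = (z.1 - v.1) * turn v o y - turn y v z * (o.1 - v.1)); last by field.
  rewrite (_ : _ - _ = turn v o z * (y.1 - v.1)); first by rewrite h mul0r.
  rewrite turn.unlock; ring.
rewrite (_ : _ * _ = (z.2 - v.2) * turn v o y - turn y v z * (o.2 - v.2)); last by field.
rewrite (_ : _ - _ = turn v o z * (y.2 - v.2)); first by rewrite h mul0r.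
rewrite turn.unlock; ring.
Qed.

Lemma on_oy z : turn o y z = 0 -> z = seg o y (turn v o z / turn v o y).
Proof.
move=> h; have d0 : turn v o y != 0 by rewrite gt_eqF.
have e : forall a b : R, (a - b) * turn v o y = 0 -> a = b.
  by move=> a b /eqP; rewrite mulf_eq0 (negPf d0) orbF subr_eq0 => /eqP.
rewrite {1}(surjective_pairing z) seg.unlock /=; congr (_, _); apply: e.
  rewrite (_ : _ * _ = (z.1 - o.1) * turn v o y - turn v o z * (y.1 - o.1)); last by field.
  rewrite (_ : _ - _ = turn o y z * (v.1 - o.1)); first by rewrite h mul0r.
  rewrite turn.unlock; ring.
rewrite (_ : _ * _ = (z.2 - o.2) * turn v o y - turn v o z * (y.2 - o.2)); last by field.
rewrite (_ : _ - _ = turn o y z * (v.2 - o.2)); first by rewrite h mul0r.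
rewrite turn.unlock; ring.
Qed.

(** An edge that passes through [m] towards the side of [o] ends in the triangle:
    the first side it would leave through is a wall. *)
Lemma trap a b t : X a b -> 0 <= t <= 1 ->
  let m := seg (pt a) (pt b) t in
  0 < turn o y m -> 0 <= turn y v m -> 0 < turn v o m ->
  0 < turn y v (pt a) * turn v o m - turn v o (pt a) * turn y v m ->
  in_triangle v o y (pt a).
Proof.
move=> Xab t01 m mv mo my oside.
set l := pt a in oside *.
case: (boolP ((0 < turn o y l) && (0 < turn v o l))) => [/andP[lv ly]|nl].
  rewrite /in_triangle lv ly /= andbT.
  have : 0 < turn y v l * turn v o m by nra.
  by rewrite pmulr_lgt0.
exfalso.
have nl' : (turn o y l <= 0) || (turn v o l <= 0) by rewrite !leNgt -negb_and.
have [s [/andP[s0 s1] sv sy se]] := first_exit mv my nl'.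
set z := seg m l s.
have zab : z = seg (pt a) (pt b) (t * (1 - s)).
  by rewrite /z /m /l seg.unlock /=; congr (_, _); ring.
have ts : 0 <= t * (1 - s) <= 1 by move: t01 => /andP[t0 t1]; apply/andP; split; nra.
have zo : 0 < turn y v z.
  have : 0 < turn y v z * turn v o m.
    have h1 : turn y v z * turn v o m - turn v o z * turn y v m =
      s * (turn y v l * turn v o m - turn v o l * turn y v m) by rewrite /z !turn_seg; ring.
    have h2 : 0 < s * (turn y v l * turn v o m - turn v o l * turn y v m) by rewrite mulr_gt0.
    have h3 : 0 <= turn v o z * turn y v m by rewrite mulr_ge0 // /z turn_seg.
    by lra.
  by rewrite pmulr_lgt0.
have zB := bary z.
have mle : turn o y m = (1 - t) * turn o y (pt a) + t * turn o y (pt b) by rewrite /m turn_seg.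
have [la lb] : turn o y (pt a) <= 0 /\ turn o y (pt b) <= 0.
  apply: (W Xab ts (h := if turn v o z == 0 then turn y v z / turn v o y else turn v o z / turn v o y)).
  rewrite -zab; case: eqP => [z0|/eqP z0].
    apply/orP; left; rewrite (introT eqP (on_vo z0)) andbT divr_gt0 //= ler_pdivrMr // mul1r.
    by move: sv; rewrite -turn_seg -/z; lra.
  have zv : turn o y z = 0 by move: se; rewrite -!turn_seg -/z (negPf z0) orbF => /eqP.
  apply/orP; right; rewrite (introT eqP (on_oy zv)) andbT.
  move: sy; rewrite -turn_seg -/z => sy.
  by rewrite divr_ge0 ?(ltW D0) //= ltr_pdivrMr // mul1r; lra.
move: t01 => /andP[t0 t1]; nra.
Qed.

Lemma turn_vxz x z : turn v x z * turn v o y =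
  turn y v x * turn v o z - turn v o x * turn y v z.
Proof. rewrite turn.unlock; ring. Qed.

(** The point closest in angle to [v o] works: an edge hiding it would, by
    [trap], end in the triangle at a point still closer. *)
Lemma visible_in_triangle (x0 : V) (vV : V) : pt vV = v -> in_triangle v o y (pt x0) ->
  exists x : V, [/\ in_triangle v o y (pt x), visible X vV x &
    forall z : V, in_triangle v o y (pt z) -> turn v (pt z) (pt x) <= 0].
Proof.
move=> vE x0in.
pose r (x : V) := turn v o (pt x) / turn y v (pt x).
have [x xin xmin] := @arg_minP _ _ _ x0 (fun x => in_triangle v o y (pt x)) r x0in.
have closest z : in_triangle v o y (pt z) -> turn v (pt z) (pt x) <= 0.
  move=> zin; have := xmin z zin; have /and3P[_ zo _] := zin; have /and3P[_ xo _] := xin.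
  rewrite /r ler_pdivrMr // mulrAC ler_pdivlMr // => h.
  by rewrite -(pmulr_lle0 _ D0) turn_vxz; lra.
exists x; split=> //; apply/visibleP => a b Xab; apply/negP => c.
move: c; wlog ax : a b Xab / turn v (pt x) (pt a) < 0.
  move=> wl c; case: (ltP (turn v (pt x) (pt a)) 0) => [h|h]; first exact: (wl a b).
  apply: (wl b a).
  - by rewrite Xsym.
  - by case/andP: c => c1 _; rewrite vE in c1; exact: (mul_lt0_ge c1 h).
  - by rewrite cross_swapr.
move=> c; have [s [t [s01 t01 e]]] := cross_meet c.
rewrite vE in e c.
have /and3P[xv xo xy] := xin.
have mE : forall p q, turn p q (seg (pt a) (pt b) t) = (1 - s) * turn p q v + s * turn p q (pt x).
  by move=> p q; rewrite -e turn_seg.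
have [s0 s1] := andP s01; have [t0 t1] := andP t01.
have ain : in_triangle v o y (pt a).
  apply: (trap Xab (t := t)); rewrite ?mE.
  - by apply/andP; split; apply: ltW.
  - by rewrite (turn_rot v o y) addr_gt0 ?mulr_gt0 // subr_gt0.
  - by rewrite turn_abb mulr0 add0r mulr_ge0 // ltW.
  - by rewrite turn_aba mulr0 add0r mulr_gt0.
  - rewrite turn_abb turn_aba !mulr0 !add0r.
    rewrite (_ : _ - _ = s * (- (turn v (pt x) (pt a) * turn v o y))); last by rewrite turn_vxz; ring.
    by rewrite mulr_gt0 // oppr_gt0 nmulr_rlt0 .
have := closest a ain; rewrite turn_swapr oppr_le0 leNgt.
by rewrite ax.
Qed.

(** By [trap], an edge that enters through [v y] has its end in the triangle. *)
Lemma visible_of_hit a b t k (vV : V) : pt vV = v -> X a b -> 0 <= t <= 1 -> 0 < k < 1 ->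
  seg (pt a) (pt b) t = seg v y k -> turn v y (pt a) < 0 ->
  exists x : V, [/\ in_triangle v o y (pt x), visible X vV x &
    forall z : V, in_triangle v o y (pt z) -> turn v (pt z) (pt x) <= 0].
Proof.
move=> vE Xab t01 /andP[k0 k1] e na.
apply: (visible_in_triangle vE (x0 := a)).
apply: (trap Xab t01); rewrite e turn_seg.
- by rewrite turn_abb mulr0 addr0 mulr_gt0 ?subr_gt0 // (turn_rot v).
- by rewrite turn_abb turn_aba !mulr0 addr0.
- by rewrite turn_aba mulr0 add0r mulr_gt0.
- rewrite turn_aba !turn_seg !turn_abb turn_aba !mulr0 !add0r mulr0 subr0.
  by rewrite mulr_gt0 ?mulr_gt0 // (turn_swap v) oppr_gt0.
Qed.
End Cut.

(** * Bundles of edges leaving a vertex *)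

Section PlaneMore.
Variable R : realFieldType.
Implicit Types p q v w u s y : R * R.

Lemma eq_mul0 (d a b : R) : d != 0 -> (a - b) * d = 0 -> a = b.
Proof. by move=> d0 /eqP; rewrite mulf_eq0 (negPf d0) orbF subr_eq0 => /eqP. Qed.

Lemma on_line v w q y : turn v w q != 0 -> turn v q y = 0 ->
  y = seg v q (turn v w y / turn v w q).
Proof.
move=> d0 h; rewrite {1}(surjective_pairing y) seg.unlock /=; congr (_, _);
  apply: (eq_mul0 d0).
  rewrite (_ : _ * _ = (y.1 - v.1) * turn v w q - turn v w y * (q.1 - v.1)); last by field.
  rewrite (_ : _ - _ = - (turn v q y * (w.1 - v.1))); first by rewrite h mul0r oppr0.
  rewrite turn.unlock; ring.
rewrite (_ : _ * _ = (y.2 - v.2) * turn v w q - turn v w y * (q.2 - v.2)); last by field.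
rewrite (_ : _ - _ = - (turn v q y * (w.2 - v.2))); first by rewrite h mul0r oppr0.
rewrite turn.unlock; ring.
Qed.

Lemma seg_inj p q (s t : R) : p != q -> seg p q s = seg p q t -> s = t.
Proof.
rewrite seg.unlock => pq [e1 e2]; apply/eqP; apply: contraNT pq => st.
have d : s - t != 0 by rewrite subr_eq0.
have k1 : q.1 = p.1 by apply: (eq_mul0 d); move: e1 => /addrI e1; rewrite mulrC mulrBl e1 subrr.
have k2 : q.2 = p.2 by apply: (eq_mul0 d); move: e2 => /addrI e2; rewrite mulrC mulrBl e2 subrr.
by rewrite (surjective_pairing p) (surjective_pairing q) k1 k2.
Qed.

Lemma turn_segm p q (s t : R) y :
  turn (seg p q s) (seg p q t) y = (t - s) * turn p q y.
Proof. rewrite turn.unlock seg.unlock /=; ring. Qed.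

Lemma turn_seg2 p q y (s : R) : turn p (seg p q s) y = s * turn p q y.
Proof. rewrite turn.unlock seg.unlock /=; ring. Qed.

(** Seen from [v], the direction of [q] lies between those of [w] and [u], so the
    way from [u] to the line [v w] passes it. *)
Lemma meet_ray v w q u s (h0 t0 : R) : 0 < turn v w q -> 0 < turn v q u -> 0 < turn v w u ->
  0 < h0 -> 0 < t0 -> seg u s h0 = seg v w t0 ->
  exists h b, [/\ 0 < h < h0, 0 < b & seg u s h = seg v q b].
Proof.
move=> wq qu wu h00 t00 e.
have B0 : turn v q (seg u s h0) < 0.
  by rewrite e turn_seg turn_aba mulr0 add0r pmulr_rlt0 // turn_swapr oppr_lt0.
set A := turn v q u in qu *; set B := turn v q _ in B0.
have AB : 0 < A - B by lra.
set h := h0 * (A / (A - B)).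
have f01 : 0 < A / (A - B) < 1 by rewrite divr_gt0 //= ltr_pdivrMr // mul1r; lra.
have hE : seg u s h = seg u (seg u s h0) (A / (A - B)).
  have := seg_seg u s 0 h0 (A / (A - B)); rewrite seg0 => ->; congr seg; rewrite /h; ring.
have y0 : turn v q (seg u s h) = 0 by rewrite hE turn_seg -/A -/B; field; rewrite gt_eqF.
move: f01 => /andP[f0 f1].
exists h, (turn v w (seg u s h) / turn v w q); split.
- by rewrite /h mulr_gt0 //= -[ltRHS]mulr1 ltr_pM2l.
- rewrite divr_gt0 // hE turn_seg e turn_seg turn_aba turn_abb !(mulr0, addr0).
  by rewrite mulr_gt0 // subr_gt0.
- by apply: on_line => //; rewrite gt_eqF.
Qed.

End PlaneMore.

Definition gen_pos (R : realFieldType) (V : finType) (pt : V -> R * R) : Prop :=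
  forall a b c : V, a != b -> a != c -> b != c -> turn (pt a) (pt b) (pt c) != 0.

Section Wedge.
Variables (R : realFieldType) (V : finType) (pt : V -> R * R).
Hypothesis ptI : injective pt.
Hypothesis gp : gen_pos pt.

Notation tn a b c := (turn (pt a) (pt b) (pt c)).
Notation cr a b c d := (cross (pt a) (pt b) (pt c) (pt d)).
Notation sg a b t := (seg (pt a) (pt b) t).

Lemma tn0 a b c : a != b -> tn a b c = 0 -> c = a \/ c = b.
Proof.
move=> ab h; case: (eqVneq c a) => [|ca]; first by left.
case: (eqVneq c b) => [|cb]; first by right.
by have := gp ab (_ : a != c) (_ : b != c); rewrite ![_ == c]eq_sym ca cb h eqxx => /(_ isT isT).
Qed.

(** In general position a segment cannot pass through an end of another one, so
    two segments that meet cross properly or coincide. *)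
Lemma meetP a b c d s t : a != b -> c != d -> 0 < s < 1 -> 0 <= t <= 1 ->
  sg a b s = sg c d t -> cr a b c d \/ (c = a /\ d = b \/ c = b /\ d = a).
Proof.
move=> ab cd s01 t01 e.
have pab : pt a != pt b by rewrite (inj_eq ptI).
have end_no x : sg a b s = pt x -> False.
  move=> ex; have : tn a b x = 0 by rewrite -ex turn_seg turn_aba turn_abb; ring.
  have [s0 s1] := andP s01.
  case/(tn0 ab) => xE; rewrite xE in ex.
    by rewrite -{2}(seg0 (pt a) (pt b)) in ex; move/(seg_inj pab): ex => E; rewrite E ltxx in s0.
  by rewrite -{2}(seg1 (pt a) (pt b)) in ex; move/(seg_inj pab): ex => E; rewrite E ltxx in s1.
have t0 : t != 0 by apply/eqP => E; apply: (end_no c); rewrite e E seg0.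
have t1 : t != 1 by apply/eqP => E; apply: (end_no d); rewrite e E seg1.
have {}t01 : 0 < t < 1 by move: t01; rewrite !le_eqVlt eq_sym (negPf t0) (negPf t1).
case: (eqVneq (tn a b c) 0) => [n|n]; last by left; exact: meet_cross e n.
have h : (1 - t) * tn a b c + t * tn a b d = 0.
  by rewrite -turn_seg -e turn_seg turn_aba turn_abb; ring.
have n' : tn a b d = 0.
  by apply/eqP; move/eqP: h; rewrite n mulr0 add0r mulf_eq0 (negPf t0).
right; case: (tn0 ab n) => ca; case: (tn0 ab n') => db; rewrite ca db in cd *.
- by rewrite eqxx in cd.
- by left.
- by right.
- by rewrite eqxx in cd.
Qed.

Lemma cross_neq a b c d : cr a b c d -> [/\ a != b, c != d & [/\ a != c, a != d, b != c & b != d]].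
Proof.
case/andP => h1 h2.
have k1 : tn a b c != 0 by apply: contraTneq h1 => ->; rewrite mul0r ltxx.
have k2 : tn a b d != 0 by apply: contraTneq h1 => ->; rewrite mulr0 ltxx.
have k3 : tn c d a != 0 by apply: contraTneq h2 => ->; rewrite mul0r ltxx.
split; last split.
- by apply: contraNneq k1 => ->; rewrite turn_aab.
- by apply: contraNneq k3 => ->; rewrite turn_aab.
- by apply: contraNneq k1 => ->; rewrite turn_aba.
- by apply: contraNneq k2 => ->; rewrite turn_aba.
- by apply: contraNneq k1 => ->; rewrite turn_abb.
- by apply: contraNneq k2 => ->; rewrite turn_abb.
Qed.

(** [X] may touch [u s] only beyond its crossing with [p q]; the end [u], at
    parameter [0], is not counted as a contact. *)
Definition first_hit (X : rel V) (p q u s : V) : Prop :=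
  cr u s p q /\
  forall a b h k h' k', X a b -> 0 <= k <= 1 -> 0 <= k' <= 1 -> 0 < h' < h ->
    sg u s h = sg p q k -> sg u s h' <> sg a b k'.

(** Edges of [G] that leave [u] together: no point lies between two of them on the
    way to [p q]. For straight edges this replaces a homotopy class of edges. *)
Definition bundle (G X : rel V) (p q u : V) (S : {set V}) : Prop :=
  (forall s, s \in S -> G u s /\ first_hit X p q u s) /\
  (forall s s' x, s \in S -> s' \in S ->
    ~~ [&& 0 < tn u s s', 0 < tn u s x, 0 < tn u x s' & 0 < tn p q x * tn p q u]).

Section LeftArc.
Variables (G X : rel V) (v c c' : V).
Hypothesis Xsym : symmetric X.
Hypothesis Xirr : irreflexive X.
Hypothesis cc' : 0 < tn v c c'.
Hypothesis wedge_nbr : forall x, 0 < tn v c x -> 0 < tn v x c' -> ~~ X v x.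
Hypothesis c'_hit : exists a b, X a b /\ cr v c' a b.

(** The candidates for a new edge from [v] inside the sector [c v c']. *)
Definition window : {set V} :=
  [set z | [&& 0 < tn v c z, 0 < tn v z c' & visible pt X v z]].

(** The edge [u s] passes the ray from [v] to [e] at [e] or beyond it. *)
Definition above u s e : Prop :=
  exists b h, [/\ 1 <= b, 0 <= h <= 1 & sg u s h = sg v e b].

Lemma wedge_trans x y z : 0 < tn v c x -> 0 < tn v c y -> 0 < tn v c z ->
  0 < tn v x y -> 0 < tn v y z -> 0 < tn v x z.
Proof.
move=> cx cy cz xy yz.
have := plucker (pt v) (pt c) (pt x) (pt y) (pt z).
have h1 : 0 < tn v c x * tn v y z by rewrite mulr_gt0.
have h2 : 0 < tn v c z * tn v x y by rewrite mulr_gt0.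
move=> e; have : 0 < tn v c y * tn v x z by rewrite -e addr_gt0.
by rewrite pmulr_rgt0.
Qed.

Section Bundle.
Variables (w u : V) (S : {set V}).
Hypothesis wZ : w \in window.
Hypothesis wu : 0 < tn v w u.
Hypothesis BS : bundle G X v w u S.

Lemma crossing_points s : s \in S -> exists h t,
  [/\ 0 < h < 1, 0 < t < 1 & sg u s h = sg v w t].
Proof. by move=> sS; have [_ [c1 _]] := BS.1 _ sS; exact: cross_meet. Qed.

Lemma side_v s h t : 0 < h -> 0 < t -> sg u s h = sg v w t -> tn u s v < 0.
Proof.
move=> h0 t0 e.
have : h * tn u s v < 0.
  by rewrite -turn_seg2 e (turn_rot (pt v)) turn_seg turn_aba mulr0 add0r turn_swapr mulrN oppr_lt0 mulr_gt0.
by rewrite pmulr_rlt0.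
Qed.

Lemma wZ' : [/\ 0 < tn v c w, 0 < tn v w c' & visible pt X v w].
Proof. by move: wZ; rewrite inE => /and3P. Qed.

(** A point hidden from [v] behind the bundle, or behind [X], betrays a visible
    point below the bundle. *)
Lemma visible_below s q h t h1 b : s \in S -> 0 < h < 1 -> 0 < t < 1 -> sg u s h = sg v w t ->
  0 <= h1 < h -> 1 <= b -> 0 < tn v w q -> sg u s h1 = sg v q b -> ~~ visible pt X v q ->
  exists x, [/\ visible pt X v x, 0 < tn v w x, 0 < tn v x q & tn u s x < 0].
Proof.
move=> sS h01 t01 e /andP[h10 h1h] b1 wq ey /visiblePn[a0 [b0 [Xab cab]]].
have [_ wc' wvis] := wZ'.
have [h0 hlt1] := andP h01; have [t0 t1] := andP t01.
have b0' : 0 < b by lra.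
have vw : v != w by apply: contraTneq wu => ->; rewrite turn_aab ltxx.
set o := sg u s h; set y := sg u s h1.
have D0 : 0 < turn (pt v) o y.
  by rewrite /o /y e ey turn_seg2 turn_seg turn_aba mulr0 add0r !mulr_gt0.
have W : walls pt X (pt v) o y.
  move=> a b' k th Xa k01.
  have no_o tt : 0 < tt <= 1 -> sg a b' k <> seg (pt v) o tt.
    move=> /andP[tt0 tt1] E.
    have E2 : sg v w (tt * t) = sg a b' k.
      by rewrite E /o e -{2}(seg0 (pt v) (pt w)) seg_seg; congr seg; ring.
    have ab' : a != b' by apply: contraTneq Xa => ->; rewrite Xirr.
    have tt01 : 0 < tt * t < 1 by apply/andP; split; [rewrite mulr_gt0 | nra].
    case: (meetP vw ab' tt01 k01 E2).
      by apply/negP; move/visibleP: wvis; apply.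
    have nX : ~~ X v w by apply: wedge_nbr => //; have [] := wZ'.
    by case=> [] [av bw]; move: Xa; rewrite av bw; [|rewrite Xsym]; rewrite (negPf nX).
  case/orP => /andP[thb /eqP E]; first by case: (no_o th).
  have [th0 th1] := andP thb.
  case: (eqVneq th 0) => [z|nz].
    by case: (no_o 1); rewrite ?ltr01 ?lexx // E z seg0 seg1.
  have [_ [_ /(_ a b' h t (h + th * (h1 - h)) k Xa)]] := BS.1 _ sS.
  move=> K; exfalso; apply: K => //.
  - by apply/andP; split; apply: ltW.
  - by apply/andP; split; nra.
  - by rewrite E /o /y seg_seg.
have tri x : in_triangle (pt v) o y (pt x) ->
    [/\ 0 < tn v w x, 0 < tn v x q & tn u s x < 0].
  case/and3P => x1 x2 x3; split.
  - by move: x3; rewrite /o e turn_seg2 pmulr_rgt0.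
  - move: x2; rewrite -turn_rot /y ey turn_seg turn_aba mulr0 add0r pmulr_rgt0 //.
  - by move: x1; rewrite /o /y turn_segm nmulr_rgt0 // subr_lt0.
suff [x [xin xvis _]] : exists x, [/\ in_triangle (pt v) o y (pt x), visible pt X v x &
    forall z, in_triangle (pt v) o y (pt z) -> turn (pt v) (pt z) (pt x) <= 0].
  by have [x1 x2 x3] := tri x xin; exists x.
have [k1 [k2 [k101 k201 E]]] := cross_meet cab.
have vqa : tn v q a0 < 0 \/ tn v q b0 < 0.
  case/andP: cab => cab _; case: (ltP (tn v q a0) 0) => H; [by left|right].
  exact: mul_lt0_ge cab H.
have vy : forall z, turn (pt v) y z = b * turn (pt v) (pt q) z by move=> z; rewrite /y ey turn_seg2.
have kb : 0 < k1 / b < 1.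
  by move: k101 => /andP[k10 k11]; rewrite divr_gt0 //= ltr_pdivrMr // mul1r; lra.
have Ey : seg (pt v) y (k1 / b) = sg v q k1.
  rewrite /y ey -{1}(seg0 (pt v) (pt q)) seg_seg; congr seg; field; lra.
case: vqa => vqa.
  apply: (@visible_of_hit _ _ pt X Xsym (pt v) o y D0 W a0 b0 k2 (k1 / b) v) => //.
  - by move: k201 => /andP[? ?]; apply/andP; split; apply: ltW.
  - by rewrite Ey E.
  - by rewrite vy pmulr_rlt0.
apply: (@visible_of_hit _ _ pt X Xsym (pt v) o y D0 W b0 a0 (1 - k2) (k1 / b) v) => //.
- by rewrite Xsym.
- by move: k201 => /andP[? ?]; apply/andP; split; lra.
- by rewrite Ey E seg_rev; congr seg; ring.
- by rewrite vy pmulr_rlt0.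
Qed.

(** On its way to [v w] the edge [u s] passes the ray of [q], either before [q],
    crossing [v q], or beyond it. *)
Lemma bundle_at q s : s \in S -> 0 < tn v w q -> 0 < tn v q u ->
  exists h b, [/\ 0 < h < 1, 0 < b, sg u s h = sg v q b & b < 1 -> cr u s v q].
Proof.
move=> sS wq qu; have [h0 [t0 [h01 t01 e]]] := crossing_points sS.
have [h00 h0lt] := andP h01; have [t00 _] := andP t01.
have [h1 [b [/andP[h10 h1h] b0 E]]] := meet_ray wq qu wu h00 t00 e.
exists h1, b; split=> //; first by rewrite h10 (lt_trans h1h h0lt).
move=> b1.
have vq : v != q by apply: contraTneq qu => ->; rewrite turn_aab ltxx.
have us : u != s by have [_ [/cross_neq[]]] := BS.1 _ sS.
have h101 : 0 <= h1 <= 1 by rewrite (ltW h10) ltW // (lt_trans h1h h0lt).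
have b01 : 0 < b < 1 by rewrite b0.
rewrite crossC; case: (meetP vq us b01 h101 (esym E)) => // -[] [uE _].
  by move: wu; rewrite uE turn_aba ltxx.
by move: qu; rewrite uE turn_abb ltxx.
Qed.

Lemma not_below s x : s \in S -> tn u s x < 0 -> ~~ cr u s v x.
Proof.
move=> sS usx; have [h0 [t0 [h01 t01 e]]] := crossing_points sS.
have [h00 _] := andP h01; have [t00 _] := andP t01.
have usv := side_v h00 t00 e.
rewrite /cross negb_and -leNgt; apply/orP; left.
by rewrite mulr_le0 // ltW.
Qed.

(** The arc of directions swept by the whole bundle ends at the first of these
    points. *)
Definition blockers : {set V} :=
  [set z in window | (0 < tn v w z) && [exists s in S, ~~ cr u s v z]].

Lemma before_vw s h0 t0 h1 q b : 0 < h0 -> sg u s h0 = sg v w t0 ->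
  0 < b -> 0 < tn v w q -> sg u s h1 = sg v q b -> h1 < h0.
Proof.
move=> h00 e b0 wq E.
have T0 : (1 - h0) * tn v w u + h0 * tn v w s = 0.
  by rewrite -turn_seg e turn_seg turn_aba turn_abb; ring.
have T1 : 0 < (1 - h1) * tn v w u + h1 * tn v w s.
  by rewrite -turn_seg E turn_seg turn_aba mulr0 add0r mulr_gt0.
have : 0 < (h0 - h1) * tn v w u.
  rewrite (_ : _ * _ = h0 * ((1 - h1) * tn v w u + h1 * tn v w s) -
     h1 * ((1 - h0) * tn v w u + h0 * tn v w s)); last by ring.
  by rewrite T0 mulr0 subr0 mulr_gt0.
by rewrite pmulr_lgt0 // subr_gt0.
Qed.

Lemma blocker_x s q h1 b : s \in S -> 0 <= h1 -> 1 <= b ->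
  0 < tn v w q -> sg u s h1 = sg v q b -> ~~ visible pt X v q ->
  0 <= tn v q c' -> 0 <= tn v c q ->
  exists2 x, x \in blockers & 0 < tn v x q.
Proof.
move=> sS h10 b1 wq E nvis qc' cq.
have [h0 [t0 [h01 t01 e]]] := crossing_points sS.
have h1h : 0 <= h1 < h0.
  have [h00 _] := andP h01.
  by rewrite h10 /=; apply: (before_vw h00 e _ wq E); lra.
have [x [xvis wx xq usx]] := visible_below sS h01 t01 e h1h b1 wq E nvis.
have [cw wc' _] := wZ'.
exists x => //; rewrite !inE xvis wx andbT /=.
have xc' : 0 < tn v x c'.
  have := plucker (pt v) (pt w) (pt x) (pt q) (pt c').
  have k1 : 0 <= tn v w x * tn v q c' by rewrite mulr_ge0 // ltW.
  have k2 : 0 < tn v w c' * tn v x q by rewrite mulr_gt0.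
  by move=> k3; rewrite -(pmulr_rgt0 _ wq) -k3; lra.
have cx : 0 < tn v c x.
  have := plucker (pt v) (pt c) (pt w) (pt x) (pt q).
  have k1 : 0 <= tn v c q * tn v w x by rewrite mulr_ge0 // ltW.
  have k2 : 0 < tn v c w * tn v x q by rewrite mulr_gt0.
  by move=> k3; rewrite -(pmulr_lgt0 _ wq) -k3; lra.
by rewrite cx xc' /=; apply/existsP; exists s; rewrite sS not_below.
Qed.

(** An edge of the bundle that starts inside the sector does not sweep the
    directions beyond [u]: either [u] is visible, or something visible hides it. *)
Lemma u_blocks s : s \in S -> 0 < tn v u c' -> exists2 x, x \in blockers & x = u \/ 0 < tn v x u.
Proof.
move=> sS uc'; have [cw wc' _] := wZ'.
have cu : 0 < tn v c u.
  have := plucker (pt v) (pt c) (pt w) (pt u) (pt c').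
  have k1 : 0 < tn v c w * tn v u c' by rewrite mulr_gt0.
  have k2 : 0 < tn v c c' * tn v w u by rewrite mulr_gt0.
  by move=> k3; rewrite -(pmulr_lgt0 _ wc') -k3; lra.
case: (boolP (visible pt X v u)) => vu.
  exists u; last by left.
  rewrite !inE cu uc' vu wu /=; apply/existsP; exists s; rewrite sS /=.
  by rewrite /cross negb_and turn_aba mulr0 ltxx.
have E : sg u s 0 = sg v u 1 by rewrite seg0 seg1.
have [x xb xu] := blocker_x sS (lexx _) (lexx _) wu E vu (ltW uc') (ltW cu).
by exists x => //; right.
Qed.

Lemma window_wedge z : z \in window -> 0 < tn v c z.
Proof. by rewrite inE => /and3P[]. Qed.

Lemma blockersW z : z \in blockers -> z \in window.
Proof. by rewrite inE => /andP[]. Qed.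

Lemma first_blocker x : x \in blockers ->
  exists2 e, e \in blockers & forall z, z \in blockers -> ~~ (0 < tn v z e).
Proof.
move=> xb.
have [e eb emin] := @arg_minP _ _ _ x (mem blockers) (fun z => tn v c z / tn v z c') xb.
exists e => // z zb; rewrite -leNgt.
have := emin z zb.
have : e \in window by apply: blockersW.
have : z \in window by apply: blockersW.
rewrite !inE => /and3P[cz zc' _] /and3P[ce ec' _].
rewrite ler_pdivrMr // mulrAC ler_pdivlMr // => h.
have := plucker (pt v) (pt c) (pt z) (pt e) (pt c').
move=> k; have : tn v c c' * tn v z e <= 0 by lra.
by rewrite pmulr_rle0.
Qed.

(** A bundle that comes from the left across [v w] sweeps all directions from [w]
    up to some visible point [e], or up to the end of the sector. If one of its
    edges passed below [e], the point [e] would separate it from the others. *)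
Lemma left_arc : S != set0 ->
  (forall s, s \in S -> cr u s v c') \/
  exists e, [/\ e \in window, 0 < tn v w e & forall s, s \in S -> above u s e /\
    forall z, z \in window -> 0 <= tn v w z -> 0 < tn v z e -> cr u s v z].
Proof.
move=> /set0Pn[s1 s1S]; have [cw wc' _] := wZ'.
have vu : v != u by apply: contraTneq wu => <-; rewrite turn_aba ltxx.
have vc' : v != c' by apply: contraTneq wc' => <-; rewrite turn_aba ltxx.
have vw : v != w by apply: contraTneq wu => ->; rewrite turn_aab ltxx.
have c'nvis : ~~ visible pt X v c'.
  have [a [b [Xab cab]]] := c'_hit.
  by apply/negP => /visibleP /(_ a b Xab); rewrite cab.
case: (set_0Vmem blockers) => [b0|[x xb]].
  left=> s sS; have nob z : z \in blockers -> False by rewrite b0 inE.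
  have noc' h1 b : 0 <= h1 -> 1 <= b -> sg u s h1 = sg v c' b -> False.
    move=> h10 b1 E.
    by have [||z /nob] := blocker_x sS h10 b1 wc' E c'nvis; rewrite ?turn_abb ?lexx ?ltW.
  case: (ltP 0 (tn v c' u)) => [c'u|uc'].
    have [h [b [/andP[h0 _] b0' E below]]] := bundle_at sS wc' c'u.
    case: (ltP b 1) => [/below //|b1]; case: (noc' h b) => //; exact: ltW.
  case: (eqVneq u c') => [uc|uc].
    by case: (noc' 0 1); rewrite ?seg0 ?seg1 ?uc.
  have : 0 < tn v u c'.
    rewrite lt_neqAle eq_sym gp //=.
    by rewrite turn_swapr oppr_ge0.
  by move=> /(u_blocks sS)[z /nob].
have [e eb emin] := first_blocker xb; right; exists e.
have eW := blockersW eb.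
have [we /existsP[s0 /andP[s0S nb0]]] : 0 < tn v w e /\ [exists s in S, ~~ cr u s v e].
  by move: eb; rewrite inE => /andP[_ /andP[]].
have [ce ec' evis] : [/\ 0 < tn v c e, 0 < tn v e c' & visible pt X v e].
  by move: eW; rewrite inE => /and3P.
split=> // s sS; split; last first.
  move=> z zW wz ze; move: wz; rewrite le_eqVlt => /orP[/eqP wz|wz].
    have [z1|->] := tn0 vw (esym wz); last by have [_ []] := BS.1 _ sS.
    by move: ze; rewrite z1 turn_aab ltxx.
  apply: contraT => nb; have : z \in blockers.
    by rewrite inE zW wz /=; apply/existsP; exists s; rewrite sS.
  by move/emin; rewrite ze.
case: (eqVneq u e) => [ue|ue]; first by exists 1, 0; rewrite seg0 seg1 ue !lexx ler01.
have ve : v != e by apply: contraTneq ce => <-; rewrite turn_aba ltxx.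
case: (ltP 0 (tn v e u)) => [eu|ue'].
  have [h [b [h01 b0 E below]]] := bundle_at sS we eu.
  case: (lerP 1 b) => [b1|b1].
    by exists b, h; split=> //; move: h01 => /andP[? ?]; apply/andP; split; exact: ltW.
  exfalso.
  have [h' [b' [h01' b0' E' below']]] := bundle_at s0S we eu.
  have b1' : 1 <= b' by rewrite leNgt; apply: contra nb0 => /below'.
  have sv s2 : s2 \in S -> tn u s2 v < 0.
    move=> s2S; have [k0 [t0 [/andP[k00 _] /andP[t00 _] e0]]] := crossing_points s2S.
    exact: side_v k00 t00 e0.
  have q1 : (1 - b) * tn u s v + b * tn u s e = 0.
    by rewrite -turn_seg -E turn_seg turn_aba turn_abb; ring.
  have q2 : (1 - b') * tn u s0 v + b' * tn u s0 e = 0.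
    by rewrite -turn_seg -E' turn_seg turn_aba turn_abb; ring.
  have us0 : u != s0 by have [_ [/cross_neq[]]] := BS.1 _ s0S.
  have e1 : 0 < tn u s e.
    have : 0 < b * tn u s e.
      have := sv s sS; have : 0 < 1 - b by rewrite subr_gt0.
      move=> k1 k2; have : (1 - b) * tn u s v < 0 by rewrite pmulr_rlt0.
      by lra.
    by rewrite pmulr_rgt0.
  have e2 : 0 < tn u e s0.
    rewrite turn_swapr oppr_gt0 lt_neqAle; apply/andP; split.
      apply/eqP => /(tn0 us0)[E2|E2]; first by rewrite E2 eqxx in ue.
      have [_ [/andP[c1 _] _]] := BS.1 _ s0S.
      have : tn v w s0 < 0.
        have [_ [c2 _]] := BS.1 _ s0S; move: c2; rewrite crossC => /andP[c2 _].
        exact: mul_lt0_ge c2 (ltW wu).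
      by rewrite -E2; move: we; lra.
    have := sv s0 s0S => k2.
    have k1 : 0 <= (1 - b') * tn u s0 v by rewrite mulr_le0 ?(ltW k2) // subr_le0.
    have : b' * tn u s0 e <= 0 by lra.
    by rewrite pmulr_rle0.
  have e3 : 0 < tn u s s0.
    have ev : tn u e v < 0 by rewrite -turn_rot -turn_rot turn_swapr oppr_lt0.
    rewrite -(nmulr_llt0 _ ev).
    have := plucker (pt u) (pt s) (pt e) (pt s0) (pt v).
    have : tn u s e * tn u s0 v < 0 by rewrite pmulr_rlt0 ?sv.
    have : tn u s v * tn u e s0 < 0 by rewrite pmulr_llt0 ?sv.
    by lra.
  by have := BS.2 s s0 e sS s0S; rewrite e1 e2 e3 mulr_gt0.
exfalso.
have ue0 : 0 < tn v u e.
  rewrite lt_neqAle eq_sym gp //=.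
  by rewrite turn_swapr oppr_ge0.
have cu : 0 < tn v c u.
  have := plucker (pt v) (pt c) (pt w) (pt u) (pt e).
  have k1 : 0 < tn v c w * tn v u e by rewrite mulr_gt0.
  have k2 : 0 < tn v c e * tn v w u by rewrite mulr_gt0.
  by move=> k3; rewrite -(pmulr_lgt0 _ we) -k3; lra.
have uc' : 0 < tn v u c'.
  have := plucker (pt v) (pt c) (pt u) (pt e) (pt c').
  have k1 : 0 < tn v c u * tn v e c' by rewrite mulr_gt0.
  have k2 : 0 < tn v c c' * tn v u e by rewrite mulr_gt0.
  by move=> k3; rewrite -(pmulr_rgt0 _ ce) -k3; lra.
have [z zb [zu|zu]] := u_blocks sS uc'.
  by have := emin z zb; rewrite zu ue0.
have := emin z zb; have cz := window_wedge (blockersW zb).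
by rewrite (wedge_trans cz cu ce zu ue0).
Qed.

End Bundle.
End LeftArc.
End Wedge.

(** * Extending a safe plane set *)

Section Mirror.
Variable R : realFieldType.

Definition mirror (p : R * R) : R * R := (p.1, - p.2).

Lemma mirror_inj : injective mirror.
Proof. by move=> [a b] [c d] [-> /oppr_inj ->]. Qed.

Lemma turn_mirror p q r : turn (mirror p) (mirror q) (mirror r) = - turn p q r.
Proof. rewrite turn.unlock /mirror /=; ring. Qed.

Lemma seg_mirror p q t : seg (mirror p) (mirror q) t = mirror (seg p q t).
Proof. rewrite seg.unlock /mirror /=; congr (_, _); ring. Qed.

Lemma cross_mirror a b c d :
  cross (mirror a) (mirror b) (mirror c) (mirror d) = cross a b c d.
Proof. by rewrite /cross !turn_mirror !mulrNN. Qed.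

Lemma visible_mirror (V : finType) (pt : V -> R * R) X v x :
  visible (mirror \o pt) X v x = visible pt X v x.
Proof. by apply: eq_forallb => a; apply: eq_forallb => b; rewrite cross_mirror. Qed.

End Mirror.

Section Safe.
Variables (R : realFieldType) (V : finType) (pt : V -> R * R).
Hypothesis ptI : injective pt.
Hypothesis gp : gen_pos pt.

Notation tn a b c := (turn (pt a) (pt b) (pt c)).
Notation cr a b c d := (cross (pt a) (pt b) (pt c) (pt d)).
Notation sg a b t := (seg (pt a) (pt b) t).

(** [left_arc] in a mirror. *)
Lemma right_arc (G X : rel V) v c c' w u (S : {set V}) :
  symmetric X -> irreflexive X -> 0 < tn v c c' ->
  (forall x, 0 < tn v c x -> 0 < tn v x c' -> ~~ X v x) ->
  (exists a b, X a b /\ cr v c a b) ->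
  w \in window pt X v c c' -> tn v w u < 0 -> bundle pt G X v w u S -> S != set0 ->
  (forall s, s \in S -> cr u s v c) \/
  exists e, [/\ e \in window pt X v c c', tn v w e < 0 & forall s, s \in S -> above pt v u s e /\
    forall z, z \in window pt X v c c' -> tn v w z <= 0 -> tn v z e < 0 -> cr u s v z].
Proof.
move=> Xsym Xirr cc' nbr hit wW wu BS S0.
pose pt' := (@mirror R) \o pt.
have tnE a b d : turn (pt' a) (pt' b) (pt' d) = - tn a b d by rewrite turn_mirror.
have crE a b d e : cross (pt' a) (pt' b) (pt' d) (pt' e) = cr a b d e by rewrite cross_mirror.
have pt'I : injective pt' by apply: inj_comp => //; exact: mirror_inj.
have gp' : gen_pos pt' by move=> a b d ab ad bd; rewrite tnE oppr_eq0 gp.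
have WE z : (z \in window pt' X v c' c) = (z \in window pt X v c c').
  by rewrite !inE !tnE visible_mirror -!turn_swapr andbCA.
have BS' : bundle pt' G X v w u S.
  split=> [s sS|s s' x sS s'S].
    have [Gus [c1 h1]] := BS.1 s sS; split=> //; split; first by rewrite crE.
    move=> a b h k h' k' Xab k01 k'01 hh; rewrite !seg_mirror => /(@mirror_inj R) E /(@mirror_inj R).
    exact: (h1 a b h k h' k').
  have := BS.2 s' s x s'S sS; apply: contra => /and4P[k0 k1 k2 k3].
  by rewrite turn_swapr -tnE k0 turn_swapr -tnE k2 turn_swapr -tnE k1 -mulrNN -!tnE k3.
case: (@left_arc R V pt' pt'I gp' G X v c' c Xsym Xirr _ _ _ w u S _ _ BS' S0).
- by rewrite tnE -turn_swapr.
- by move=> x; rewrite !tnE -!turn_swapr => k1 k2; exact: nbr.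
- by have [a [b [Xab cab]]] := hit; exists a, b; rewrite crE.
- by rewrite WE.
- by rewrite tnE oppr_gt0.
- by move=> h; left=> s sS; rewrite -crE; exact: h.
move=> [e [eW we h]]; right; exists e; split; first by rewrite -WE.
  by rewrite -oppr_gt0 -tnE.
move=> s sS; have [[b [h1 [b1 h01 E]]] h2] := h s sS; split.
  by exists b, h1; split=> //; move: E; rewrite !seg_mirror => /(@mirror_inj R).
move=> z zW wz ze; rewrite -crE; apply: h2; rewrite ?WE // tnE ?oppr_ge0 ?oppr_gt0 //.
Qed.

(** Between the two rays the edges cut out two segments, whose ends follow each
    other on the two rays in opposite orders. *)
Lemma flip_cross v y z a b c d : 0 < tn v y z ->
  cr a b v y -> above pt v a b z -> cr c d v z -> above pt v c d y -> cr a b c d.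
Proof.
move=> yz cab [be [h2 [be1 h201 E2]]] ccd [al' [k1 [al1 k101 E3]]].
have [h1 [al [h101 al01 E1]]] := cross_meet cab.
have [k2 [be' [k201 be01 E4]]] := cross_meet ccd.
have [al0 al1'] := andP al01; have [be0 be1'] := andP be01.
have c0 : cross (sg a b h1) (sg a b h2) (sg c d k1) (sg c d k2).
  rewrite E1 E2 E3 E4.
  have Ty r s t : turn (sg v y r) (sg v z s) (sg v y t) = s * (r - t) * tn v y z.
    by rewrite turn.unlock seg.unlock /=; ring.
  have Tz r s t : turn (sg v y r) (sg v z s) (sg v z t) = r * (s - t) * tn v y z.
    by rewrite turn.unlock seg.unlock /=; ring.
  have be00 : 0 < be by lra.
  have al'0 : 0 < al' by lra.
  rewrite /cross !Ty !Tz; apply/andP; split.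
    have n1 : be * (al - al') * tn v y z < 0 by rewrite pmulr_llt0 // pmulr_rlt0 // subr_lt0; lra.
    by rewrite (nmulr_rlt0 _ n1) mulr_gt0 // mulr_gt0 // subr_gt0; lra.
  have n1 : 0 < be' * (al' - al) * tn v y z by rewrite mulr_gt0 // mulr_gt0 // subr_gt0; lra.
  by rewrite (pmulr_rlt0 _ n1) pmulr_llt0 // pmulr_rlt0 // subr_lt0; lra.
have [s [t [s01 t01 E]]] := cross_meet c0.
rewrite !seg_seg in E.
have in01 (x y' r : R) : 0 < x < 1 -> 0 <= y' <= 1 -> 0 < r < 1 -> 0 < x + r * (y' - x) < 1.
  by move=> /andP[? ?] /andP[? ?] /andP[? ?]; apply/andP; split; nra.
have q1 : 0 < h1 + s * (h2 - h1) < 1 by apply: in01.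
have q2 : 0 < k1 + t * (k2 - k1) < 1.
  rewrite (_ : _ + _ = k2 + (1 - t) * (k1 - k2)); last by ring.
  by apply: in01 => //; move: t01 => /andP[? ?]; apply/andP; split; lra.
have [ab _ _] := cross_neq cab; have [cd _ _] := cross_neq ccd.
have q2' : 0 <= k1 + t * (k2 - k1) <= 1 by move: q2 => /andP[? ?]; apply/andP; split; apply: ltW.
case: (meetP ptI gp ab cd q1 q2' E) => // same.
have : turn (sg a b h1) (sg a b h2) (sg c d k1) = 0.
  rewrite turn_segm; case: same => -[-> ->]; rewrite ?turn_seg ?turn_aba ?turn_abb; ring.
move: c0 => /andP[c0 _] z0; move: c0; rewrite z0 mul0r ltxx //.
Qed.

(** What bundles need of a bound on the number of crossings per edge. *)
Definition star_bounded (k : nat) (G : rel V) : Prop :=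
  forall a b u (S : {set V}), G a b -> (forall s, s \in S -> G u s /\ cr u s a b) -> (#|S| <= k)%N.

(** For bundles, the edges of a safe set behave like edges of [G]. *)
Definition safe (k : nat) (G X : rel V) : Prop :=
  forall p q u (S : {set V}), X p q -> bundle pt G X p q u S -> (#|S| <= k)%N.

Definition add_edge (X : rel V) (v w : V) : rel V :=
  fun a b => [|| X a b, (a == v) && (b == w) | (a == w) && (b == v)].

Lemma bundle_sym (G X : rel V) p q u S : bundle pt G X p q u S -> bundle pt G X q p u S.
Proof.
move=> [h1 h2]; split=> [s sS|s s' x sS s'S].
  have [Gus [c k1]] := h1 s sS; split=> //; split; first by rewrite cross_swapr.
  move=> a b h k h' k' Xab /andP[k0 k1'] k'01 hh E.
  apply: (k1 a b h (1 - k) h' k') => //; last by rewrite E seg_rev.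
  by apply/andP; split; lra.
by have := h2 s s' x sS s'S; rewrite ![tn q p _]turn_swap mulrNN.
Qed.

Lemma bundle_sub (G X Y : rel V) p q u S : (forall a b, X a b -> Y a b) ->
  bundle pt G Y p q u S -> bundle pt G X p q u S.
Proof.
move=> XY [h1 h2]; split=> // s sS; have [Gus [c k1]] := h1 s sS; split=> //.
by split=> // a b h k h' k' Xab; apply: k1; exact: XY.
Qed.

Section Extend.
Variables (k : nat) (G X : rel V) (v c c' : V).
Hypothesis Xsym : symmetric X.
Hypothesis Xirr : irreflexive X.
Hypothesis Gstar : star_bounded k G.
Hypothesis Xsafe : safe k G X.
Hypothesis Gc : G v c.
Hypothesis Gc' : G v c'.
Hypothesis cc' : 0 < tn v c c'.
Hypothesis wedge_nbr : forall x, 0 < tn v c x -> 0 < tn v x c' -> ~~ X v x.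
Hypothesis c_hit : exists a b, X a b /\ cr v c a b.
Hypothesis c'_hit : exists a b, X a b /\ cr v c' a b.
Let Z := window pt X v c c'.

(** More than [k] edges that sweep all directions from [w] to [e]. *)
Definition larc w e := exists u (S : {set V}), [/\ (k < #|S|)%N, forall s, s \in S -> G u s,
  e \in Z, 0 < tn v w e & forall s, s \in S -> above pt v u s e /\
    forall z, z \in Z -> 0 <= tn v w z -> 0 < tn v z e -> cr u s v z].

Definition rarc w e := exists u (S : {set V}), [/\ (k < #|S|)%N, forall s, s \in S -> G u s,
  e \in Z, tn v w e < 0 & forall s, s \in S -> above pt v u s e /\
    forall z, z \in Z -> tn v w z <= 0 -> tn v z e < 0 -> cr u s v z].

(** The old edges being safe, a witness against safety is a bundle across the new
    edge. *)
Lemma unsafe_arc w : w \in Z -> ~ safe k G (add_edge X v w) ->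
  (exists e, larc w e) \/ (exists e, rarc w e).
Proof.
move=> wZ; rewrite /safe => /existsNP[p /existsNP[q /existsNP[u /existsNP[S /not_implyP[Ypq]]]]].
move=> /not_implyP[BS /negP]; rewrite -ltnNge => kS.
have {}BS : bundle pt G X v w u S.
  have BS' := bundle_sub (fun a b (h : X a b) => introT or3P (Or31 _ _ h) : add_edge X v w a b) BS.
  case/or3P: Ypq => [Xpq|/andP[/eqP<- /eqP<-] //|/andP[/eqP<- /eqP<-]]; last exact: bundle_sym.
  by have := Xsafe Xpq BS'; rewrite leqNgt kS.
have S0 : S != set0 by rewrite -card_gt0 (leq_ltn_trans _ kS).
have GS s : s \in S -> G u s by case/BS.1.
case: (ltrgt0P (tn v w u)) => wu.
- left; case: (left_arc ptI gp Xsym Xirr cc' wedge_nbr c'_hit wZ wu BS S0).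
    move=> h; have := Gstar Gc' (fun s sS => conj (GS s sS) (h s sS)).
    by rewrite leqNgt kS.
  by move=> [e [eZ we h]]; exists e, u, S; split.
- right; case: (right_arc Xsym Xirr cc' wedge_nbr c_hit wZ wu BS S0).
    move=> h; have := Gstar Gc (fun s sS => conj (GS s sS) (h s sS)).
    by rewrite leqNgt kS.
  by move=> [e [eZ we h]]; exists e, u, S; split.
- exfalso; case/set0Pn: S0 => s sS; have [_ [/cross_neq[us vw [uv uw _ _]] _]] := BS.1 s sS.
  by case: (tn0 gp vw wu) => E; [rewrite E eqxx in uv | rewrite E eqxx in uw].
Qed.

(** Two arcs that overlap and turn in opposite ways flip, so that too many edges
    cross one edge of [G]. *)
Lemma arcs_clash w w' y u : w \in Z -> y \in Z ->
  larc w w' -> rarc y u -> 0 <= tn v w u -> 0 < tn v u w' -> tn v y w' <= 0 -> False.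
Proof.
move=> wZ yZ [a [S [kS GS w'Z ww' hS]]] [b [T [kT GT uZ yu hT]]] wu uw' yw'.
have [s sS] : exists s, s \in S by apply/card_gt0P; apply: leq_ltn_trans kS.
have [s_ab s_be] := hS s sS.
have c1 : cr a s v u by apply: s_be.
have : (#|T| <= k)%N.
  apply: (Gstar (GS s sS)) => t tT; split; first exact: GT.
  have [t_ab t_be] := hT t tT.
  have c2 : cr b t v w' by apply: t_be => //; rewrite turn_swapr oppr_lt0.
  by rewrite crossC; exact: (flip_cross uw' c1 s_ab c2 t_ab).
by rewrite leqNgt kT.
Qed.

Lemma Zwedge z : z \in Z -> 0 < tn v c z.
Proof. by rewrite inE => /and3P[]. Qed.

Lemma Z_trans x y z : x \in Z -> y \in Z -> z \in Z -> 0 < tn v x y -> 0 < tn v y z -> 0 < tn v x z.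
Proof. by move=> /Zwedge cx /Zwedge cy /Zwedge cz; exact: (wedge_trans cx cy cz). Qed.

Lemma Z_tn0 x y : x \in Z -> y \in Z -> tn v x y = 0 -> x = y.
Proof.
move=> xZ yZ h; have vx : v != x by apply: contraTneq (Zwedge xZ) => <-; rewrite turn_aba ltxx.
case: (tn0 gp vx h) => // yv; move: (Zwedge yZ); rewrite yv turn_aba ltxx //.
Qed.

(** Every window point right of [y] is straddled by an arc going left and ending
    no further than [y]. *)
Definition covered y := forall u, u \in Z -> 0 < tn v u y ->
  exists w w', [/\ w \in Z, larc w w', 0 <= tn v w u, 0 < tn v u w' & tn v y w' <= 0].

Lemma larcZ w e : larc w e -> e \in Z.
Proof. by case=> u [S []]. Qed.

(** At a covered point an arc to the right would clash; an arc to the left leads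
    to another covered point, further left, and so on without end. *)
Lemma not_covered y : (forall w, w \in Z -> (exists e, larc w e) \/ (exists e, rarc w e)) ->
  y \in Z -> ~ covered y.
Proof.
move=> arcs; have [m] := ubnP #|[set z in Z | 0 < tn v y z]|.
elim: m y => // m IH y ym yZ cov.
case: (arcs y yZ) => [[y' A]|[u A]]; last first.
  have [b [T [_ _ uZ yu _]]] := A.
  have [|w [w' [wZ B wu uw' yw']]] := cov u uZ; first by rewrite turn_swapr oppr_gt0.
  exact: arcs_clash B A wu uw' yw'.
have y'Z := larcZ A; have yy' : 0 < tn v y y' by case: A => b [T []].
apply: (IH y') => //.
  rewrite ltnS in ym; apply: leq_trans ym; apply: proper_card; apply/properP; split.
    apply/subsetP => z; rewrite ![_ \in [set _ in Z | _]]inE => /andP[zZ y'z]; rewrite zZ /=.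
    exact: Z_trans yy' y'z.
  by exists y'; rewrite ![_ \in [set _ in Z | _]]inE ?turn_abb ?ltxx ?andbF // y'Z.
move=> u uZ uy'; case: (ltrgt0P (tn v u y)) => uy.
- have [w [w' [wZ B wu uw' yw']]] := cov u uZ uy; exists w, w'; split=> //.
  rewrite turn_swapr oppr_le0.
  have w'Z := larcZ B.
  move: yw'; rewrite le_eqVlt => /orP[/eqP /(Z_tn0 yZ w'Z) <-|yw']; first exact: ltW.
  by apply: ltW; apply: Z_trans yy'; rewrite // turn_swapr oppr_gt0.
- exists y, y'; split=> //; rewrite ?turn_abb //.
  by rewrite turn_swapr oppr_ge0 ltW.
- have := Z_tn0 uZ yZ uy => uE; exists y, y'; split; rewrite ?uE ?turn_abb //.
Qed.

(** Otherwise every visible point carries an arc, and the rightmost one is covered,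
    since no point lies to its right. *)
Theorem extend_safe : Z != set0 -> exists2 w, w \in Z & safe k G (add_edge X v w).
Proof.
move=> /set0Pn[z0 z0Z]; apply: contrapT => none.
have arcs w : w \in Z -> (exists e, larc w e) \/ (exists e, rarc w e).
  by move=> wZ; apply: unsafe_arc => // sw; apply: none; exists w.
have [y yZ ymin] := @arg_minP _ _ _ z0 (mem Z) (fun z => tn v c z / tn v z c') z0Z.
apply: (not_covered arcs yZ) => u uZ uy; exfalso.
have := ymin u uZ.
have [cu uc' _] : [/\ 0 < tn v c u, 0 < tn v u c' & visible pt X v u] by move: uZ; rewrite inE => /and3P.
have [cy yc' _] : [/\ 0 < tn v c y, 0 < tn v y c' & visible pt X v y] by have : y \in Z := yZ; rewrite inE => /and3P.
rewrite ler_pdivrMr // mulrAC ler_pdivlMr // => h.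
have e := plucker (pt v) (pt c) (pt u) (pt y) (pt c').
have : tn v c c' * tn v u y <= 0 by lra.
by rewrite pmulr_rle0 // leNgt uy.
Qed.

End Extend.
End Safe.

(** * The first edge met *)

Definition plane_rel (R : realFieldType) (V : finType) (pt : V -> R * R) (X : rel V) : Prop :=
  forall a b c d, X a b -> X c d -> ~~ cross (pt a) (pt b) (pt c) (pt d).

Section FirstHit.
Variables (R : realFieldType) (V : finType) (pt : V -> R * R).
Hypothesis ptI : injective pt.
Hypothesis gp : gen_pos pt.

Notation tn a b c := (turn (pt a) (pt b) (pt c)).
Notation cr a b c d := (cross (pt a) (pt b) (pt c) (pt d)).
Notation sg a b t := (seg (pt a) (pt b) t).

Variables (X : rel V).
Hypothesis Xsym : symmetric X.
Hypothesis Xirr : irreflexive X.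
Hypothesis Xplane : plane_rel pt X.

Lemma first_hit_symm p q v c : first_hit pt X p q v c -> first_hit pt X q p v c.
Proof.
move=> [h1 h2]; split=> [|a b h k h' k' Xab /andP[k0 k1] k'01 hh E]; first by rewrite cross_swapr.
apply: (h2 a b h (1 - k) h' k') => //; last by rewrite E seg_rev.
by apply/andP; split; lra.
Qed.

Section Side.
Variables (p q v c0 : V) (h0 k0 k1 : R).
Hypothesis Xpq : X p q.
Hypothesis F : first_hit pt X p q v c0.
Hypothesis h001 : 0 < h0 < 1.
Hypothesis k001 : 0 < k0 < 1.
Hypothesis E0 : sg v c0 h0 = sg p q k0.
Hypothesis k0k1 : k0 < k1.
Hypothesis k11 : k1 <= 1.
Hypothesis qleft : 0 < tn v c0 q.
Let o := sg p q k0.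
Let y := sg p q k1.

Lemma turn_vo x : turn (pt v) o x = h0 * turn (pt v) (pt c0) x.
Proof. by rewrite /o -E0 turn_seg2. Qed.

Lemma side_pos : 0 < turn (pt v) (pt c0) y.
Proof.
have [k00 k0lt] := andP k001.
have e : (1 - k0) * tn v c0 p + k0 * tn v c0 q = 0.
  by rewrite -turn_seg -E0 turn_seg turn_aba turn_abb; ring.
rewrite /y turn_seg.
have k0' : 0 < 1 - k0 by lra.
rewrite -(pmulr_rgt0 _ k0').
have -> : (1 - k0) * ((1 - k1) * tn v c0 p + k1 * tn v c0 q) =
  (1 - k1) * ((1 - k0) * tn v c0 p + k0 * tn v c0 q) + (k1 - k0) * tn v c0 q by ring.
by rewrite e mulr0 add0r mulr_gt0 // subr_gt0.
Qed.

Lemma side_D : 0 < turn (pt v) o y.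
Proof. by have [h00 _] := andP h001; rewrite turn_vo mulr_gt0 // side_pos. Qed.

Lemma pq_neq : p != q.
Proof. by apply: contraTneq Xpq => ->; rewrite Xirr. Qed.

Lemma on_pq a b k k' : X a b -> 0 < k < 1 -> 0 <= k' <= 1 -> sg p q k = sg a b k' ->
  turn o y (pt a) <= 0 /\ turn o y (pt b) <= 0.
Proof.
move=> Xab k01 k'01 E.
have ab : a != b by apply: contraTneq Xab => ->; rewrite Xirr.
case: (meetP ptI gp pq_neq ab k01 k'01 E) => [c|]; first by have := Xplane Xpq Xab; rewrite c.
have op : turn o y (pt p) = 0 by rewrite turn_segm turn_aba mulr0.
have oq : turn o y (pt q) = 0 by rewrite turn_segm turn_abb mulr0.
by case=> -[-> ->]; rewrite op oq.
Qed.

(** The sector of [v] between the contact [o] and a point [y] of [p q] is closed: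
    the first contact makes a wall of [v o], planarity makes one of [o y]. *)
Lemma side_walls : walls pt X (pt v) o y.
Proof.
have [h00 h0lt] := andP h001; have [k00 k0lt] := andP k001.
move=> a b t th Xab t01 /orP[/andP[/andP[th0 th1] /eqP E]|/andP[/andP[th0 th1] /eqP E]].
  case: (eqVneq th 1) => [e1|n1].
    by apply: (on_pq Xab k001 t01); rewrite E e1 seg1.
  exfalso; have lt1 : th < 1 by rewrite lt_neqAle n1.
  have [_ /(_ a b h0 k0 (th * h0) t Xab)] := F.
  apply=> //; first by apply/andP; split; exact: ltW.
    by rewrite mulr_gt0 //= -[ltRHS]mul1r ltr_pM2r.
  by rewrite E /o -E0 -{2}(seg0 (pt v) (pt c0)) seg_seg; congr seg; ring.
apply: (on_pq (k := k0 + th * (k1 - k0)) Xab _ t01); last by rewrite E seg_seg.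
have m1 : 0 <= th * (k1 - k0) by rewrite mulr_ge0 // subr_ge0 ltW.
have m2 : 0 < (1 - th) * (1 - k0) by rewrite mulr_gt0 // subr_gt0.
have m3 : 0 <= th * (1 - k1) by rewrite mulr_ge0 // subr_ge0.
by apply/andP; split; lra.
Qed.

Lemma side_v_pos : 0 < tn p q v.
Proof.
have := side_D; rewrite -turn_rot -turn_rot turn_rot.
rewrite -turn_rot /o /y.
have -> : turn (sg p q k1) (pt v) (sg p q k0) = (k1 - k0) * tn p q v.
  by rewrite -turn_rot -turn_rot turn_segm.
by rewrite pmulr_rgt0 // subr_gt0.
Qed.

Lemma side_tri x : in_triangle (pt v) o y (pt x) ->
  [/\ 0 < tn p q x, 0 < turn (pt v) (pt x) y & 0 < tn v c0 x].
Proof.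
case/and3P => x1 x2 x3; have [h00 _] := andP h001; split.
- by move: x1; rewrite turn_segm pmulr_rgt0 // subr_gt0.
- by move: x2; rewrite -turn_rot.
- by move: x3; rewrite turn_vo pmulr_rgt0.
Qed.
End Side.

(** With no visible point between two directions, both first meet the same edge,
    and nothing lies in front of it. *)
Lemma next_hit_left v c0 c p q : X p q -> first_hit pt X p q v c0 -> 0 < tn v c0 c ->
  0 < tn v c0 q -> ~~ visible pt X v c ->
  (forall x, 0 < tn v c0 x -> 0 < tn v x c -> ~~ visible pt X v x) ->
  first_hit pt X p q v c /\
  forall x, ~~ [&& 0 < tn v c0 x, 0 < tn v x c & 0 < tn p q x * tn p q v].
Proof.
move=> Xpq F c0c c0q cnv nov.
have [h0 [k0 [h001 k001 E0]]] := cross_meet F.1.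
have [h00 h0lt] := andP h001; have [k00 k0lt] := andP k001.
have vc0 : v != c0 by apply: contraTneq c0c => ->; rewrite turn_aab ltxx.
have vc : v != c by apply: contraTneq c0c => <-; rewrite turn_aba ltxx.
have vq : v != q by apply: contraTneq c0q => <-; rewrite turn_aba ltxx.
have pq : p != q by apply: contraTneq Xpq => ->; rewrite Xirr.
have D1 := side_D h001 k001 E0 k0lt c0q.
have W1 := side_walls Xpq F h001 k001 E0 k0lt (lexx 1).
(* an edge hiding [x0] from [v], with [x0] on the ray of [y] or beyond *)
have hidden k1 x0 b : k0 < k1 -> k1 <= 1 -> 0 < b -> sg p q k1 = sg v x0 b ->
    0 <= tn v x0 c -> 0 < tn v c0 x0 ->
    (forall a b' k k', X a b' -> 0 < k < b -> 0 <= k' <= 1 -> sg v x0 k = sg a b' k' ->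
       tn v x0 a < 0 -> False).
  move=> k0k1 k11 b0 Ey x0c c0x0 a b' k k' Xab /andP[kk0 kk1] k'01 E na.
  have D := side_D h001 k001 E0 k0k1 c0q.
  have W := side_walls Xpq F h001 k001 E0 k0k1 k11.
  have kb : 0 < k / b < 1 by rewrite divr_gt0 //= ltr_pdivrMr // mul1r.
  have E' : sg a b' k' = seg (pt v) (sg p q k1) (k / b).
    rewrite -E Ey -{2}(seg0 (pt v) (pt x0)) seg_seg; congr seg; field; lra.
  have na' : turn (pt v) (sg p q k1) (pt a) < 0 by rewrite Ey turn_seg2 pmulr_rlt0.
  have [x [xin xvis _]] := visible_of_hit Xsym D W (erefl _) Xab k'01 kb E' na'.
  have [x1 x2 x3] := side_tri h001 E0 k0k1 xin.
  have xx0 : 0 < tn v x x0.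
    by move: x2; rewrite Ey turn_seg turn_aba mulr0 add0r pmulr_rgt0.
  have xc : 0 < tn v x c.
    have := plucker (pt v) (pt c0) (pt x) (pt x0) (pt c).
    have m1 : 0 <= tn v c0 x * tn v x0 c by rewrite mulr_ge0 // ltW.
    have m2 : 0 < tn v c0 c * tn v x x0 by rewrite mulr_gt0.
    by move=> e; rewrite -(pmulr_rgt0 _ c0x0) -e; lra.
  by have := nov x x3 xc; rewrite xvis.
have hid_vis k1 x0 b : k0 < k1 -> k1 <= 1 -> 1 <= b -> sg p q k1 = sg v x0 b ->
    0 <= tn v x0 c -> 0 < tn v c0 x0 -> ~~ visible pt X v x0 -> False.
  move=> k0k1 k11 b1 Ey x0c c0x0 /visiblePn[a [b' [Xab cab]]].
  have [k [k' [/andP[kk0 kk1] /andP[k'0 k'1] E]]] := cross_meet cab.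
  have kb : 0 < k < b by rewrite kk0 (lt_le_trans kk1).
  have b0 : 0 < b by lra.
  have k'01 : 0 <= k' <= 1 by rewrite !ltW.
  case/andP: cab => cab _; case: (ltP (tn v x0 a) 0) => na.
    exact: (hidden k1 x0 b k0k1 k11 b0 Ey x0c c0x0 a b' k k').
  have nb := mul_lt0_ge cab na.
  apply: (hidden k1 x0 b k0k1 k11 b0 Ey x0c c0x0 b' a k (1 - k')) => //.
  - by rewrite Xsym.
  - by move: k'01 => /andP[? ?]; apply/andP; split; lra.
  - by rewrite E seg_rev; congr seg; ring.
have Eq : sg p q 1 = sg v q 1 by rewrite !seg1.
case: (ltrgt0P (tn v c q)) => cq; last first.
- have [qv|qc] := tn0 gp vc cq; first by rewrite qv eqxx in vq.
  by case: (hid_vis 1 q 1); rewrite ?lexx ?ltr01 // qc ?turn_abb.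
- have qc : 0 < tn v q c by rewrite turn_swapr oppr_gt0.
  by case: (hid_vis 1 q 1); rewrite ?lexx ?ltr01 // ?(ltW qc) // nov.
have Eqp : sg q p (1 - k0) = sg v c0 h0 by rewrite seg_rev E0; congr seg; ring.
have k0' : 0 < 1 - k0 by lra.
have [h [b [/andP[hh0 hh1] b0 Eh]]] := meet_ray c0c cq c0q k0' h00 Eqp.
have Ey : sg p q (1 - h) = sg v c b by rewrite -Eh [in RHS]seg_rev.
have k0k1 : k0 < 1 - h by lra.
have k11 : 1 - h <= 1 by lra.
have h01 : 0 < 1 - h < 1 by apply/andP; split; lra.
have h01' : 0 <= 1 - h <= 1 by apply/andP; split; lra.
have cc0 : 0 <= tn v c c by rewrite turn_abb.
have b1 : b < 1.
  rewrite ltNge; apply/negP => b1.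
  exact: (hid_vis (1 - h) c b k0k1 k11 b1 Ey cc0 c0c cnv).
have b01 : 0 < b < 1 by rewrite b0.
have ccr : cr v c p q.
  case: (meetP ptI gp vc pq b01 h01' (esym Ey)) => // -[[_ qE]|[_ qE]].
    by move: cq; rewrite qE turn_abb ltxx.
  by rewrite qE eqxx in vq.
split.
  split=> // a b' k k1 k' k2 Xab k01 k201 /andP[kk' kk] Ek E.
  have kb : k = b.
    have z1 : (1 - k) * tn p q v + k * tn p q c = 0.
      by rewrite -turn_seg Ek turn_seg turn_aba turn_abb; ring.
    have z2 : (1 - b) * tn p q v + b * tn p q c = 0.
      by rewrite -turn_seg -Ey turn_seg turn_aba turn_abb; ring.
    have nz : tn p q v - tn p q c != 0.
      move: ccr => /andP[_]; case: eqP => // nz; have -> : tn p q c = tn p q v by lra.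
      by rewrite -expr2 ltNge sqr_ge0.
    apply/eqP; rewrite -subr_eq0; apply/eqP; apply: (eq_mul0 nz); rewrite subr0.
    by lra.
  have ab : a != b' by apply: contraTneq Xab => ->; rewrite Xirr.
  have k'01 : 0 < k' < 1 by apply/andP; split; lra.
  case: (meetP ptI gp vc ab k'01 k201 E) => [cab|same]; last first.
    have Xvc : X v c by case: same => -[<- <-] //; rewrite Xsym.
    by have := Xplane Xvc Xpq; rewrite ccr.
  have k'b : 0 < k' < b by rewrite kk' -kb.
  case/andP: cab => cab _; case: (ltP (tn v c a) 0) => na.
    exact: (hidden (1 - h) c b k0k1 k11 b0 Ey cc0 c0c a b' k' k2).
  have nb := mul_lt0_ge cab na.
  apply: (hidden (1 - h) c b k0k1 k11 b0 Ey cc0 c0c b' a k' (1 - k2)) => //.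
  - by rewrite Xsym.
  - by move: k201 => /andP[? ?]; apply/andP; split; lra.
  - by rewrite E seg_rev; congr seg; ring.
move=> x; apply/negP => /and3P[c0x xc xs].
have D := side_D h001 k001 E0 k0k1 c0q.
have W := side_walls Xpq F h001 k001 E0 k0k1 k11.
have vs := side_v_pos h001 k001 E0 k0k1 c0q.
have xin : in_triangle (pt v) (sg p q k0) (sg p q (1 - h)) (pt x).
  apply/and3P; split.
  - by rewrite turn_segm mulr_gt0 ?subr_gt0 //; move: xs; rewrite pmulr_lgt0.
  - by rewrite -turn_rot Ey turn_seg turn_aba mulr0 add0r mulr_gt0.
  - by rewrite (turn_vo E0) mulr_gt0.
have [z [zin zvis _]] := visible_in_triangle Xsym D W (erefl _) xin.
have [_ z2 z3] := side_tri h001 E0 k0k1 zin.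
have zc : 0 < tn v z c by move: z2; rewrite Ey turn_seg turn_aba mulr0 add0r pmulr_rgt0.
by have := nov z z3 zc; rewrite zvis.
Qed.

End FirstHit.

(** * Edges that cross the base of an empty triangle *)

Section Class.
Variables (R : realFieldType) (V : finType) (pt : V -> R * R).
Hypothesis ptI : injective pt.
Hypothesis gp : gen_pos pt.

Notation tn a b c := (turn (pt a) (pt b) (pt c)).
Notation cr a b c d := (cross (pt a) (pt b) (pt c) (pt d)).
Notation sg a b t := (seg (pt a) (pt b) t).

Section Bundles.
Variables (X : rel V).
Hypothesis Xsym : symmetric X.
Hypothesis Xirr : irreflexive X.
Hypothesis Xplane : plane_rel pt X.

Lemma next_hit v c0 c p q : X p q -> first_hit pt X p q v c0 -> 0 < tn v c0 c ->
  ~~ visible pt X v c ->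
  (forall x, 0 < tn v c0 x -> 0 < tn v x c -> ~~ visible pt X v x) ->
  first_hit pt X p q v c /\
  forall x, ~~ [&& 0 < tn v c0 x, 0 < tn v x c & 0 < tn p q x * tn p q v].
Proof.
move=> Xpq F c0c cnv nov.
case: (ltP 0 (tn v c0 q)) => c0q.
  exact: (next_hit_left ptI gp Xsym Xirr Xplane Xpq F c0c c0q cnv nov).
have c0p : 0 < tn v c0 p.
  by case/andP: F.1 => c1 _; rewrite mulrC in c1; exact: mul_lt0_le c1 c0q.
rewrite Xsym in Xpq.
have [F' h] := next_hit_left ptI gp Xsym Xirr Xplane Xpq (first_hit_symm F) c0c c0p cnv nov.
split; first exact: first_hit_symm.
by move=> x; have := h x; rewrite ![tn q p _]turn_swap mulrNN.
Qed.

Lemma first_hit_exists v c : ~~ visible pt X v c ->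
  exists p q, X p q /\ first_hit pt X p q v c.
Proof.
move=> /visiblePn[a0 [b0 [Xab0 cab0]]].
pose r (e : V * V) := tn e.1 e.2 v / (tn e.1 e.2 v - tn e.1 e.2 c).
have e0P : X (a0, b0).1 (a0, b0).2 && cr v c (a0, b0).1 (a0, b0).2 by rewrite Xab0.
have [[p q] /= /andP[Xpq cpq] emin] := @arg_minP _ _ _ (a0, b0)
  (fun e : V * V => X e.1 e.2 && cr v c e.1 e.2) r e0P.
exists p, q; split=> //; split=> // a b h k h' k' Xab k01 k'01 /andP[h'0 h'h] E E'.
have [vc pq _] := cross_neq cpq.
have ab : a != b by apply: contraTneq Xab => ->; rewrite Xirr.
have par x y l m : cr v c x y -> sg v c l = sg x y m -> l = r (x, y).
  move=> cxy e; have nz : tn x y v - tn x y c != 0.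
    move: cxy => /andP[_]; case: eqP => // nz; have -> : tn x y c = tn x y v by lra.
    by rewrite -expr2 ltNge sqr_ge0.
  have z : (1 - l) * tn x y v + l * tn x y c = 0.
    by rewrite -turn_seg e turn_seg turn_aba turn_abb; ring.
  rewrite /r /=; apply: (eq_mul0 nz); rewrite mulrBl divfK //; lra.
have hr := par p q h k cpq E.
have [h0 [k0 [/andP[h00 h0lt] _ E0]]] := cross_meet cpq.
have hh0 : h < 1 by rewrite hr -(par p q h0 k0 cpq E0).
have h'01 : 0 < h' < 1 by rewrite h'0 (lt_trans h'h hh0).
case: (meetP ptI gp vc ab h'01 k'01 E') => [cab|same].
  have := emin (a, b); rewrite /= Xab cab => /(_ isT).
  by rewrite -hr -(par a b h' k' cab E') leNgt h'h.
have Xvc : X v c by case: same => -[<- <-] //; rewrite Xsym.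
by have := Xplane Xvc Xpq; rewrite cpq.
Qed.

End Bundles.

End Class.

Section Class2.
Variables (R : realFieldType) (V : finType) (pt : V -> R * R).
Hypothesis ptI : injective pt.
Hypothesis gp : gen_pos pt.

Notation tn a b c := (turn (pt a) (pt b) (pt c)).
Notation cr a b c d := (cross (pt a) (pt b) (pt c) (pt d)).
Notation sg a b t := (seg (pt a) (pt b) t).

Lemma first_hit_mirror (X : rel V) p q v c :
  first_hit (@mirror R \o pt) X p q v c <-> first_hit pt X p q v c.
Proof.
rewrite /first_hit cross_mirror; split=> -[c1 h]; split=> // a b k k0 k' k1 Xab k01 k11 kk.
  by move=> E E'; apply: (h a b k k0 k' k1 Xab k01 k11 kk); rewrite !seg_mirror ?E ?E'.
by rewrite !seg_mirror => /(@mirror_inj R) E /(@mirror_inj R); exact: (h a b k k0 k' k1).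
Qed.

(** Edges with no visible point between them first meet the same edge of [X]. *)
Lemma bundle_of_class (G X : rel V) v (C : {set V}) :
  symmetric X -> irreflexive X -> plane_rel pt X -> irreflexive G -> C != set0 ->
  (forall c, c \in C -> G v c /\ ~~ visible pt X v c) ->
  (forall c c' x, c \in C -> c' \in C -> 0 < tn v c c' -> 0 < tn v c x -> 0 < tn v x c' ->
     ~~ visible pt X v x) ->
  exists p q, X p q /\ bundle pt G X p q v C.
Proof.
move=> Xsym Xirr Xplane Girr /set0Pn[c0 c0C] GC nov.
have [p [q [Xpq F]]] := first_hit_exists ptI gp Xsym Xirr Xplane (GC _ c0C).2.
have vc c : c \in C -> v != c.
  by move=> cC; apply: contraTneq (GC c cC).1 => <-; rewrite Girr.
have first c : c \in C -> first_hit pt X p q v c.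
  move=> cC; case: (ltrgt0P (tn v c0 c)) => c0c.
  - have [F' _] := next_hit ptI gp Xsym Xirr Xplane Xpq F c0c (GC _ cC).2
      (fun x => nov c0 c x c0C cC c0c).
    exact: F'.
  - pose pt' := (@mirror R) \o pt.
    have tnE a b d : turn (pt' a) (pt' b) (pt' d) = - tn a b d by rewrite turn_mirror.
    have pt'I : injective pt' by apply: inj_comp => //; exact: mirror_inj.
    have gp' : gen_pos pt' by move=> a b d ab ad bd; rewrite tnE oppr_eq0 gp.
    have pl' : plane_rel pt' X by move=> a b d e; rewrite cross_mirror; exact: Xplane.
    apply/first_hit_mirror; have F0 := (first_hit_mirror X p q v c0).2 F.
    have cc0 : 0 < turn (pt' v) (pt' c0) (pt' c) by rewrite tnE oppr_gt0.
    have cnv : ~~ visible pt' X v c by rewrite visible_mirror; exact: (GC _ cC).2.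
    have [|F' _] := next_hit pt'I gp' Xsym Xirr pl' Xpq F0 cc0 cnv; last by [].
    move=> x; rewrite !tnE visible_mirror -!turn_swapr => k1 k2.
    by apply: (nov c c0) => //; rewrite turn_swapr oppr_gt0.
  - by have [cv|->//] := tn0 gp (vc _ c0C) c0c; have := vc _ cC; rewrite cv eqxx.
exists p, q; split=> //; split=> [c cC|c c' x cC c'C].
  by split; [exact: (GC _ cC).1 | exact: first].
apply/negP => /and4P[cc' cx xc' xs].
have [_ h] := next_hit ptI gp Xsym Xirr Xplane Xpq (first c cC) cc' (GC _ c'C).2
  (fun x => nov c c' x cC c'C cc').
by have := h x; rewrite cx xc' xs.
Qed.

(** An empty triangle appears three times, once from each vertex. *)
Definition tri (T : rel V) (v a b : V) : bool :=
  [&& T v a, T a b, T b v, 0 < tn v a b &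
    [forall x, ~~ [&& 0 < tn v a x, 0 < tn a b x & 0 < tn b v x]]].

Lemma tri_rot T v a b : tri T v a b = tri T a b v.
Proof.
rewrite /tri (turn_rot (pt v)); case: (T v a); case: (T a b); case: (T b v) => //=.
by congr (_ && _); apply: eq_forallb => x; rewrite andbC -andbA.
Qed.

Lemma four_turns p q r (s : R * R) : turn p q s + turn q r s + turn r p s = turn p q r.
Proof. rewrite turn.unlock; ring. Qed.

(** The edges that enter the triangle at [v] and leave it through the opposite
    side. *)
Definition class (G : rel V) (v a b : V) : {set V} :=
  [set c | G v c & cr v c a b].

Lemma class_side v a b c : 0 < tn v a b -> cr v c a b ->
  [/\ 0 < tn v a c, 0 < tn v c b & tn a b c < 0].
Proof.
move=> vab /andP[c1 c2].
have abc : tn a b c < 0 by apply: mul_lt0_ge c2 _; rewrite (turn_rot (pt v)) ltW.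
have F := four_turns (pt v) (pt a) (pt b) (pt c).
rewrite -(turn_rot (pt b) (pt v) (pt c)) in F.
case: (ltP 0 (tn v c b)) => cb.
  split=> //.
  by rewrite turn_swapr oppr_gt0; rewrite mulrC in c1; apply: mul_lt0_ge c1 (ltW cb).
have ca : 0 < tn v c a by rewrite mulrC in c1; apply: mul_lt0_le c1 cb.
by exfalso; move: ca; rewrite turn_swapr; lra.
Qed.

(** Such an edge would cross the opposite side or end inside the triangle. *)
Lemma tri_no_nbr (T : rel V) v a b x : irreflexive T -> symmetric T -> plane_rel pt T ->
  tri T v a b -> T v x ->
  0 < tn v a x -> 0 < tn v x b -> False.
Proof.
move=> Tirr Tsym Tpl /and5P[Tva Tab Tbv vab /forallP /(_ x) emp] Tvx ax xb.
have ab : a != b by apply: contraTneq Tab => ->; rewrite Tirr.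
case: (ltrgt0P (tn a b x)) => abx.
- by move: emp; rewrite ax abx -(turn_rot (pt b)) xb.
- have := Tpl _ _ _ _ Tvx Tab; rewrite /cross negb_and -!leNgt.
  have -> : (0 <= tn v x a * tn v x b) = false.
    by apply/negbTE; rewrite -ltNge pmulr_llt0 // turn_swapr oppr_lt0.
  have -> // : (0 <= tn a b v * tn a b x) = false.
  by apply/negbTE; rewrite -ltNge pmulr_rlt0 // turn_rot.
- by case: (tn0 gp ab abx) => E; [move: ax | move: xb]; rewrite E turn_abb ltxx.
Qed.

(** If a visible point separates two edges of the class, [extend_safe] contradicts
    the maximality of [X]. Otherwise the class is a bundle, and [X] is safe. *)
Theorem class_le (k : nat) (G X T : rel V) v a b :
  symmetric X -> irreflexive X -> symmetric T -> irreflexive T -> irreflexive G ->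
  plane_rel pt T -> (forall x y, X x y -> T x y) ->
  star_bounded pt k G -> safe pt k G X ->
  (forall x y, G x y -> ~~ X x y -> ~~ visible pt X x y) ->
  (forall x y, x != y -> visible pt X x y -> ~~ X x y -> ~ safe pt k G (add_edge X x y)) ->
  tri T v a b -> (#|class G v a b| <= k)%N.
Proof.
move=> Xsym Xirr Tsym Tirr Girr Tpl XT Gst Xsafe Ghit Xmax tr.
have Xpl : plane_rel pt X by move=> p q r s Xpq Xrs; apply: Tpl; exact: XT.
have [Tva Tab Tbv vab _] := and5P tr.
rewrite leqNgt; apply/negP => kC.
set C := class G v a b in kC.
have C0 : C != set0 by rewrite -card_gt0 (leq_ltn_trans _ kC).
have CP c : c \in C -> [/\ G v c, 0 < tn v a c, 0 < tn v c b & ~~ visible pt X v c].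
  rewrite inE => /andP[Gvc cvc]; have [h1 h2 _] := class_side vab cvc; split=> //.
  apply: Ghit => //; apply/negP => /XT Tvc.
  by have := Tpl _ _ _ _ Tvc Tab; rewrite cvc.
case: (pselect (exists c c' x, [/\ c \in C, c' \in C & [/\ 0 < tn v c c', 0 < tn v c x, 0 < tn v x c' & visible pt X v x]])).
  move=> [c [c' [x [cC c'C [cc' cx xc' xvis]]]]].
  have [Gvc ac cb cnv] := CP c cC; have [Gvc' ac' c'b c'nv] := CP c' c'C.
  have nbr y : 0 < tn v c y -> 0 < tn v y c' -> ~~ X v y.
    move=> cy yc'; apply/negP => /XT Tvy.
    apply: (tri_no_nbr Tirr Tsym Tpl tr Tvy).
      have e := plucker (pt v) (pt a) (pt c) (pt y) (pt c').
      have m1 : 0 < tn v a c * tn v y c' by rewrite mulr_gt0.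
      have m2 : 0 < tn v a c' * tn v c y by rewrite mulr_gt0.
      by rewrite -(pmulr_lgt0 _ cc') -e addr_gt0.
    have e := plucker (pt v) (pt c) (pt y) (pt c') (pt b).
    have m1 : 0 < tn v c y * tn v c' b by rewrite mulr_gt0.
    have m2 : 0 < tn v c b * tn v y c' by rewrite mulr_gt0.
    by rewrite -(pmulr_rgt0 _ cc') -e addr_gt0.
  have hit y : ~~ visible pt X v y -> exists p q, X p q /\ cr v y p q by exact: visiblePn.
  have Z0 : window pt X v c c' != set0 by apply/set0Pn; exists x; rewrite inE cx xc' xvis.
  have [w wZ sw] := extend_safe ptI gp Xsym Xirr Gst Xsafe Gvc Gvc' cc' nbr (hit c cnv) (hit c' c'nv) Z0.
  move: wZ; rewrite inE => /and3P[cw wc' wvis].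
  apply: (Xmax v w) => //; last exact: nbr.
  by apply: contraTneq cw => <-; rewrite turn_aba ltxx.
move=> none.
have [||p [q [Xpq B]]] := @bundle_of_class G X v C Xsym Xirr Xpl Girr C0.
- by move=> c /CP[].
- move=> c c' x cC c'C cc' cx xc'; apply/negP => xvis; apply: none.
  by exists c, c', x.
by have := Xsafe _ _ _ _ Xpq B; rewrite leqNgt kC.
Qed.

End Class2.

(** * The empty triangles of a maximal plane set *)

Section Tri2.
Variables (R : realFieldType) (V : finType).
Implicit Types pt : V -> R * R.

(** Dependency between the values of an affine function at four points. *)
Lemma affine_dep (a0 b0 v a b u : R * R) :
  turn a0 b0 v * turn a b u = turn a0 b0 u * turn v a b
    + turn a0 b0 a * turn v b u - turn a0 b0 b * turn v a u.
Proof. rewrite turn.unlock; ring. Qed.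

Notation tn pt a b c := (turn (pt a) (pt b) (pt c)).
Notation cr pt a b c d := (cross (pt a) (pt b) (pt c) (pt d)).
Notation sg pt a b t := (seg (pt a) (pt b) t).

(** The neighbour of [v] next to the direction of [u] on the left. *)
Lemma left_nbr pt (T : rel V) v u a0 b0 : injective pt -> gen_pos pt ->
  symmetric T -> irreflexive T -> plane_rel pt T ->
  (forall x y, x != y -> visible pt T x y -> T x y) ->
  T a0 b0 -> first_hit pt T a0 b0 v u -> 0 < tn pt v u b0 ->
  exists b, [/\ T v b, 0 < tn pt v u b, 0 <= tn pt v b b0, 0 <= tn pt a0 b0 b &
    forall x, ~~ [&& 0 < tn pt v u x, 0 < tn pt v x b & 0 < tn pt a0 b0 x]]
    /\ 0 < tn pt a0 b0 v.
Proof.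
move=> ptI gp Tsym Tirr Tpl Tmax Tab F ub0.
have [h0 [k0 [h001 k001 E0]]] := cross_meet F.1.
have [h00 h0lt] := andP h001; have [k00 k0lt] := andP k001.
have D := side_D h001 k001 E0 k0lt ub0.
have W := side_walls ptI gp Tirr Tpl Tab F h001 k001 E0 k0lt (lexx 1).
have f0 := side_v_pos h001 k001 E0 k0lt ub0.
have vb0 : v != b0 by apply: contraTneq ub0 => <-; rewrite turn_aba ltxx.
have inP x : in_triangle (pt v) (sg pt a0 b0 k0) (sg pt a0 b0 1) (pt x) =
    [&& 0 < tn pt v u x, 0 < tn pt v x b0 & 0 < tn pt a0 b0 x].
  rewrite /in_triangle turn_segm (turn_vo E0) pmulr_rgt0 ?subr_gt0 // pmulr_rgt0 //.
  rewrite -(turn_rot (seg _ _ _) (pt v) (pt x)) seg1.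
  by rewrite andbC -andbA andbCA.
case: (pselect (exists x, in_triangle (pt v) (sg pt a0 b0 k0) (sg pt a0 b0 1) (pt x))).
  move=> [x0 x0in].
  have [b [bin bvis bmin]] := visible_in_triangle Tsym D W (erefl _) x0in.
  move: bin; rewrite inP => /and3P[ub bb0 fb].
  exists b; split=> //; split=> //; rewrite ?ltW //.
    apply: Tmax => //; apply: contraTneq ub => <-; rewrite turn_aba ltxx //.
  move=> x; apply/negP => /and3P[ux xb fx].
  have xb0 : 0 < tn pt v x b0.
    have e := plucker (pt v) (pt u) (pt x) (pt b) (pt b0).
    have m1 : 0 < tn pt v u x * tn pt v b b0 by rewrite mulr_gt0.
    have m2 : 0 < tn pt v u b0 * tn pt v x b by rewrite mulr_gt0.
    by rewrite -(pmulr_rgt0 _ ub) -e addr_gt0.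
  have := bmin x; rewrite inP ux xb0 fx => /(_ isT).
  by rewrite leNgt xb.
move=> none.
exists b0; split=> //; split; rewrite ?turn_abb ?lexx //.
  apply: Tmax => //; apply: contrapT => /negP /visiblePn [a [b [Xab cab]]].
  apply: none.
  have [k [k' [/andP[kk0 kk1] /andP[k'0 k'1] E]]] := cross_meet cab.
  have k01 : 0 < k < 1 by rewrite kk0.
  have k'01 : 0 <= k' <= 1 by rewrite !ltW.
  have E1 : pt b0 = sg pt a0 b0 1 by rewrite seg1.
  case/andP: cab => cab _; case: (ltP (tn pt v b0 a) 0) => na.
    rewrite E1 in E na.
    by have [x [xin _ _]] := visible_of_hit Tsym D W (erefl _) Xab k'01 k01 (esym E) na; exists x.
  have nb := mul_lt0_ge cab na.
  rewrite E1 in E nb; rewrite Tsym in Xab.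
  have E' : sg pt b a (1 - k') = seg (pt v) (sg pt a0 b0 1) k.
    by rewrite E seg_rev; congr seg; ring.
  have k'01' : 0 <= 1 - k' <= 1 by apply/andP; split; lra.
  by have [x [xin _ _]] := visible_of_hit Tsym D W (erefl _) Xab k'01' k01 E' nb; exists x.
by move=> x; apply/negP => h; apply: none; exists x; rewrite inP.
Qed.

Section Fix.
Variables (pt : V -> R * R) (T : rel V).
Hypothesis ptI : injective pt.
Hypothesis gp : gen_pos pt.
Hypothesis Tsym : symmetric T.
Hypothesis Tirr : irreflexive T.
Hypothesis Tpl : plane_rel pt T.
Hypothesis Tmax : forall x y, x != y -> visible pt T x y -> T x y.

(** [left_nbr] in a mirror. *)
Lemma right_nbr v u a0 b0 :
  T a0 b0 -> first_hit pt T a0 b0 v u -> tn pt v u a0 < 0 ->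
  exists a, [/\ T v a, tn pt v u a < 0, tn pt v a a0 <= 0, 0 <= tn pt a0 b0 a &
    forall x, ~~ [&& tn pt v u x < 0, tn pt v x a < 0 & 0 < tn pt a0 b0 x]].
Proof.
move=> Tab F ua0.
pose pt' := (@mirror R) \o pt.
have tnE a b d : turn (pt' a) (pt' b) (pt' d) = - tn pt a b d by rewrite turn_mirror.
have pt'I : injective pt' by apply: inj_comp => //; exact: mirror_inj.
have gp' : gen_pos pt' by move=> a b d ab ad bd; rewrite tnE oppr_eq0 gp.
have pl' : plane_rel pt' T by move=> a b d e; rewrite cross_mirror; exact: Tpl.
have max' x y : x != y -> visible pt' T x y -> T x y by rewrite visible_mirror; exact: Tmax.
have F' : first_hit pt' T b0 a0 v u by apply/first_hit_mirror; exact: first_hit_symm.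
have ua0' : 0 < tn pt' v u a0 by rewrite tnE oppr_gt0.
rewrite Tsym in Tab.
have [a [[Tva ua aa0 fa emp] _]] := left_nbr pt'I gp' Tsym Tirr pl' max' Tab F' ua0'.
exists a; split=> //.
- by rewrite -oppr_gt0 -tnE.
- by rewrite -oppr_ge0 -tnE.
- by rewrite turn_swap -tnE.
- by move=> x; have := emp x; rewrite !tnE !oppr_gt0 (turn_swap (pt a0)) oppr_lt0.
Qed.

(** The neighbours of [v] next to the direction of [u] on either side are joined:
    an edge hiding one from the other would end in the empty sector between them. *)
Lemma tri_exists v u : v != u -> ~~ T v u ->
  exists a b, tri pt T v a b /\ cr pt v u a b.
Proof.
move=> vu nT.
have nvis : ~~ visible pt T v u by apply: contra nT => /(Tmax vu).
have [a0 [b0 [Tab0 F0]]] := first_hit_exists ptI gp Tsym Tirr Tpl nvis.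
wlog ub0 : a0 b0 Tab0 F0 / 0 < tn pt v u b0.
  move=> wl; case: (ltP 0 (tn pt v u b0)) => ub0; first exact: (wl a0 b0).
  apply: (wl b0 a0); [by rewrite Tsym | exact: first_hit_symm |].
  by case/andP: F0.1 => c1 _; rewrite mulrC in c1; exact: mul_lt0_le c1 ub0.
have ua0 : tn pt v u a0 < 0.
  by case/andP: F0.1 => c1 _; rewrite mulrC in c1; exact: mul_lt0_ge c1 (ltW ub0).
have [b [[Tvb ub bb0 fb empb] f0]] := left_nbr ptI gp Tsym Tirr Tpl Tmax Tab0 F0 ub0.
have [a [Tva ua aa0 fa empa]] := right_nbr Tab0 F0 ua0.
have fu : tn pt a0 b0 u < 0.
  by case/andP: F0.1 => _ c2; exact: mul_lt0_ge c2 (ltW f0).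
have vab0 : 0 < tn pt v a0 b0 by rewrite -turn_rot.
have a0b : 0 < tn pt v a0 b.
  have e := plucker (pt v) (pt a0) (pt u) (pt b) (pt b0).
  have m1 : 0 <= tn pt v a0 u * tn pt v b b0.
    by rewrite mulr_ge0 // turn_swapr oppr_ge0 ltW.
  have m2 : 0 < tn pt v a0 b0 * tn pt v u b by rewrite mulr_gt0.
  by rewrite -(pmulr_lgt0 _ ub0) -e; lra.
have vab : 0 < tn pt v a b.
  have e := plucker (pt v) (pt a0) (pt a) (pt u) (pt b).
  have m1 : 0 <= tn pt v a0 a * tn pt v u b.
    by rewrite mulr_ge0 // ?(ltW ub) // turn_swapr oppr_ge0.
  have m2 : 0 < tn pt v a0 b * tn pt v a u.
    by rewrite mulr_gt0 // turn_swapr oppr_gt0.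
  have a0u : 0 < tn pt v a0 u by rewrite turn_swapr oppr_gt0.
  by rewrite -(pmulr_rgt0 _ a0u) -e; lra.
have au : 0 < tn pt v a u by rewrite turn_swapr oppr_gt0.
have abu : tn pt a b u < 0.
  rewrite -(pmulr_rlt0 _ f0) affine_dep.
  have m1 : tn pt a0 b0 u * tn pt v a b < 0 by rewrite pmulr_llt0.
  have m2 : tn pt a0 b0 a * tn pt v b u <= 0.
    by rewrite mulr_ge0_le0 // turn_swapr oppr_le0 ltW.
  have m3 : 0 <= tn pt a0 b0 b * tn pt v a u by rewrite mulr_ge0 // ltW.
  lra.
have cvu : cr pt v u a b.
  by rewrite /cross nmulr_rlt0 // ub /= nmulr_llt0 // -turn_rot turn_rot turn_rot.
(* a point of the sector [a v b] on the side of [v] does not exist *)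
have noin x : x != v -> 0 < tn pt v a x -> 0 < tn pt v x b -> 0 < tn pt a0 b0 x -> False.
  move=> xv ax xb fx; case: (ltrgt0P (tn pt v u x)) => ux.
  - by have := empb x; rewrite ux xb fx.
  - by have := empa x; rewrite ux fx turn_swapr oppr_lt0 ax.
  - have [E|E] := tn0 gp vu ux; first by rewrite E eqxx in xv.
    by move: fx; rewrite E; lra.
have f_in x : 0 < tn pt v a x -> 0 < tn pt v x b -> 0 < tn pt a b x -> 0 < tn pt a0 b0 x.
  move=> ax xb abx; have e := affine_dep (pt a0) (pt b0) (pt v) (pt a) (pt b) (pt x).
  have m1 : 0 < tn pt a0 b0 v * tn pt a b x by rewrite mulr_gt0.
  have m2 : tn pt a0 b0 a * tn pt v b x <= 0.
    by rewrite mulr_ge0_le0 // turn_swapr oppr_le0 ltW.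
  have m3 : 0 <= tn pt a0 b0 b * tn pt v a x by rewrite mulr_ge0 // ltW.
  by rewrite -(pmulr_lgt0 _ vab); lra.
exists a, b; split=> //; apply/and5P; split=> //; first last.
- apply/forallP => x; apply/negP => /and3P[ax abx bx].
  have xb : 0 < tn pt v x b by move: bx; rewrite -turn_rot.
  have xv : x != v by apply: contraTneq ax => ->; rewrite turn_aba ltxx.
  exact: (noin x xv ax xb (f_in x ax xb abx)).
- by rewrite Tsym.
have ab : a != b by apply: contraTneq vab => ->; rewrite turn_abb ltxx.
have va : v != a by apply: contraTneq vab => ->; rewrite turn_aab ltxx.
have vb : v != b by apply: contraTneq vab => ->; rewrite turn_aba ltxx.
apply: Tmax => //; apply/visibleP => c d Tcd; apply/negP => cab.
wlog abc : c d Tcd cab / 0 < tn pt a b c.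
  move=> wl; case: (ltP 0 (tn pt a b c)) => h; first exact: (wl c d).
  apply: (wl d c); [by rewrite Tsym | by rewrite cross_swapr|].
  by case/andP: cab => c1 _; exact: mul_lt0_le c1 h.
have abd : tn pt a b d < 0.
  by case/andP: cab => c1 _; rewrite mulrC in c1; apply: mul_lt0_ge _ (ltW abc); rewrite mulrC.
have dv : d != v.
  by apply: contraTneq abd => ->; rewrite turn_rot -leNgt ltW.
case: (eqVneq c v) => [cv|cv].
(* the edge comes from [v] itself *)
  rewrite cv in Tcd cab; rewrite crossC in cab.
  have [ad db _] := class_side vab cab.
  have a0d : 0 < tn pt v a0 d.
    have e := plucker (pt v) (pt a0) (pt a) (pt d) (pt b).
    have m1 : 0 <= tn pt v a0 a * tn pt v d b.
      by rewrite mulr_ge0 // ?(ltW db) // turn_swapr oppr_ge0.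
    have m2 : 0 < tn pt v a0 b * tn pt v a d by rewrite mulr_gt0.
    by rewrite -(pmulr_lgt0 _ vab) -e; lra.
  have a0b0 : a0 != b0 by apply: contraTneq Tab0 => ->; rewrite Tirr.
  case: (ltrgt0P (tn pt a0 b0 d)) => fd.
  - exact: (noin d dv ad db fd).
  - have := Tpl Tcd Tab0; apply/negP; rewrite negbK.
    have db0 : 0 < tn pt v d b0.
      have e := plucker (pt v) (pt a0) (pt d) (pt b) (pt b0).
      have m1 : 0 <= tn pt v a0 d * tn pt v b b0 by rewrite mulr_ge0 // ltW.
      have m2 : 0 < tn pt v a0 b0 * tn pt v d b by rewrite mulr_gt0.
      by rewrite -(pmulr_rgt0 _ a0b) -e; lra.
    have da0 : tn pt v d a0 < 0 by rewrite turn_swapr oppr_lt0.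
    by rewrite /cross nmulr_rlt0 // db0 /= pmulr_rlt0.
  - case: (tn0 gp a0b0 fd) => E.
      by move: ad aa0; rewrite E; lra.
    by move: db bb0; rewrite E turn_swapr; lra.
(* otherwise it ends inside the triangle *)
pose X := [rel x y | [&& T x y, x != v & y != v]].
have [s [t [s01 t01 E]]] := cross_meet cab.
have [s0 s1] := andP s01.
have t01' : 0 <= t <= 1 by move: t01 => /andP[t0 t1]; rewrite !ltW.
have D : 0 < turn (pt b) (pt v) (pt a) by rewrite -turn_rot.
have Tva' : T b v by rewrite Tsym.
have W : walls pt X (pt b) (pt v) (pt a).
  move=> x y k h /and3P[Txy xv yv] k01 hyp; exfalso.
  have xy : x != y by apply: contraTneq Txy => ->; rewrite Tirr.
  have nov : sg pt x y k <> pt v.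
    move=> e; have z : tn pt x y v = 0 by rewrite -e turn_seg turn_aba turn_abb; ring.
    by case: (tn0 gp xy z) => ve; [move: xv|move: yv]; rewrite ve eqxx.
  have side p h' : T v p -> p != v -> 0 < h' < 1 -> sg pt x y k <> sg pt v p h'.
    move=> Tvp pv h'01 e; case: (meetP ptI gp _ xy h'01 k01 (esym e)).
    - by rewrite eq_sym.
    - by apply/negP; exact: (Tpl Tvp Txy).
    - by case=> -[ex ey]; [move: xv|move: yv]; rewrite ?ex ?ey eqxx.
  case/orP: hyp => /andP[/andP[h0 h1] /eqP e].
    case: (eqVneq h 1) => [h1'|hn]; first by apply: nov; rewrite e h1' seg1.
    apply: (side b (1 - h)) => //; first by rewrite eq_sym.
      have hlt : h < 1 by rewrite lt_neqAle hn.
      by apply/andP; split; lra.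
    by rewrite e [in RHS]seg_rev; congr seg; ring.
  case: (eqVneq h 0) => [h0'|hn]; first by apply: nov; rewrite e h0' seg0.
  apply: (side a h) => //; first by rewrite eq_sym.
  by rewrite lt_neqAle eq_sym hn h0.
have Xcd : X c d by rewrite /X /= Tcd cv dv.
have /and3P[vac _ bvc] : in_triangle (pt b) (pt v) (pt a) (pt c).
  apply: (trap D W Xcd t01'); rewrite -E !turn_seg !(turn_aba, turn_abb, mulr0, addr0, add0r) //.
  - by rewrite mulr_gt0.
  - by rewrite mulr_gt0 // subr_gt0.
  - by rewrite subr0 mulr_gt0 // mulr_gt0 // subr_gt0.
have xb : 0 < tn pt v c b by move: bvc; rewrite -turn_rot.
exact: (noin c cv vac xb (f_in c vac xb abc)).
Qed.

(** Of two apices on the same side of [a b], one lies in the triangle of the other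
    or two of the sides cross. *)
Lemma tri_unique v w a b : tri pt T v a b -> tri pt T w a b -> v = w.
Proof.
move=> tv tw; apply/eqP; apply: contraT => vw.
have [Tva Tab Tbv vab /forallP/(_ w) ev] := and5P tv.
have [Twa _ Tbw wab /forallP/(_ v) ew] := and5P tw.
have abv : 0 < tn pt a b v by rewrite turn_rot.
have abw : 0 < tn pt a b w by rewrite turn_rot.
rewrite abw /= in ev; rewrite abv /= in ew.
have neq p q : T p q -> p != q by move=> Tpq; apply: contraTneq Tpq => ->; rewrite Tirr.
have e1 : tn pt w a v = - tn pt v a w by rewrite turn.unlock; ring.
have e2 : tn pt b w v = - tn pt b v w by rewrite turn.unlock; ring.
rewrite e1 e2 !oppr_gt0 in ew.
have Twa' : T a w by rewrite Tsym.
case: (ltrgt0P (tn pt v a w)) => P.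
- rewrite P /= -leNgt in ev; case: (ltrgt0P (tn pt b v w)) ev => // Q _.
    have bva : 0 < tn pt b v a by rewrite -turn_rot.
    have awb : tn pt a w b < 0 by rewrite turn_swapr oppr_lt0.
    have awv : 0 < tn pt a w v by rewrite turn_rot.
    by have := Tpl Tbv Twa'; rewrite /cross (pmulr_rlt0 _ bva) Q (nmulr_rlt0 _ awb) awv.
  by case: (tn0 gp (neq _ _ Tbv) Q) => E; [have := neq _ _ Tbw; rewrite E eqxx | rewrite E eqxx in vw].
- rewrite P /= -leNgt in ew; case: (ltrgt0P (tn pt b v w)) ew => // Q _.
    have bwa : 0 < tn pt b w a by rewrite turn_rot.
    have bwv : tn pt b w v < 0 by rewrite e2 oppr_lt0.
    by have := Tpl Tva Tbw; rewrite /cross (pmulr_rlt0 _ vab) P (nmulr_rlt0 _ bwv) bwa.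
  by case: (tn0 gp (neq _ _ Tbv) Q) => E; [have := neq _ _ Tbw; rewrite E eqxx | rewrite E eqxx in vw].
- case: (tn0 gp (neq _ _ Tva) P) => E; first by rewrite E eqxx in vw.
  by have := neq _ _ Twa; rewrite E eqxx.
Qed.

(** Inside the triangle each of the two edges joins a vertex to the opposite side. *)
Lemma class_cross v a b c d : 0 < tn pt v a b -> cr pt v c a b -> cr pt a d b v -> cr pt v c a d.
Proof.
move=> vab c1 c2.
have [ac cb abc] := class_side vab c1.
have abv : 0 < tn pt a b v by rewrite turn_rot.
have [bd dv bvd] := class_side abv c2.
have va : tn pt v c a < 0 by rewrite turn_swapr oppr_lt0.
have ab : tn pt a d b < 0 by rewrite turn_swapr oppr_lt0.
have cd : 0 < tn pt v c d.
  have := affine_dep (pt v) (pt c) (pt v) (pt a) (pt b) (pt d).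
  rewrite turn_aba mul0r => e.
  have m1 : tn pt v c a * tn pt v b d < 0 by rewrite nmulr_rlt0 // turn_swap oppr_gt0.
  have m2 : 0 < tn pt v c b * tn pt v a d by rewrite mulr_gt0 // -turn_rot.
  by rewrite -(pmulr_lgt0 _ vab); lra.
have dc : tn pt a d c < 0.
  have := affine_dep (pt a) (pt d) (pt a) (pt b) (pt v) (pt c).
  rewrite turn_aba mul0r => e.
  have m1 : 0 < tn pt a d b * tn pt a v c by rewrite nmulr_rgt0 // turn_swap oppr_lt0.
  have m2 : tn pt a d v * tn pt a b c < 0 by rewrite pmulr_rlt0.
  by rewrite -(pmulr_llt0 _ abv); lra.
by rewrite /cross nmulr_rlt0 // cd pmulr_rlt0.
Qed.
End Fix.
End Tri2.

(** * A plane graph has at most three edges per vertex *)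

Section Heights.
Variables (R : realFieldType) (V : finType) (pt : V -> R * R).
Hypothesis xI : injective (fun v => (pt v).1).
Hypothesis gp : gen_pos pt.

Notation x v := ((pt v).1).
Notation y v := ((pt v).2).
Notation tn a b c := (turn (pt a) (pt b) (pt c)).
Notation cr a b c d := (cross (pt a) (pt b) (pt c) (pt d)).

Lemma ptI : injective pt.
Proof. by move=> a b e; apply: xI; rewrite /= e. Qed.

Definition slope (a b : V) : R := (y b - y a) / (x b - x a).

Definition height (a b : V) (t : R) : R := y a + (t - x a) * slope a b.

Lemma height_r a b t : x a < x b -> height a b t = y b - (x b - t) * slope a b.
Proof. by move=> ab; rewrite /height /slope; field; lra. Qed.

Lemma height_l a b : height a b (x a) = y a.
Proof. by rewrite /height subrr mul0r addr0. Qed.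

Lemma height_at_r a b : x a < x b -> height a b (x b) = y b.
Proof. by move=> ab; rewrite height_r // subrr mul0r subr0. Qed.

Lemma turn_height a b c : x a < x b -> tn a b c = (x b - x a) * (y c - height a b (x c)).
Proof. by move=> ab; rewrite turn.unlock /height /slope; field; lra. Qed.

Lemma height_affine a b (s t r : R) :
  height a b (s + r * (t - s)) = (1 - r) * height a b s + r * height a b t.
Proof. rewrite /height; ring. Qed.

Lemma heights_meet a b c d (t : R) : x a < x b -> x c < x d ->
  x a < t < x b -> x c <= t <= x d -> height a b t = height c d t ->
  cr a b c d \/ (c = a /\ d = b).
Proof.
move=> ab cd /andP[at_ tb] /andP[ct td] e.
have sE p q : x p < x q -> seg (pt p) (pt q) ((t - x p) / (x q - x p)) = (t, height p q t).
  move=> pq; rewrite seg.unlock /height /slope; congr (_, _); field; lra.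
have ab' : a != b by apply: contraTneq ab => ->; rewrite ltxx.
have cd' : c != d by apply: contraTneq cd => ->; rewrite ltxx.
have s01 : 0 < (t - x a) / (x b - x a) < 1.
  have h : 0 < x b - x a by lra.
  by rewrite divr_gt0 ?subr_gt0 //= ltr_pdivrMr // mul1r; lra.
have t01 : 0 <= (t - x c) / (x d - x c) <= 1.
  have h : 0 < x d - x c by lra.
  by rewrite divr_ge0 ?subr_ge0 ?(ltW cd) //= ler_pdivrMr // mul1r; lra.
have E : seg (pt a) (pt b) ((t - x a) / (x b - x a)) = seg (pt c) (pt d) ((t - x c) / (x d - x c)).
  by rewrite !sE // e.
case: (meetP ptI gp ab' cd' s01 t01 E) => [|[|[ca db]]]; [by left | by right |].
by move: cd; rewrite ca db ltNge ltW.
Qed.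

Lemma heights_swap a b c d (s t : R) : x a < x b -> x c < x d -> s < t ->
  x a <= s -> x c <= s -> t <= x b -> t <= x d ->
  height a b s < height c d s -> height c d t < height a b t -> cr a b c d.
Proof.
move=> ab cd st as_ cs tb td hs ht.
set r := (height c d s - height a b s) / ((height c d s - height a b s) + (height a b t - height c d t)).
have d0 : 0 < (height c d s - height a b s) + (height a b t - height c d t) by lra.
have /andP[r0 r1] : 0 < r < 1.
  by rewrite /r divr_gt0 ?subr_gt0 //= ltr_pdivrMr // mul1r; lra.
have m1 : 0 < r * (t - s) by rewrite mulr_gt0 // subr_gt0.
have m2 : 0 < (1 - r) * (t - s) by rewrite mulr_gt0 // subr_gt0.
have e : height a b (s + r * (t - s)) = height c d (s + r * (t - s)).
  by rewrite !height_affine /r; field; lra.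
have [|||] := heights_meet ab cd _ _ e => //.
- by apply/andP; split; lra.
- by apply/andP; split; lra.
- by move=> [ca db]; move: hs; rewrite ca db ltxx.
Qed.

Section Edges.
Variable T : {set V * V}.
Hypothesis Tx : forall a b, (a, b) \in T -> x a < x b.
Hypothesis Tpl : forall a b c d, (a, b) \in T -> (c, d) \in T -> ~~ cr a b c d.

(** [w] looks straight down on the edge [u v]. *)
Definition seen (u v w : V) : bool :=
  [&& x u < x w < x v, height u v (x w) < y w &
    [forall c, forall d, [&& (c, d) \in T, x c < x w < x d & height u v (x w) < height c d (x w)]
       ==> (y w <= height c d (x w))]].

Lemma gp_height a b c : x a < x b -> c != a -> c != b -> y c != height a b (x c).
Proof.
move=> ab ca cb; have ab' : a != b by apply: contraTneq ab => ->; rewrite ltxx.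
have := gp ab' (_ : a != c) (_ : b != c); rewrite ![_ == c]eq_sym ca cb => /(_ isT isT).
by rewrite turn_height //; apply: contraNneq => ->; rewrite subrr mulr0.
Qed.

(** [u1 v] is the next edge above [u v] at [v]. Of the points between the two, the
    rightmost one sees [u v]: an edge in between would lead to a point further
    right, or be a closer edge at [v]. *)
Lemma seen_of_left u v u1 : (u, v) \in T -> (u1, v) \in T -> slope u1 v < slope u v ->
  (forall u2, (u2, v) \in T -> slope u2 v < slope u v -> slope u2 v <= slope u1 v) ->
  x u < x u1 -> exists w, seen u v w.
Proof.
move=> uv u1v sl smax uu1.
have xuv := Tx uv; have xu1v := Tx u1v.
pose Rg z := [&& x u1 <= x z, x z < x v, height u v (x z) < y z & y z <= height u1 v (x z)].
have R1 : Rg u1.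
  rewrite /Rg lexx xu1v height_l lexx andbT /=.
  rewrite -[ltRHS](height_l u1 v) !height_r // ltrD2l ltrN2.
  by rewrite ltr_pM2l // subr_gt0.
have [w /and4P[w1 w2 w3 w4] wmax] := @arg_maxP _ _ _ u1 Rg (fun z => x z) R1.
exists w; rewrite /seen w3 w2 (lt_le_trans uu1 w1) /=.
apply/forallP => c; apply/forallP => d; apply/implyP => /and3P[cd /andP[cw wd] h].
rewrite leNgt; apply/negP => hw.
have xcd := Tx cd.
have hu1 : height c d (x w) < height u1 v (x w) by apply: lt_le_trans w4.
have below_u s : x w <= s -> s <= x d -> s <= x v -> height u v s <= height c d s.
  move=> ws sd sv; rewrite leNgt; apply/negP => k.
  have ws' : x w < s by rewrite lt_neqAle ws andbT; apply: contraTneq k => <-; rewrite -leNgt ltW.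
  have := Tpl uv cd; rewrite (heights_swap _ _ ws') //; apply: ltW => //.
  exact: lt_le_trans uu1 w1.
have above_1 s : x w <= s -> s <= x d -> s <= x v -> height c d s <= height u1 v s.
  move=> ws sd sv; rewrite leNgt; apply/negP => k.
  have ws' : x w < s by rewrite lt_neqAle ws andbT; apply: contraTneq k => <-; rewrite -leNgt ltW.
  by have := Tpl cd u1v; rewrite (heights_swap _ _ ws') //; apply: ltW.
case: (ltrgtP (x d) (x v)) => dv.
- have du : d != u by apply: contraTneq wd => ->; rewrite -leNgt ltW // (lt_le_trans uu1 w1).
  have dv' : d != v by apply: contraTneq dv => ->; rewrite ltxx.
  have hd : height c d (x d) = y d by rewrite height_at_r.
  have Rd : Rg d.
    have r1 : height u v (x d) < y d.
      by rewrite lt_neqAle eq_sym gp_height //= -hd below_u // ltW.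
    have r2 : y d <= height u1 v (x d) by rewrite -hd above_1 // ltW.
    by rewrite /Rg dv (le_trans w1 (ltW wd)) r1 r2.
  have h' : x d <= x w := wmax d Rd.
  by move: h'; rewrite leNgt wd.
- have h1 := below_u (x v) (ltW w2) (ltW dv) (lexx _).
  have h2 := above_1 (x v) (ltW w2) (ltW dv) (lexx _).
  rewrite !height_at_r // in h1 h2.
  have vc : v != c by apply: contraTneq (lt_trans cw w2) => ->; rewrite ltxx.
  have vd : v != d by apply: contraTneq dv => ->; rewrite ltxx.
  by have := gp_height xcd vc vd; rewrite eq_le h1 h2.
- have {dv} dv := xI dv; rewrite dv in cd h hw hu1 xcd wd.
  have lt_slope p q : x p < x v -> x q < x v ->
      height p v (x w) < height q v (x w) -> slope q v < slope p v.
    move=> pv qv; rewrite !height_r // ltrD2l ltrN2 ltr_pM2l ?subr_gt0 //.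
  have := smax c cd (lt_slope _ _ xuv xcd h).
  by rewrite leNgt (lt_slope _ _ xcd xu1v hu1).
Qed.

Definition top_left (e : V * V) : bool :=
  [forall u2, ((u2, e.2) \in T) ==> (slope e.1 e.2 <= slope u2 e.2)].

Definition top_right (e : V * V) : bool :=
  [forall v2, ((e.1, v2) \in T) ==> (slope e.1 v2 <= slope e.1 e.2)].

Lemma same_slope_left u u2 v : x u < x v -> x u2 < x v -> slope u v = slope u2 v -> u = u2.
Proof.
move=> uv u2v s; apply/eqP; apply: contraT => uu2.
have vu : u2 != v by apply: contraTneq u2v => ->; rewrite ltxx.
have := gp_height uv (_ : u2 != u) vu; rewrite eq_sym => /(_ uu2).
by rewrite height_r // s -height_r // height_l eqxx.
Qed.

Lemma same_slope_right u v v2 : x u < x v -> x u < x v2 -> slope u v = slope u v2 -> v = v2.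
Proof.
move=> uv uv2 s; apply/eqP; apply: contraT => vv2.
have vu : v2 != u by apply: contraTneq uv2 => ->; rewrite ltxx.
have := gp_height uv vu; rewrite eq_sym => /(_ vv2).
by rewrite /height s -/(height u v2 _) height_at_r // eqxx.
Qed.

Lemma seen_unique u v c d w : (u, v) \in T -> (c, d) \in T -> seen u v w -> seen c d w ->
  (u, v) = (c, d).
Proof.
move=> uv cd /and3P[/andP[uw wv] h1 /forallP b1] /and3P[/andP[cw wd] h2 /forallP b2].
have xuv := Tx uv; have xcd := Tx cd.
case: (ltrgtP (height u v (x w)) (height c d (x w))) => h.
- have := b1 c => /forallP /(_ d) /implyP; rewrite cd cw wd h => /(_ isT).
  by rewrite leNgt h2.
- have := b2 u => /forallP /(_ v) /implyP; rewrite uv uw wv h => /(_ isT).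
  by rewrite leNgt h1.
have [|||] := heights_meet xuv xcd _ _ h; rewrite ?uw ?cw ?wd ?(ltW cw) ?(ltW wd) //.
- by move=> c1; have := Tpl uv cd; rewrite c1.
- by move=> [-> ->].
Qed.
End Edges.
End Heights.

Section Count.
Variables (R : realFieldType) (V : finType) (pt : V -> R * R).
Hypothesis xI : injective (fun v => (pt v).1).
Hypothesis gp : gen_pos pt.
Notation x v := ((pt v).1).
Notation y v := ((pt v).2).
Variable T : {set V * V}.
Hypothesis Tx : forall a b, (a, b) \in T -> x a < x b.
Hypothesis Tpl : forall a b c d, (a, b) \in T -> (c, d) \in T ->
  ~~ cross (pt a) (pt b) (pt c) (pt d).

Definition xflip (p : R * R) : R * R := (- p.1, p.2).

Lemma turn_xflip p q r : turn (xflip p) (xflip q) (xflip r) = - turn p q r.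
Proof. rewrite turn.unlock /xflip /=; ring. Qed.

Lemma cross_xflip a b c d :
  cross (xflip a) (xflip b) (xflip c) (xflip d) = cross a b c d.
Proof. by rewrite /cross !turn_xflip !mulrNN. Qed.

Lemma gp_xflip : gen_pos (xflip \o pt).
Proof. by move=> a b c ab bc ca; rewrite /= turn_xflip oppr_eq0; apply: gp. Qed.

Lemma slope_xflip a b : slope (xflip \o pt) b a = - slope pt a b.
Proof.
by rewrite /slope /= -mulNr opprB [- _ - - _]addrC opprK.
Qed.

Lemma height_xflip a b t : x a < x b -> height (xflip \o pt) b a (- t) = height pt a b t.
Proof. by move=> ab; rewrite [RHS]height_r // /height slope_xflip /=; ring. Qed.

(** [seen_of_left] in a mirror. *)
Lemma seen_of_right u v v2 : (u, v) \in T -> (u, v2) \in T -> slope pt u v < slope pt u v2 ->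
  (forall v3, (u, v3) \in T -> slope pt u v < slope pt u v3 -> slope pt u v2 <= slope pt u v3) ->
  x v2 < x v -> exists w, seen pt T u v w.
Proof.
move=> uv uv2 sl smin v2v.
pose T' := [set e : V * V | (e.2, e.1) \in T].
have xI' : injective (fun z => ((xflip \o pt) z).1) by move=> a b /= /oppr_inj; apply: xI.
have T'x a b : (a, b) \in T' -> ((xflip \o pt) a).1 < ((xflip \o pt) b).1.
  by rewrite inE /= ltrN2; apply: Tx.
have T'pl a b c d : (a, b) \in T' -> (c, d) \in T' ->
    ~~ cross ((xflip \o pt) a) ((xflip \o pt) b) ((xflip \o pt) c) ((xflip \o pt) d).
  by rewrite !inE /= cross_xflip cross_swapl cross_swapr; apply: Tpl.
have [|||||w] := seen_of_left xI' gp_xflip T'x T'pl (u := v) (v := u) (u1 := v2).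
- by rewrite inE.
- by rewrite inE.
- by rewrite !slope_xflip ltrN2.
- by move=> v3; rewrite inE /= !slope_xflip ltrN2 lerN2; apply: smin.
- by rewrite /= ltrN2.
have xuv := Tx uv.
case/and3P=> /andP[/= w1 w2]; rewrite height_xflip // => w3 /forallP w4.
exists w; rewrite /seen w3 -ltrN2 w2 -ltrN2 w1 /=.
apply/forallP => c; apply/forallP => d; apply/implyP => /and3P[cd /andP[cw wd] h].
have := w4 d => /forallP /(_ c); rewrite inE /= !ltrN2 cd cw wd /= !height_xflip ?(Tx cd) //.
by rewrite h.
Qed.

(** Take the next edges above [u v] at both ends. If neither of them begins inside
    the vertical strip of [u v], they cross there. *)
Lemma edge_cases u v : (u, v) \in T ->
  [|| top_left pt T (u, v), top_right pt T (u, v) | [exists w, seen pt T u v w]].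
Proof.
move=> uv; have xuv := Tx uv.
case tl: (top_left _ _ _) => //; case tr: (top_right _ _ _) => //=.
move/negbT: tl => /forallPn [u0]; rewrite negb_imply -ltNge /= => /andP[u0v s0].
move/negbT: tr => /forallPn [v0]; rewrite negb_imply -ltNge /= => /andP[uv0 s1].
pose Pl z := ((z, v) \in T) && (slope pt z v < slope pt u v).
pose Pr z := ((u, z) \in T) && (slope pt u v < slope pt u z).
have Pl0 : Pl u0 by rewrite /Pl u0v.
have Pr0 : Pr v0 by rewrite /Pr uv0.
have [u1 /andP[u1v su1] umax] := @arg_maxP _ _ _ u0 Pl (fun z => slope pt z v) Pl0.
have [v2 /andP[uv2 sv2] vmin] := @arg_minP _ _ _ v0 Pr (fun z => slope pt u z) Pr0.
have umax' z : (z, v) \in T -> slope pt z v < slope pt u v -> slope pt z v <= slope pt u1 v.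
  by move=> h1 h2; apply: umax; rewrite /Pl h1.
have vmin' z : (u, z) \in T -> slope pt u v < slope pt u z -> slope pt u v2 <= slope pt u z.
  by move=> h1 h2; apply: vmin; rewrite /Pr h1.
apply/existsP.
case: (ltrP (x u) (x u1)) => xu1; first exact: (seen_of_left xI gp Tx Tpl uv u1v su1 umax' xu1).
case: (ltrP (x v2) (x v)) => xv2; first exact: (seen_of_right uv uv2 sv2 vmin' xv2).
have xu1v := Tx u1v; have xuv2 := Tx uv2.
have := Tpl uv2 u1v.
rewrite (heights_swap xI gp xuv2 xu1v xuv) //.
  rewrite height_l -[ltLHS](height_l pt u v) !height_r // ltrD2l ltrN2 ltr_pM2l ?subr_gt0 //.
rewrite height_at_r // /height -[ltLHS](height_at_r xuv) /height ltrD2l ltr_pM2l ?subr_gt0 //.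
Qed.

(** Three injections into the vertices: the left-topmost edges by their right
    end, the right-topmost edges by their left end, the others by a vertex
    seen above them. *)
Lemma plane_bound : (#|T| <= 3 * #|V|)%N.
Proof.
pose A := [set e in T | top_left pt T e].
pose B := [set e in T | top_right pt T e].
pose C := [set e in T | [exists w, seen pt T e.1 e.2 w]].
have sub : T \subset A :|: B :|: C.
  by apply/subsetP => -[u v] uv; rewrite !inE uv /= -orbA; apply: edge_cases.
have cA : (#|A| <= #|V|)%N.
  rewrite -(card_in_imset (f := snd)) ?max_card // => -[u v] [u2 v2].
  rewrite !inE /= => /andP[uv /forallP t1] /andP[uv2 /forallP t2] e.
  rewrite -{v2}e in uv2 t2 *.
  have := t1 u2; have := t2 u; rewrite uv uv2 /= => l1 l2.
  by rewrite (same_slope_left gp (Tx uv) (Tx uv2)) //; apply/eqP; rewrite eq_le l1 l2.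
have cB : (#|B| <= #|V|)%N.
  rewrite -(card_in_imset (f := fst)) ?max_card // => -[u v] [u2 v2].
  rewrite !inE /= => /andP[uv /forallP t1] /andP[uv2 /forallP t2] e.
  rewrite -{u2}e in uv2 t2 *.
  have := t1 v2; have := t2 v; rewrite uv uv2 /= => l1 l2.
  by rewrite (same_slope_right gp (Tx uv) (Tx uv2)) //; apply/eqP; rewrite eq_le l1 l2.
have cC : (#|C| <= #|V|)%N.
  pose f (e : V * V) := odflt e.1 [pick w | seen pt T e.1 e.2 w].
  have fP e : e \in C -> seen pt T e.1 e.2 (f e).
    rewrite !inE /f => /andP[_ /existsP[w sw]].
    by case: pickP => //= /(_ w); rewrite sw.
  rewrite -(card_in_imset (f := f)) ?max_card // => -[u v] [c d] h1 h2 e.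
  have s1 := fP _ h1; have s2 := fP _ h2; rewrite -e in s2.
  move: h1 h2; rewrite !inE => /andP[uv _] /andP[cd _].
  exact: (seen_unique xI gp Tx Tpl uv cd s1 s2).
apply: leq_trans (subset_leq_card sub) _.
apply: leq_trans (leq_card_setU _ _).1 _.
rewrite mulSn mul2n -addnn addnC leq_add // (leq_trans (leq_card_setU _ _).1) // leq_add //.
Qed.
End Count.

(** * Edge sets *)

Section EdgeSets.
Variables (R : realFieldType) (V : finType) (pt : V -> R * R).
Hypothesis xI : injective (fun v => (pt v).1).
Notation x v := ((pt v).1).
Notation cr a b c d := (cross (pt a) (pt b) (pt c) (pt d)).

(** A set of edges, each one written once, from left to right. *)
Definition oriented (A : {set V * V}) : bool := [forall e in A, x e.1 < x e.2].

Definition adj (A : {set V * V}) : rel V := fun a b => ((a, b) \in A) || ((b, a) \in A).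

Definition ed (a b : V) : V * V := if x a < x b then (a, b) else (b, a).

Lemma orientedP A a b : oriented A -> (a, b) \in A -> x a < x b.
Proof. by move=> /forall_inP h /h. Qed.

Lemma adj_sym A : symmetric (adj A).
Proof. by move=> a b; rewrite /adj orbC. Qed.

Lemma adj_irr A : oriented A -> irreflexive (adj A).
Proof. by move=> oA a; apply/negbTE; rewrite /adj orbb; apply/negP => /(orientedP oA); rewrite ltxx. Qed.

Lemma ed_adj A a b : oriented A -> adj A a b = (ed a b \in A).
Proof.
move=> oA; rewrite /adj /ed; case: ltP => ab.
  by case h: ((b, a) \in A); rewrite ?orbF //; have := orientedP oA h; rewrite ltNge ltW.
by case h: ((a, b) \in A) => //; have := orientedP oA h; rewrite ltNge ab.
Qed.

Lemma ed_cross a b c d : cr a b (ed c d).1 (ed c d).2 = cr a b c d.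
Proof. by rewrite /ed; case: ifP => //= _; rewrite cross_swapr. Qed.

Lemma ed_inj a b c d : ed a b = ed c d -> (a = c /\ b = d) \/ (a = d /\ b = c).
Proof. by rewrite /ed; case: ifP; case: ifP => _ _ [-> ->]; [left|right|right|left]. Qed.

Lemma ed_injr a b c : ed a b = ed a c -> b = c.
Proof. by case/ed_inj => [[_ ->]|[-> ->]]. Qed.

Lemma ed_oriented a b : a != b -> x (ed a b).1 < x (ed a b).2.
Proof.
move=> ab; rewrite /ed; case: (ltP (x a) (x b)) => //= ba.
by rewrite lt_neqAle ba andbT eq_sym; apply: contra ab => /eqP/xI ->.
Qed.

Lemma orientedS (A B : {set V * V}) : A \subset B -> oriented B -> oriented A.
Proof. by move=> /subsetP AB /forall_inP oB; apply/forall_inP => e /AB; apply: oB. Qed.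

Lemma oriented_add A a b : a != b -> oriented A -> oriented (ed a b |: A).
Proof.
move=> ab /forall_inP oA; apply/forall_inP => e; rewrite !inE => /orP[/eqP ->|]; last exact: oA.
exact: ed_oriented.
Qed.

Definition dir (A : {set V * V}) : {set V * V} := [set e | adj A e.1 e.2].

Lemma card_dir A : oriented A -> #|dir A| = (2 * #|A|)%N.
Proof.
move=> oA; pose sw (e : V * V) := (e.2, e.1).
have swI : injective sw by move=> [a b] [c d] [-> ->].
have -> : dir A = A :|: sw @: A.
  apply/setP => -[a b]; rewrite !inE /adj /=; congr (_ || _).
  apply/idP/imsetP => [h|[[c d] h [-> ->]]] //; by exists (b, a).
rewrite cardsU card_imset // (_ : A :&: _ = set0) ?cards0 ?subn0 ?mul2n ?addnn //.
apply/setP => -[a b]; rewrite !inE; apply/negbTE/negP => /andP[h /imsetP[[c d] h' [e1 e2]]].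
have := orientedP oA h; have := orientedP oA h'; rewrite e1 e2 => l1 l2.
by have := lt_trans l1 l2; rewrite ltxx.
Qed.

Lemma adj_add A a b : oriented A -> a != b -> adj (ed a b |: A) = add_edge (adj A) a b.
Proof.
move=> oA ab; apply/funext => c; apply/funext => d.
rewrite /adj /add_edge !inE /ed; case: ifP => _; rewrite !xpair_eqE;
  case: (_ \in A); case: (_ \in A); rewrite ?orbT //=; do 4 case: (_ == _) => //=.
Qed.

Definition plane (A : {set V * V}) : bool :=
  [forall e in A, forall f in A, ~~ cr e.1 e.2 f.1 f.2].

Lemma planeP A : plane A -> forall a b c d, (a, b) \in A -> (c, d) \in A -> ~~ cr a b c d.
Proof.
by move=> /forall_inP h a b c d ab cd; have /forall_inP/(_ _ cd) := h _ ab.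
Qed.

Lemma planeE A : plane A <-> plane_rel pt (adj A).
Proof.
split=> [h a b c d|h].
  have p := planeP h; rewrite /adj => /orP[ab|ab] /orP[cd|cd].
  - exact: p.
  - by rewrite cross_swapr; apply: p.
  - by rewrite cross_swapl; apply: p.
  - by rewrite cross_swapl cross_swapr; apply: p.
apply/forall_inP => -[a b] ab; apply/forall_inP => -[c d] cd /=; apply: h; by rewrite /adj ?ab ?cd.
Qed.

Lemma planeS (A B : {set V * V}) : A \subset B -> plane B -> plane A.
Proof.
move=> /subsetP AB pB; apply/forall_inP => -[a b] /AB ab; apply/forall_inP => -[c d] /AB cd.
exact: (planeP pB).
Qed.

Lemma cross_self a b c : ~~ cr a b a c.
Proof. by rewrite /cross turn_aba mul0r ltxx. Qed.

Lemma plane_add A a b : plane A -> visible pt (adj A) a b -> plane (ed a b |: A).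
Proof.
move=> pA /visibleP vis; apply/planeE.
have key c d : (c, d) \in ed a b |: A -> (c, d) \in A \/ forall e f, cr e f c d = cr e f a b.
  rewrite !inE => /orP[/eqP h|]; [right => e f | by left].
  by rewrite -[RHS]ed_cross -h.
have crC p q r s : cr p q r s = cr r s p q by rewrite crossC.
move/planeE: (pA) => pA'.
have main c d e f : (c, d) \in ed a b |: A -> (e, f) \in ed a b |: A -> ~~ cr c d e f.
  move=> /key [cd|cd] /key [ef|ef].
  - exact: (planeP pA).
  - by rewrite ef crC; apply: vis; rewrite /adj cd.
  - by rewrite crC cd crC; apply: vis; rewrite /adj ef.
  - by rewrite ef crC cd cross_self.
apply/planeE; apply/forall_inP => -[c d] cd; apply/forall_inP => -[e f]; exact: main.
Qed.
End EdgeSets.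

(** * Maximal safe sets *)

(** [n * M.+1 + m] encodes the lexicographic order of pairs whose second member
    is at most [M]. *)
Lemma lex_le (M n m n' m' : nat) :
  (n * M.+1 + m <= n' * M.+1 + m')%N -> (m' <= M)%N -> (n <= n')%N.
Proof. by move=> h mM; rewrite leqNgt; apply/negP => lt; nia. Qed.

Lemma lex_lt (M n m n' m' : nat) :
  (n * M.+1 + m <= n' * M.+1 + m')%N -> (n' <= n)%N -> (m <= m')%N.
Proof. by move=> h mM; nia. Qed.

Section KPlanar.
Variables (R : realFieldType) (V : finType) (pt : V -> R * R).
Hypothesis xI : injective (fun v => (pt v).1).
Hypothesis gp : gen_pos pt.
Notation x v := ((pt v).1).
Notation tn a b c := (turn (pt a) (pt b) (pt c)).
Notation cr a b c d := (cross (pt a) (pt b) (pt c) (pt d)).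
Notation oriented := (oriented pt).
Notation plane := (plane pt).
Notation ed := (ed pt).

Variables (k : nat) (G : {set V * V}).
Hypothesis oG : oriented G.

Definition crossers (a b : V) : {set V * V} := [set f in G | cr a b f.1 f.2].

Hypothesis Gk : forall a b, (a, b) \in G -> (#|crossers a b| <= k)%N.

Lemma adj_crossers a b : adj G a b -> (#|crossers a b| <= k)%N.
Proof.
rewrite /adj => /orP[|/Gk]; first exact: Gk.
suff -> : crossers b a = crossers a b by [].
by apply/setP => f; rewrite !inE cross_swapl.
Qed.

Lemma ed_crossers a b c d : adj G c d -> cr a b c d -> ed c d \in crossers a b.
Proof. by rewrite (ed_adj _ _ oG) inE => -> /=; rewrite ed_cross. Qed.

Lemma star_adj : star_bounded pt k (adj G).
Proof.
move=> a b u S ab h; apply: leq_trans (adj_crossers ab).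
rewrite -(card_imset (f := ed u) (mem S)); last by move=> s t; exact: ed_injr.
apply/subset_leq_card/subsetP => _ /imsetP[s /h [us c] ->].
by apply: ed_crossers => //; rewrite crossC.
Qed.

Lemma bundle_G p q u S (X : rel V) : adj G p q -> bundle pt (adj G) X p q u S -> (#|S| <= k)%N.
Proof.
move=> pq [h _]; apply: (star_adj (u := u) pq) => s /h [us [c _]]; split=> //.
Qed.

Definition good (X : {set V * V}) : Prop :=
  [/\ oriented X, plane X & safe pt k (adj G) (adj X)].

Lemma good_sub (H : {set V * V}) : H \subset G -> plane H -> good H.
Proof.
move=> HG pH; split=> //; first exact: orientedS HG oG.
move=> p q u S pq; apply: bundle_G; move: pq; rewrite /adj => /orP[] h.
  by rewrite (subsetP HG).
by rewrite (subsetP HG _ h) orbT.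
Qed.

Lemma plane0 : plane set0.
Proof. by apply/forall_inP => e; rewrite inE. Qed.

(** [X] is safe with, first, as many edges of [G] as possible and, then, as many
    edges as possible; [T] is a maximal plane set around it. Adding edges of [G]
    keeps safety, so plane subsets of [G] are safe and [X] contains a largest one. *)
Lemma maximal_sets : exists X T : {set V * V},
  [/\ good X, oriented T, plane T, X \subset T &
   [/\ (forall a b, adj G a b -> ~~ adj X a b -> ~~ visible pt (adj X) a b),
   (forall a b, a != b -> visible pt (adj X) a b -> ~~ adj X a b ->
      ~ safe pt k (adj G) (add_edge (adj X) a b)),
   (forall a b, a != b -> visible pt (adj T) a b -> adj T a b) &
   (forall H : {set V * V}, H \subset G -> plane H -> (#|H| <= #|G :&: T|)%N)]].
Proof.
pose M := #|{: V * V}|.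
pose f (X : {set V * V}) := (#|X :&: G| * M.+1 + #|X|)%N.
have g0 : `[< good set0 >] by apply/asboolP/good_sub; [exact: sub0set | exact: plane0].
have [X /asboolP gX Xmax'] := @arg_maxnP _ set0 (fun X => `[< good X >]) f g0.
have Xmax Y : good Y -> (f Y <= f X)%N by move=> gY; apply: Xmax'; apply/asboolP.
have [oX pX sX] := gX.
pose Q := [pred T : {set V * V} | [&& X \subset T, oriented T & plane T]].
have QX : Q X by rewrite /Q /= subxx oX pX.
have [T /and3P[XT oT pT] Tmax'] := @arg_maxnP _ X Q (fun T => #|T|) QX.
have XM (Y : {set V * V}) : (#|Y| <= M)%N by exact: max_card.
have XGmax (H : {set V * V}) : H \subset G -> plane H -> (#|H| <= #|X :&: G|)%N.
  move=> HG pH; have := Xmax H (good_sub HG pH); rewrite /f (setIidPl HG).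
  by move/lex_le; apply.
have add_lt (A : {set V * V}) a b : oriented A -> a != b -> ~~ adj A a b -> #|ed a b |: A| = #|A|.+1.
  by move=> oA ab; rewrite (ed_adj _ _ oA) => h; rewrite cardsU1 h.
exists X, T; split=> //; split.
- move=> a b gab nX; apply/negP => vis.
  have ab : a != b by apply: contraTneq gab => ->; rewrite (adj_irr oG).
  have gY : good (ed a b |: X).
    split; [exact: oriented_add | exact: plane_add |].
    move=> p q u S pq B.
    case h : (adj X p q).
      apply: (sX p q u S h); apply: bundle_sub B => c d.
      by rewrite /adj !inE => /orP[] ->; rewrite ?orbT.
    apply: (bundle_G _ B); move: pq h gab; rewrite (adj_add oX ab) /add_edge => /or3P[->|/andP[]|/andP[]] //;
      move=> /eqP -> /eqP -> // _; by rewrite adj_sym.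
  have /lex_le/(_ (XM X)) := Xmax _ gY.
  have -> : (ed a b |: X) :&: G = ed a b |: (X :&: G).
    apply/setP => e; rewrite !inE; case: eqP => //= ->.
    by rewrite -(ed_adj _ _ oG) gab.
  by rewrite cardsU1 !inE -(ed_adj _ _ oX) (negbTE nX) /= add1n ltnn.
- move=> a b ab vis nX; rewrite -(adj_add oX ab) => sY.
  have gY : good (ed a b |: X) by split=> //; [exact: oriented_add | exact: plane_add].
  have le : (#|X :&: G| <= #|(ed a b |: X) :&: G|)%N by apply/subset_leq_card/setSI/subsetUr.
  by have /lex_lt/(_ le) := Xmax _ gY; rewrite add_lt // ltnn.
- move=> a b ab vis; apply: contraT => nT.
  rewrite -(ltnn #|T|) -(add_lt T a b oT ab nT); apply: Tmax'; rewrite /Q /=.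
  by rewrite (subset_trans XT (subsetUr _ _)) oriented_add // plane_add.
- move=> H HG pH; apply: leq_trans (XGmax H HG pH) _.
  by rewrite setIC; apply/subset_leq_card/setIS.
Qed.
End KPlanar.

(** * Local inequality in a triangle *)

(** The arithmetic of one triangle: [n1], [n2], [n3] are the sizes of its classes,
    and each [g] tells whether the opposite side is missing from the graph. *)
Lemma three_classes (k n1 n2 n3 g1 g2 g3 : nat) : (k <= 4 ->
  n1 <= k -> n2 <= k -> n3 <= k -> g1 <= 1 -> g2 <= 1 -> g3 <= 1 ->
  (0 < n1 -> n2 + n3 + 1 <= k) -> (0 < n2 -> n3 + n1 + 1 <= k) -> (0 < n3 -> n1 + n2 + 1 <= k) ->
  (1 < n1 -> g1 = 0 -> n2 + n3 + 2 <= k) -> (1 < n2 -> g2 = 0 -> n3 + n1 + 2 <= k) ->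
  (1 < n3 -> g3 = 0 -> n1 + n2 + 2 <= k) ->
  n1 + n2 + n3 <= k + g1 + g2 + g3)%N.
Proof. lia. Qed.

Section Local.
Variables (R : realFieldType) (V : finType) (pt : V -> R * R).
Hypothesis xI : injective (fun v => (pt v).1).
Hypothesis gp : gen_pos pt.
Notation x v := ((pt v).1).
Notation tn a b c := (turn (pt a) (pt b) (pt c)).
Notation cr a b c d := (cross (pt a) (pt b) (pt c) (pt d)).
Notation oriented := (oriented pt).
Notation plane := (plane pt).
Notation ed := (ed pt).
Variables (k : nat) (G T : {set V * V}).
Hypothesis oG : oriented G.
Hypothesis Gk : forall a b, (a, b) \in G -> (#|crossers pt G a b| <= k)%N.
Hypothesis oT : oriented T.
Hypothesis pT : plane T.
Hypothesis Tmax : forall a b, a != b -> visible pt (adj T) a b -> adj T a b.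
Hypothesis GTmax : forall H : {set V * V}, H \subset G -> plane H -> (#|H| <= #|G :&: T|)%N.
Notation trg v a b := (tri pt (adj T) v a b).
Notation cls v a b := (class pt (adj G) v a b).

Let Tpl : plane_rel pt (adj T). Proof. exact/planeE. Qed.

(** Otherwise [a b] could join the plane set [G :&: T]. *)
Lemma outside_hit a b : adj G a b -> ~~ adj T a b ->
  exists2 f, f \in G :&: T & cr a b f.1 f.2.
Proof.
move=> gab nT; apply/exists_inP; apply: contraT => /exists_inPn nf.
have vis : visible pt (adj (G :&: T)) a b.
  apply/visibleP => c d; rewrite /adj => /orP[] /nf //=.
  by rewrite cross_swapr.
have sub : ed a b |: (G :&: T) \subset G.
  by rewrite subUset subsetIl sub1set -(ed_adj _ _ oG) gab.
have := GTmax sub (plane_add (planeS (subsetIr _ _) pT) vis).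
by rewrite cardsU1 !inE -(ed_adj _ _ oT) (negbTE nT) andbF add1n ltnn.
Qed.

Lemma class_outside v a b c : trg v a b -> c \in cls v a b -> ~~ adj T v c.
Proof.
move=> /and5P[_ Tab _ _ _]; rewrite inE => /andP[_ c1]; apply/negP => Tvc.
by have := Tpl Tvc Tab; rewrite c1.
Qed.

(** The edges counted all cross [v c], and they are distinct since those of the
    classes are not in [T]. *)
Lemma class_room v a b c (D : {set V * V}) : trg v a b -> c \in cls v a b ->
  D \subset G :&: T -> (forall f, f \in D -> cr v c f.1 f.2) ->
  (#|cls a b v| + #|cls b v a| + #|D| <= k)%N.
Proof.
move=> tr cC DGT Dc; have vab : 0 < tn v a b by case/and5P: tr.
have abv : 0 < tn a b v by rewrite turn_rot.
have bva : 0 < tn b v a by rewrite -turn_rot.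
have tr2 : trg a b v by rewrite -tri_rot.
have tr3 : trg b v a by rewrite -tri_rot.
have [Gvc c1] : adj G v c /\ cr v c a b by move: cC; rewrite inE => /andP[].
apply: leq_trans (adj_crossers Gk Gvc).
pose E2 := ed a @: cls a b v; pose E3 := ed b @: cls b v a.
have -> : #|cls a b v| = #|E2| by rewrite card_imset // => s t; apply: ed_injr.
have -> : #|cls b v a| = #|E3| by rewrite card_imset // => s t; apply: ed_injr.
have d23 : [disjoint E2 & E3].
  apply/pred0Pn => -[e /andP[/imsetP[d]]] /=; rewrite inE => /andP[_ cd] -> /imsetP[d' _].
  case/ed_inj => -[ab d'b]; first by move: vab; rewrite ab turn_abb ltxx.
  move: cd; rewrite d'b crossC => /andP[_]; by rewrite turn_abb mul0r ltxx.
have dD (E : {set V * V}) : (forall e, e \in E -> e \notin T) -> [disjoint E & D].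
  move=> h; apply/pred0Pn => -[e /andP[/= /h h' /(subsetP DGT)]].
  by rewrite inE (negbTE h') andbF.
have dU : [disjoint E2 :|: E3 & D].
  apply: dD => _ /setUP[] /imsetP[d dC ->]; rewrite -(ed_adj _ _ oT).
    exact: class_outside tr2 dC.
  exact: class_outside tr3 dC.
rewrite -(eqP (_ : #|E2 :|: E3| == #|E2| + #|E3|)%N); last by rewrite (leq_card_setU _ _).2.
rewrite -(eqP (_ : #|E2 :|: E3 :|: D| == #|E2 :|: E3| + #|D|)%N); last by rewrite (leq_card_setU _ _).2.
apply/subset_leq_card/subsetP => e /setUP[/setUP[]|eD].
- case/imsetP => d; rewrite inE => /andP[Gad cd] ->.
  by apply: ed_crossers => //; apply: class_cross vab c1 cd.
- case/imsetP => d; rewrite inE => /andP[Gbd cd] ->.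
  apply: ed_crossers => //; rewrite crossC.
  exact: class_cross bva cd c1.
- by rewrite inE Dc // andbT; have := subsetP DGT e eD; rewrite inE => /andP[].
Qed.

(** Two edges of the class that meet nothing of [G :&: T] but [a b] could replace
    it there. *)
Lemma class_exchange v a b : trg v a b -> adj G a b -> (1 < #|cls v a b|)%N ->
  exists2 c, c \in cls v a b & exists2 f, f \in G :&: T & (f != ed a b) && cr v c f.1 f.2.
Proof.
move=> tr Gab /card_gt1P[c [d [cC dC cd]]].
have [Tva Tab Tbv vab _] := and5P tr.
apply: contrapT => no.
have vis s : s \in cls v a b -> visible pt (adj (G :&: T :\ ed a b)) v s.
  move=> sC; apply/visibleP => e f; rewrite /adj => /orP[] h; apply/negP => h'; apply: no; exists s => //.
    by move: h => /setD1P[h1 h2]; exists (e, f); rewrite ?h1.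
  move: h => /setD1P[h1 h2]; exists (f, e); rewrite ?h1 //=.
  by rewrite cross_swapr.
pose H0 := G :&: T :\ ed a b.
have pH0 : plane H0 by apply: planeS pT; rewrite /H0 subDset (subset_trans (subsetIr _ _)) ?subsetUr.
pose H1 := ed v c |: H0; have pH1 : plane H1 by apply: plane_add => //; apply: vis.
pose H2 := ed v d |: H1.
have oH0 : oriented H0.
  by apply: orientedS oT; rewrite /H0 subDset (subset_trans (subsetIr _ _)) ?subsetUr.
have cn : v != c.
  by move: cC; rewrite inE => /andP[g _]; apply: contraTneq g => ->; rewrite (adj_irr oG).
have pH2 : plane H2.
  apply: plane_add => //; apply/visibleP => e f; rewrite /H1 (adj_add oH0 cn) /add_edge.
  move=> /or3P[|/andP[/eqP -> /eqP ->]|/andP[/eqP -> /eqP ->]].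
  - by move: e f; apply/visibleP/vis.
  - exact: cross_self.
  - by rewrite cross_swapr; exact: cross_self.
have inG s : s \in cls v a b -> ed v s \in G.
  by rewrite inE -(ed_adj _ _ oG) => /andP[].
have H2G : H2 \subset G.
  rewrite !subUset !sub1set !inG //= /H0 subDset (subset_trans (subsetIl _ _)) ?subsetUr //.
have := GTmax H2G pH2.
have nTs s : s \in cls v a b -> ed v s \notin T.
  by move=> sC; rewrite -(ed_adj _ _ oT); apply: class_outside tr sC.
have abGT : ed a b \in G :&: T by rewrite inE -!ed_adj // Gab.
rewrite cardsU1 /H1 cardsU1 (cardsD1 (ed a b) (G :&: T)) abGT /H0 !inE.
rewrite (negbTE (nTs c cC)) (negbTE (nTs d dC)) !andbF orbF.
case: eqP => [/ed_injr dc|_]; first by rewrite dc eqxx in cd.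
by rewrite addnA /= ltnn.
Qed.

Hypothesis k4 : (k <= 4)%N.
Hypothesis class_k : forall v a b, trg v a b -> (#|cls v a b| <= k)%N.

(** An edge of one class crosses the other two classes and an edge of [G :&: T];
    when its class has two members and the side it leaves through belongs to [G],
    one of them crosses two edges of [G :&: T]. *)
Lemma local_bound v a b : trg v a b ->
  (#|cls v a b| + #|cls a b v| + #|cls b v a| <=
     k + ~~ adj G a b + ~~ adj G b v + ~~ adj G v a)%N.
Proof.
move=> tr1.
have tr2 : trg a b v by rewrite -tri_rot.
have tr3 : trg b v a by rewrite -tri_rot.
have one p q r : trg p q r -> (0 < #|cls p q r|)%N -> (#|cls q r p| + #|cls r p q| + 1 <= k)%N.
  move=> tr /card_gt0P[c cC].
  have [|f fGT fc] := @outside_hit p c _ (class_outside tr cC).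
    by move: cC; rewrite inE => /andP[].
  rewrite -(cards1 f); apply: (class_room tr cC); first by rewrite sub1set.
  by move=> e; rewrite inE => /eqP ->.
have two p q r : trg p q r -> (1 < #|cls p q r|)%N -> ~~ adj G q r = 0 :> nat ->
    (#|cls q r p| + #|cls r p q| + 2 <= k)%N.
  move=> tr h /eqP; rewrite eqb0 negbK => Gqr.
  have [c cC [f fGT /andP[fn fc]]] := class_exchange tr Gqr h.
  have <- : #|[set f; ed q r]| = 2%N by rewrite cards2 fn.
  apply: (class_room tr cC).
    have [_ Tqr _ _ _] := and5P tr.
    by rewrite subUset !sub1set fGT inE -!ed_adj // Gqr.
  move=> e; rewrite !inE => /orP[] /eqP -> //; rewrite ed_cross.
  by move: cC; rewrite inE => /andP[].
apply: (three_classes k4); rewrite ?class_k ?leq_b1 //.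
- exact: one.
- exact: one.
- exact: one.
- exact: two.
- exact: two.
- exact: two.
Qed.
End Local.

(** * Graphs with few crossings per edge *)

Lemma sum_bool (I : finType) (P b : pred I) :
  \sum_(i | P i) (b i : nat) = #|[set i | P i && b i]|.
Proof. by rewrite -sum1dep_card big_mkcondr; apply: eq_bigr => i _; case: (b i). Qed.

Lemma k_planar_count (k g t n gt tg i : nat) : (3 * gt <= k * (2 * t) + 3 * tg ->
  gt + i = 2 * g -> tg + i = 2 * t -> t <= 3 * n -> g <= (k + 3) * n)%N.
Proof. nia. Qed.

Section Count.
Variables (R : realFieldType) (V : finType) (pt : V -> R * R).
Hypothesis xI : injective (fun v => (pt v).1).
Hypothesis gp : gen_pos pt.
Notation x v := ((pt v).1).
Notation tn a b c := (turn (pt a) (pt b) (pt c)).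
Notation cr a b c d := (cross (pt a) (pt b) (pt c) (pt d)).

(** An edge of [G] outside [T] leaves an empty triangle through the opposite side
    at both of its ends, while [T] has at most two triangles per edge. The sum of
    the local bounds is [3 |G - T| <= k |T| + 3 |T - G|]. *)
Theorem k_planar (k : nat) (G : {set V * V}) : (k <= 4)%N -> oriented pt G ->
  (forall a b, (a, b) \in G -> (#|crossers pt G a b| <= k)%N) ->
  (#|G| <= (k + 3) * #|V|)%N.
Proof.
move=> k4 oG Gk.
have [X [T [[oX pX sX] oT pT XT [Ghit Xmax Tmax GTmax]]]] := maximal_sets xI oG Gk.
have Tpl : plane_rel pt (adj T) by apply/planeE.
have XTa a b : adj X a b -> adj T a b.
  by rewrite /adj => /orP[] /(subsetP XT) ->; rewrite ?orbT.
have clk v a b : tri pt (adj T) v a b -> (#|class pt (adj G) v a b| <= k)%N.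
  apply: (class_le (ptI xI) gp (@adj_sym _ X) (adj_irr oX) (@adj_sym _ T) (adj_irr oT) (adj_irr oG) Tpl XTa) => //.
  exact: (star_adj oG Gk).
have loc := local_bound oG Gk oT pT GTmax k4 clk.
have trE := tri_exists (ptI xI) gp (@adj_sym _ T) (adj_irr oT) Tpl Tmax.
have trU := tri_unique gp (@adj_sym _ T) (adj_irr oT) Tpl.
pose T3 := [set t : V * V * V | tri pt (adj T) t.1.1 t.1.2 t.2].
pose rot (t : V * V * V) := (t.1.2, t.2, t.1.1).
have rotI : injective rot by move=> [[a b] c] [[d e] f] [-> -> ->].
have rotT t : (rot t \in T3) = (t \in T3) by rewrite !inE -tri_rot.
pose cl (t : V * V * V) := class pt (adj G) t.1.1 t.1.2 t.2.
pose g (t : V * V * V) : nat := ~~ adj G t.1.2 t.2.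
have sum_rot (F : V * V * V -> nat) : \sum_(t in T3) F (rot t) = \sum_(t in T3) F t.
  by rewrite [RHS](reindex_inj rotI); apply: eq_bigl => t; rewrite rotT.
have L : (3 * (\sum_(t in T3) #|cl t|) <= k * #|T3| + 3 * \sum_(t in T3) g t)%N.
  have : (\sum_(t in T3) (#|cl t| + #|cl (rot t)| + #|cl (rot (rot t))|) <=
      \sum_(t in T3) (k + g t + g (rot t) + g (rot (rot t))))%N.
    by apply: leq_sum => -[[v a] b]; rewrite inE; apply: loc.
  rewrite !big_split /= (sum_rot (fun t => #|cl (rot t)|)) !(sum_rot (fun t => #|cl t|)).
  rewrite (sum_rot (fun t => g (rot t))) !(sum_rot g) sum_nat_const.
  by rewrite mulnC -!addnA !mulSn mul0n !addn0.
have base : {in T3 &, injective (fun t : V * V * V => (t.1.2, t.2))}.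
  move=> [[v a] b] [[w c] d]; rewrite !inE /= => t1 t2 [ac bd]; rewrite -ac -bd in t2 *.
  by rewrite (trU _ _ _ _ t1 t2).
have cT3 : (#|T3| <= #|dir T|)%N.
  rewrite -(card_in_imset base); apply/subset_leq_card/subsetP => _ /imsetP[t tT ->].
  by move: tT; rewrite !inE => /and5P[].
have cg : (\sum_(t in T3) g t <= #|dir T :\: dir G|)%N.
  rewrite sum_bool.
  rewrite -(card_in_imset (f := fun t : V * V * V => (t.1.2, t.2))); last first.
    by apply: sub_in2 base => t; rewrite inE => /andP[].
  apply/subset_leq_card/subsetP => _ /imsetP[t tA ->].
  by move: tA; rewrite !inE => /andP[/and5P[_ -> _ _ _] ->].
have ch : (#|dir G :\: dir T| <= \sum_(t in T3) #|cl t|)%N.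
  pose P (e : V * V) (t : V * V * V) := (t.1.1 == e.1) && (e.2 \in cl t).
  apply: (@leq_trans (\sum_(e in dir G :\: dir T) \sum_(t in T3) P e t)%N).
    rewrite -sum1_card; apply: leq_sum => -[v c]; rewrite !inE /= => /andP[nT Gvc].
    have vc : v != c by apply: contraTneq Gvc => ->; rewrite (adj_irr oG).
    have [a [b [tr ce]]] := trE _ _ vc nT.
    have tT : (v, a, b) \in T3 by rewrite inE.
    by rewrite (bigD1 _ tT) /= /P /= eqxx inE Gvc ce.
  rewrite exchange_big /=; apply: leq_sum => t _.
  rewrite sum_bool.
  apply: leq_trans (_ : #|(fun c => (t.1.1, c)) @: cl t| <= _)%N; last exact: leq_imset_card.
  apply/subset_leq_card/subsetP => -[v c]; rewrite inE => /andP[_ /andP[/= /eqP <- cC]].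
  by apply/imsetP; exists c.
have T3n : (#|T| <= 3 * #|V|)%N.
  apply: (plane_bound xI gp) => [a b|a b c d]; first exact: orientedP.
  exact: planeP.
apply: (@k_planar_count k #|G| #|T| #|V| #|dir G :\: dir T| #|dir T :\: dir G| #|dir G :&: dir T|) => //.
- rewrite -(card_dir oT); apply: leq_trans (leq_trans L _); first by rewrite leq_mul2l ch.
  by rewrite leq_add // leq_mul2l // ?cT3 ?cg orbT.
- by rewrite -(card_dir oG) addnC cardsID.
- by rewrite -(card_dir oT) setIC addnC cardsID.
Qed.
End Count.

(** * The crossing lemma *)

Lemma card_disjointU (I : finType) (A B : {set I}) :
  [disjoint A & B] -> #|A :|: B| = (#|A| + #|B|)%N.
Proof. by move=> d; apply/eqP; rewrite (leq_card_setU A B).2. Qed.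

Section Crossings.
Variables (R : realFieldType) (V : finType) (pt : V -> R * R).
Notation cr a b c d := (cross (pt a) (pt b) (pt c) (pt d)).

(** Ordered pairs of crossing edges: twice the number of crossings. *)
Definition crossings (G : {set V * V}) : {set (V * V) * (V * V)} :=
  [set p | [&& p.1 \in G, p.2 \in G & cr p.1.1 p.1.2 p.2.1 p.2.2]].

Lemma crossings_remove (G : {set V * V}) e : e \in G ->
  (#|crossings (G :\ e)| + 2 * #|crossers pt G e.1 e.2| <= #|crossings G|)%N.
Proof.
move=> eG; set C := crossers _ _ _ _.
have eC : e \notin C by rewrite /C inE negb_and cross_self orbT.
pose A := [set (e, f) | f in C]; pose B := [set (f, e) | f in C].
have cA : #|A| = #|C| by rewrite card_imset // => f g [].
have cB : #|B| = #|C| by rewrite card_imset // => f g [].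
have d1 : [disjoint A & B].
  apply/pred0Pn => -[_ /andP[/imsetP[f fC ->] /imsetP[g gC [h _]]]].
  by rewrite -h (negbTE eC) in gC.
have d2 : [disjoint crossings (G :\ e) & A :|: B].
  apply/pred0Pn => -[[f g] /andP[]] /=; rewrite inE /= !inE => /and3P[/andP[fe _] /andP[ge _] _].
  by case/orP => /imsetP[h _ [h1 h2]]; [move: fe; rewrite h1 eqxx | move: ge; rewrite h2 eqxx].
rewrite mul2n -addnn -{1}cA -cB.
rewrite -(card_disjointU d1) -(card_disjointU d2).
apply/subset_leq_card; rewrite !subUset; apply/and3P; split; apply/subsetP.
- by move=> [f g]; rewrite !inE /= => /and3P[/andP[_ ->] /andP[_ ->] ->].
- by move=> _ /imsetP[f fC ->]; move: fC; rewrite !inE /= eG => /andP[-> ->].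
- by move=> _ /imsetP[f fC ->]; move: fC; rewrite !inE /= eG crossC => /andP[-> ->].
Qed.

Hypothesis xI : injective (fun v => (pt v).1).
Hypothesis gp : gen_pos pt.

(** Removing an edge with more than [m] crossings pays for the decrease of the
    sum. *)
Lemma removal_step (g n : nat) : (3 * n < g)%N -> exists2 m, (m <= 4)%N & ((m + 3) * n < g)%N /\
  (\sum_(k < 5) (g - (k + 3) * n) <= \sum_(k < 5) (g.-1 - (k + 3) * n) + m.+1)%N.
Proof.
move=> h; rewrite !big_ord_recr !big_ord0 /=.
case: (ltnP (7 * n) g) => h7; first by exists 4%N => //; lia.
case: (ltnP (6 * n) g) => h6; first by exists 3%N => //; lia.
case: (ltnP (5 * n) g) => h5; first by exists 2%N => //; lia.
case: (ltnP (4 * n) g) => h4; first by exists 1%N => //; lia.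
by exists 0%N => //; lia.
Qed.

(** Removing, again and again, an edge with the number of crossings granted by
    the bounds on [k]-planar graphs. *)
Lemma crossings_sum (G : {set V * V}) : oriented pt G ->
  (2 * \sum_(k < 5) (#|G| - (k + 3) * #|V|) <= #|crossings G|)%N.
Proof.
have [N leN] := ubnP #|G|; elim: N => // N IH in G leN *.
move=> oG; case: (leqP #|G| (3 * #|V|)) => h.
  rewrite big1 // => k _; apply/eqP; rewrite subn_eq0 (leq_trans h) // leq_mul2r.
  by rewrite -{1}[3%N]add0n leq_add2r leq0n orbT.
have [m m4 [hm hs]] := removal_step h.
have [e eG em] : exists2 e, e \in G & (m < #|crossers pt G e.1 e.2|)%N.
  apply/exists_inP; apply: contraLR hm => /exists_inPn no; rewrite -leqNgt.
  by apply: (k_planar xI gp m4 oG) => a b ab; rewrite leqNgt; apply: (no (a, b)).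
have cG : #|G| = #|G :\ e|.+1 by rewrite (cardsD1 e G) eG.
have := IH (G :\ e) _ (orientedS (subsetDl _ _) oG).
rewrite -(ltn_add2r 1) !addn1 -cG => /(_ leN) IH1.
apply: leq_trans (crossings_remove eG).
move: hs; rewrite {2}cG /= => hs.
apply: leq_trans (leq_mul (leqnn 2) hs) _.
by rewrite mulnDr leq_add // leq_mul2l em.
Qed.
End Crossings.

Section Sampling.
Variables (R : realFieldType) (V : finType).

(** Probability of the set [S] when every vertex is drawn with probability [p]. *)
Definition weight (p : R) (S : {set V}) : R := \prod_v (if v \in S then p else 1 - p).

Lemma weight_ge0 p S : 0 <= p <= 1 -> 0 <= weight p S.
Proof.
move=> /andP[p0 p1]; apply: prodr_ge0 => v _; case: ifP => _ //; by rewrite subr_ge0.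
Qed.

(** The factors of the vertices in [A] are forced, each of the others sums to one. *)
Lemma weight_above p (A : {set V}) : \sum_(S : {set V}) (A \subset S)%:R * weight p S = p ^+ #|A|.
Proof.
transitivity (\prod_v (p + (if v \in A then 0 else 1 - p))).
  rewrite (@bigA_distr _ 0 1 *%R +%R); apply: eq_bigr => S _; rewrite /weight.
  case AS: (A \subset S); rewrite ?mul1r ?mul0r.
    by apply: eq_bigr => v _; case: ifP => // vS; case: ifP => // /(subsetP AS); rewrite vS.
  have /subsetPn[v vA vS] := negbT AS.
  by rewrite (bigD1 v) //= (negbTE vS) vA mul0r.
rewrite (bigID (mem A)) /= [X in _ * X]big1 ?mulr1 => [|v /negbTE ->]; last by rewrite addrC subrK.
rewrite (eq_bigr (fun=> p)) => [|v ->]; last by rewrite addr0.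
by rewrite prodr_const.
Qed.

(** Linearity of expectation. *)
Lemma expected_inside p (I : finType) (P : pred I) (A : I -> {set V}) m :
  (forall i, P i -> #|A i| = m) ->
  \sum_(S : {set V}) (#|[set i | P i && (A i \subset S)]|)%:R * weight p S = #|P|%:R * p ^+ m.
Proof.
move=> hA; transitivity (\sum_(S : {set V}) \sum_(i | P i) (A i \subset S)%:R * weight p S).
  apply: eq_bigr => S _; rewrite -mulr_suml; congr (_ * _).
  by rewrite -sum_bool natr_sum.
rewrite exchange_big /= (eq_bigr (fun=> p ^+ m)) => [|i Pi]; last by rewrite weight_above hA.
by rewrite sumr_const mulr_natl.
Qed.
End Sampling.

Section CrossingLemma.
Variables (R : realFieldType) (V : finType) (pt : V -> R * R).
Hypothesis xI : injective (fun v => (pt v).1).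
Hypothesis gp : gen_pos pt.
Variable G : {set V * V}.
Hypothesis oG : oriented pt G.

Definition ends (e : V * V) : {set V} := [set e.1; e.2].

(** [crossings_sum] for the subgraph induced on [S], in its linear form. *)
Lemma crossings_inside (S : {set V}) :
  (10 * #|[set e | (e \in G) && (ends e \subset S)]| <= 50 * #|S| +
   #|[set p | (p \in crossings pt G) && (ends p.1 :|: ends p.2 \subset S)]|)%N.
Proof.
pose W := {v : V | v \in S}.
pose f (e : W * W) := (val e.1, val e.2).
have fI : injective f by move=> [a b] [c d] [/val_inj -> /val_inj ->].
pose H : {set W * W} := [set e | f e \in G].
have endsS e : (ends e \subset S) = (e.1 \in S) && (e.2 \in S).
  by rewrite subUset !sub1set.
have cH : #|H| = #|[set e | (e \in G) && (ends e \subset S)]|.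
  rewrite -(card_imset _ fI); congr (#|pred_of_set _|); apply/setP => -[a b]; rewrite !inE endsS.
  apply/imsetP/idP => [[[c d]]|/and3P[ab aS bS]].
    rewrite inE => h [-> ->]; rewrite h; apply/and3P.
    by split=> //; [exact: (valP c) | exact: (valP d)].
  by exists (exist _ a aS, exist _ b bS); rewrite ?inE.
have oH : oriented (pt \o val) H.
  by apply/forall_inP => e; rewrite inE => /(orientedP oG).
have gpW : gen_pos (pt \o (val : W -> V)).
  by move=> a b c ab ac bc; apply: gp; rewrite (inj_eq val_inj).
have xIW : injective (fun w : W => ((pt \o val) w).1).
  by move=> a b /= /xI/val_inj.
have := crossings_sum xIW gpW oH; rewrite cH card_sig.
rewrite (_ : #|[pred x | x \in S]| = #|S|); last exact: eq_card.
have : (#|crossings (pt \o val) H| <=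
  #|[set p | (p \in crossings pt G) && (ends p.1 :|: ends p.2 \subset S)]|)%N.
  rewrite -(card_imset (f := fun p => (f p.1, f p.2))); last first.
    by move=> [[a1 a2] [b1 b2]] [[c1 c2] [d1 d2]] [/val_inj -> /val_inj -> /val_inj -> /val_inj ->].
  apply/subset_leq_card/subsetP => _ /imsetP[[a b] p ->]; move: p.
  case: a b => [a1 a2] [b1 b2]; rewrite !inE !subUset !sub1set => -> /=.
  by rewrite (valP a1) (valP a2) (valP b1) (valP b2).
rewrite !big_ord_recr !big_ord0 /=; set g := #|_|; set x := #|_|; set s := #|_|; set y := #|_|.
by clear; clearbody g x s y; lia.
Qed.

(** The expectation of [crossings_inside] over a random set of vertices. *)
Theorem crossing_lemma : (15 * #|V| <= 2 * #|G|)%N ->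
  (8 * #|G| ^ 3 <= 135 * #|V| ^ 2 * #|crossings pt G|)%N.
Proof.
move=> dense.
have [->|e0] := posnP #|G|; first by rewrite exp0n.
have V0 : (0 < #|V|)%N.
  by case/card_gt0P: e0 => -[a _] _; apply/card_gt0P; exists a.
pose e : R := #|G|%:R; pose n : R := #|V|%:R; pose c : R := #|crossings pt G|%:R.
have eR : 0 < e by rewrite ltr0n.
have nR : 0 < n by rewrite ltr0n.
(* the probability that optimizes the constant *)
pose p := 15 * n / (2 * e).
have p0 : 0 < p by rewrite /p divr_gt0 ?mulr_gt0.
have p1 : p <= 1.
  by rewrite /p ler_pdivrMr ?mulr_gt0 // mul1r /e /n -!natrM ler_nat.
have p01 : 0 <= p <= 1 by rewrite ltW.
have main : 10 * (e * p ^+ 2) <= 50 * (n * p) + c * p ^+ 4.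
  have h2 : forall f, f \in G -> #|ends f| = 2%N.
    by move=> [a b] /(orientedP oG) ab; rewrite cards2 /=; case: eqP ab => [->|//]; rewrite ltxx.
  have h4 : forall q, q \in crossings pt G -> #|ends q.1 :|: ends q.2| = 4%N.
    move=> [[a b] [c' d]]; rewrite inE => /and3P[_ _ /cross_neq] /=.
    move=> [ab cd [ac ad bc bd]].
    rewrite card_disjointU ?cards2 /= ?ab ?cd //.
    apply/pred0Pn => -[z /andP[]]; rewrite /= !inE => /orP[] /eqP -> /orP[] /eqP /= h.
    - by rewrite h eqxx in ac.
    - by rewrite h eqxx in ad.
    - by rewrite h eqxx in bc.
    - by rewrite h eqxx in bd.
  have E2 := @expected_inside R V p _ (mem G) ends 2 h2.
  have E4 := @expected_inside R V p _ (mem (crossings pt G)) (fun q => ends q.1 :|: ends q.2) 4 h4.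
  have E1 := @expected_inside R V p _ predT (fun v : V => [set v]) 1 (fun v _ => cards1 v).
  rewrite expr1 in E1.
  have -> : e * p ^+ 2 = #|mem G|%:R * p ^+ 2 by [].
  rewrite -E2 -[n * p]E1 -[c * p ^+ 4]E4 !mulr_sumr -big_split /=.
  apply: ler_sum => S _; rewrite !mulrA -mulrDl.
  apply: ler_wpM2r; first exact: weight_ge0.
  rewrite -!natrM -natrD ler_nat.
  have -> : #|[set v : V | predT v && ([set v] \subset S)]| = #|S|.
    by apply: eq_card => v; rewrite inE sub1set.
  exact: crossings_inside.
have key : 8 * e ^+ 3 <= 135 * n ^+ 2 * c.
  have E : 135 * n ^+ 2 * c - 8 * e ^+ 3 =
     (50 * (n * p) + c * p ^+ 4 - 10 * (e * p ^+ 2)) * (135 * n ^+ 2 / p ^+ 4).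
    by rewrite /p; field; rewrite !gt_eqF.
  rewrite -subr_ge0 E; apply: mulr_ge0; first by rewrite subr_ge0.
  by rewrite !mulr_ge0 ?invr_ge0 ?exprn_ge0 ?ltW.
move: key; rewrite /e /n /c -!natrX -!natrM ler_nat //.
Qed.
End CrossingLemma.

(** * Halving edges *)

Section Det.
Variable R : realFieldType.
Implicit Types u v w p q r : R * R.

Definition dt u v : R := u.1 * v.2 - u.2 * v.1.

Lemma dtC u v : dt v u = - dt u v. Proof. rewrite /dt; ring. Qed.
Lemma dtv u : dt u u = 0. Proof. rewrite /dt; ring. Qed.
Lemma dtB w u v : dt w (u - v) = dt w u - dt w v. Proof. rewrite /dt /=; ring. Qed.
Lemma dtNl u v : dt (- u) v = - dt u v. Proof. rewrite /dt /=; ring. Qed.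
Lemma dtNr u v : dt u (- v) = - dt u v. Proof. rewrite /dt /=; ring. Qed.
Lemma turn_dt p q r : turn p q r = dt (q - p) (r - p).
Proof. rewrite turn.unlock /dt /=; ring. Qed.

Lemma dt_plucker u v w x : dt u v * dt w x = dt w v * dt u x + dt u w * dt v x.
Proof. rewrite /dt; ring. Qed.
End Det.

Section Halving.
Variables (R : realFieldType) (V : finType) (pt : V -> R * R).
Hypothesis xI : injective (fun v => (pt v).1).
Hypothesis gp : gen_pos pt.
Notation x v := ((pt v).1).
Notation tn a b c := (turn (pt a) (pt b) (pt c)).
Notation cr a b c d := (cross (pt a) (pt b) (pt c) (pt d)).

Definition right_of (a b : V) : {set V} := [set v | tn a b v < 0].

Variable h : nat.
Hypothesis Vh : #|V| = (2 * h + 2)%N.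

Definition halving (a b : V) : bool :=
  [&& a != b, #|right_of a b| == h & #|right_of b a| == h].

Definition halving_edges : {set V * V} := [set e | (x e.1 < x e.2) && halving e.1 e.2].
Notation G := halving_edges.

Lemma halving_sym a b : halving a b = halving b a.
Proof. by rewrite /halving eq_sym; congr (_ && _); rewrite andbC. Qed.

Lemma oG : oriented pt G.
Proof. by apply/forall_inP => e; rewrite inE => /andP[]. Qed.

Lemma adjG a b : adj G a b = halving a b.
Proof.
rewrite /adj !inE /= (halving_sym b a) -andb_orl; case hab: (halving a b); rewrite ?andbF // andbT.
have ab : a != b by case/and3P: hab.
by case: (ltgtP (x a) (x b)) => // /xI e; rewrite e eqxx in ab.
Qed.

Lemma right_of_sum a b : a != b -> (#|right_of a b| + #|right_of b a| = 2 * h)%N.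
Proof.
move=> ab; have E : [set: V] = [set a; b] :|: (right_of a b :|: right_of b a).
  apply/setP => v; rewrite !inE; case: (eqVneq v a) => //= va; case: (eqVneq v b) => //= vb.
  rewrite [tn b a v]turn_swap oppr_lt0.
  by have := gp ab (_ : a != v) (_ : b != v); rewrite ![_ == v]eq_sym va vb => /(_ isT isT); case: ltrgt0P.
have d1 : [disjoint right_of a b & right_of b a].
  apply/pred0Pn => -[v /andP[]] /=; rewrite !inE [tn b a v]turn_swap oppr_lt0 => h1 h2.
  by have := lt_trans h1 h2; rewrite ltxx.
have d2 : [disjoint [set a; b] & right_of a b :|: right_of b a].
  apply/pred0Pn => -[v /andP[]] /=; rewrite !inE => /orP[] /eqP ->;
  by rewrite ?turn_aba ?turn_abb ltxx.
have := cardsT V; rewrite E (card_disjointU d2) (card_disjointU d1) cards2 ab Vh; lia.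
Qed.

Lemma halvingE a b : a != b -> halving a b = (#|right_of a b| == h).
Proof.
move=> ab; rewrite /halving ab /=; have := right_of_sum ab.
case: eqP => //= ->; move=> e; apply/eqP; lia.
Qed.

Notation dir_vec e := (pt e.2 - pt e.1).

(** Of two parallel lines, one has everything on one side of the other, and its own
    points besides. *)
Lemma parallel_sub a b c d : dt (pt b - pt a) (pt d - pt c) = 0 -> x a < x b -> x c < x d ->
  tn a b c < 0 -> [set c; d] :|: right_of c d \subset right_of a b.
Proof.
move=> P ab cd abc.
have key r : tn c d r <= 0 -> tn a b r < 0.
  have E : (x b - x a) * tn c d r = (x d - x c) * (tn a b r - tn a b c).
    have := P; rewrite turn.unlock /dt /= => P'.
    rewrite -[LHS]addr0 -[X in _ + X](mulr0 ((pt r).1 - x c)) -P'; ring.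
  move=> le0; have : (x b - x a) * tn c d r <= 0 by rewrite pmulr_rle0 // subr_gt0.
  by rewrite E pmulr_rle0 ?subr_gt0 // subr_le0 => /le_lt_trans; apply.
apply/subsetP => r; rewrite !inE => /orP[/orP[]|] => [/eqP ->|/eqP ->|/ltW] //.
- by apply: key; rewrite turn_abb.
- exact: key.
Qed.

Lemma parallel_halving a b c d : (a, b) \in G -> (c, d) \in G ->
  dt (pt b - pt a) (pt d - pt c) = 0 -> (a, b) = (c, d).
Proof.
rewrite !inE /= => /andP[ab /and3P[ab' /eqP h1 _]] /andP[cd /and3P[cd' /eqP h2 _]] P.
have no p q r s : x p < x q -> x r < x s -> r != s -> #|right_of p q| = h -> #|right_of r s| = h ->
    dt (pt q - pt p) (pt s - pt r) = 0 -> ~~ (tn p q r < 0).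
  move=> pq rs rs' hp hr P'; apply/negP => /(parallel_sub P' pq rs)/subset_leq_card.
  rewrite card_disjointU ?cards2 ?rs' ?hp ?hr; first by lia.
  by apply/pred0Pn => -[v /andP[]] /=; rewrite !inE => /orP[] /eqP ->; rewrite ?turn_aba ?turn_abb ltxx.
have n1 := no a b c d ab cd cd' h1 h2 P.
have n2 := no c d a b cd ab ab' h2 h1.
rewrite dtC P oppr0 in n2; have {}n2 := n2 erefl.
have E : tn a b d = tn a b c.
  apply/eqP; rewrite -subr_eq0 -P; apply/eqP; rewrite turn.unlock /dt /=; ring.
have E2 : (x b - x a) * tn c d a = - ((x d - x c) * tn a b c).
  have := P; rewrite turn.unlock /dt /= => P'.
  rewrite -[LHS]addr0 -[X in _ + X](mulr0 (x a - x c)) -P'; ring.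
have abc : tn a b c = 0.
  apply/eqP; rewrite eq_le; apply/andP; split; last by rewrite leNgt.
  rewrite leNgt; apply/negP => pos; move/negP: n2; apply.
  by rewrite -(pmulr_rlt0 _ (_ : 0 < x b - x a)) ?subr_gt0 // E2 oppr_lt0 mulr_gt0 // subr_gt0.
have on r : tn a b r = 0 -> r = a \/ r = b.
  move=> z; case: (eqVneq r a) => [|ra]; [by left | case: (eqVneq r b) => [|rb]; first by right].
  by have := gp ab' (_ : a != r) (_ : b != r); rewrite ![_ == r]eq_sym ra rb z eqxx => /(_ isT isT).
case: (on c abc) => hc; case: (on d (etrans E abc)) => hd.
- by rewrite hc hd eqxx in cd'.
- by rewrite hc hd.
- by move: cd; rewrite hc hd ltNge ltW.
- by rewrite hc hd eqxx in cd'.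
Qed.

Lemma dt_slope a b c d : x a < x b -> x c < x d ->
  dt (pt b - pt a) (pt d - pt c) =
  (x b - x a) * (x d - x c) * (slope pt c d - slope pt a b).
Proof. by move=> ab cd; rewrite /dt /slope /=; field; rewrite !subr_eq0 !gt_eqF. Qed.

(** The halving edges in the order of their directions, each direction and its
    opposite once per turn. *)
Lemma events_exist : (0 < #|G|)%N -> exists ev : nat -> V * V,
  [/\ forall t, ev (t + #|G|)%N = ((ev t).2, (ev t).1),
      forall t, halving (ev t).1 (ev t).2,
      forall s t, (s < t < s + #|G|)%N -> 0 < dt (dir_vec (ev s)) (dir_vec (ev t)) &
      forall a b N, halving a b -> exists2 t, (N <= t < N + 2 * #|G|)%N & ev t = (a, b)].
Proof.
set m := #|G| => m0.
have [e0 _] := card_gt0P m0.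
pose sl (e : V * V) := slope pt e.1 e.2.
pose r := relpre sl <=%O; pose s := sort r (enum G).
have rt : transitive r by move=> a b c; apply: le_trans.
have rr : reflexive r by move=> a; apply: lexx.
have ss : sorted r s by apply: sort_sorted => a b; apply: le_total.
have sz : size s = m by rewrite size_sort -cardE.
have su : uniq s by rewrite sort_uniq enum_uniq.
have memG i : (i < m)%N -> nth e0 s i \in G.
  by move=> im; rewrite -mem_enum -(mem_sort r) mem_nth // sz.
have pos i j : (i < j < m)%N -> 0 < dt (dir_vec (nth e0 s i)) (dir_vec (nth e0 s j)).
  move=> /andP[ij jm]; have im := ltn_trans ij jm.
  have E : dt (dir_vec (nth e0 s i)) (dir_vec (nth e0 s j)) =
      (x (nth e0 s i).2 - x (nth e0 s i).1) * (x (nth e0 s j).2 - x (nth e0 s j).1) *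
      (sl (nth e0 s j) - sl (nth e0 s i)).
    have := memG i im; have := memG j jm; rewrite !inE => /andP[xj _] /andP[xi _].
    by rewrite dt_slope.
  rewrite lt_neqAle; apply/andP; split; last first.
    have := memG i im; have := memG j jm; rewrite !inE => /andP[xj _] /andP[xi _].
    rewrite E; apply: mulr_ge0; first by rewrite mulr_ge0 // subr_ge0 ltW.
    rewrite subr_ge0.
    have := sorted_leq_nth rt rr e0 ss => /(_ i j).
    rewrite !inE sz im jm => H; exact: (H isT isT (ltnW ij)).
  apply/negP => /eqP z.
  have h1 := memG i im; have h2 := memG j jm.
  have := @parallel_halving (nth e0 s i).1 (nth e0 s i).2 (nth e0 s j).1 (nth e0 s j).2.
  rewrite -!surjective_pairing => /(_ h1 h2 (esym z)) /eqP.
  by rewrite nth_uniq ?sz // => /eqP ij'; rewrite ij' ltnn in ij.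
pose sw (e : V * V) := (e.2, e.1).
pose ev t := let e := nth e0 s (t %% m) in if odd (t %/ m) then sw e else e.
have evm t : ev (t + m)%N = sw (ev t).
  rewrite /ev modnDr divnDr // divnn m0 addn1 /=.
  by case: (odd _) => //=; rewrite /sw /= -surjective_pairing.
have evm2 t c : ev (t + c * (2 * m))%N = ev t.
  elim: c => [|c IH]; first by rewrite mul0n addn0.
  rewrite mulSn addnA addnAC mul2n -addnn addnA !evm addnn -mul2n IH.
  by rewrite /sw /= -surjective_pairing.
exists ev; split=> //.
- move=> t; have := memG (t %% m)%N (ltn_pmod t m0); rewrite inE /ev => /andP[_ H].
  by case: (odd _) => //=; rewrite halving_sym.
- move=> i j /andP[ij jim].
  have [q [k [km ei]]] : exists q k, (k < m)%N /\ i = (q * m + k)%N.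
    by exists (i %/ m)%N, (i %% m)%N; rewrite ltn_pmod // -divn_eq.
  have evE q' k' : (k' < m)%N -> ev (q' * m + k')%N = if odd q' then sw (nth e0 s k') else nth e0 s k'.
    by move=> k'm; rewrite /ev modnMDl modn_small // divnMDl // divn_small // addn0.
  have swv e : dir_vec (sw e) = - dir_vec e by rewrite opprB.
  have evi : ev i = if odd q then sw (nth e0 s k) else nth e0 s k by rewrite ei evE.
  case: (ltnP (k + (j - i)) m) => kj.
    have ej : j = (q * m + (k + (j - i)))%N by lia.
    have P : 0 < dt (dir_vec (nth e0 s k)) (dir_vec (nth e0 s (k + (j - i)))).
      by apply: pos; apply/andP; split; lia.
    rewrite evi ej evE //; case: (odd q); last exact: P.
    by rewrite !swv dtNl dtNr opprK.
  have kj' : (k + (j - i) - m < m)%N by lia.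
  have ej : j = (q.+1 * m + (k + (j - i) - m))%N by rewrite mulSn; lia.
  have P : 0 < dt (dir_vec (nth e0 s (k + (j - i) - m))) (dir_vec (nth e0 s k)).
    by apply: pos; apply/andP; split; lia.
  rewrite dtC in P.
  rewrite evi ej evE //= ; case: (odd q); rewrite /= swv ?dtNl ?dtNr; exact: P.
- move=> a b N hab.
  have [t0 t0m et0] : exists2 t0, (t0 < 2 * m)%N & ev t0 = (a, b).
    have : adj G a b by rewrite adjG.
    have key e : e \in G -> exists2 i, (i < m)%N & nth e0 s i = e.
      move=> eG; exists (index e s); last by rewrite nth_index // mem_sort mem_enum.
      by rewrite -sz index_mem mem_sort mem_enum.
    rewrite /adj => /orP[] /key[i im ei].
      exists i; first by lia.
      by rewrite /ev modn_small // divn_small.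
    exists (i + m)%N; first by lia.
    by rewrite evm /ev modn_small // divn_small //= ei.
  exists (N + (t0 + (2 * m - 1) * N) %% (2 * m))%N.
    by rewrite leq_addr ltn_add2l ltn_pmod // muln_gt0.
  set c := (t0 + _)%N; have E := divn_eq c (2 * m).
  rewrite -(evm2 _ (c %/ (2 * m))%N) -addnA [(_ %% _ + _)%N]addnC -E /c.
  rewrite addnCA -[X in (t0 + (X + _))%N]mul1n -mulnDl (_ : (1 + (2 * m - 1) = 2 * m)%N); last by lia.
  by rewrite mulnC evm2.
Qed.
End Halving.

(** * The lower half turning with the direction *)

Section Tokens.
Variables (R : realFieldType) (V : finType) (pt : V -> R * R).
Hypothesis gp : gen_pos pt.
Notation x v := ((pt v).1).
Notation tn a b c := (turn (pt a) (pt b) (pt c)).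
Notation right_of := (right_of pt).
Variable h : nat.
Hypothesis Vh : #|V| = (2 * h + 2)%N.
Notation halving := (halving pt h).
Variables (m : nat) (ev : nat -> V * V).
Hypothesis m2 : (1 < m)%N.
Notation A t := (ev t).1.
Notation B t := (ev t).2.
Notation u t := (pt (B t) - pt (A t)).
Hypothesis ev_m : forall t, ev (t + m)%N = (B t, A t).
Hypothesis ev_h : forall t, halving (A t) (B t).
Hypothesis ev_dt : forall s t, (s < t < s + m)%N -> 0 < dt (u s) (u t).
Hypothesis ev_ex : forall a b N, halving a b -> exists2 t, (N <= t < N + 2 * m)%N & ev t = (a, b).

Lemma ev_2m t : ev (t + 2 * m)%N = ev t.
Proof. by rewrite mul2n -addnn addnA !ev_m -surjective_pairing. Qed.

Lemma u_m t : u (t + m)%N = - u t.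
Proof. by rewrite ev_m opprB. Qed.

Lemma dt_ge0 s t : (s <= t <= s + m)%N -> 0 <= dt (u s) (u t).
Proof.
move=> /andP[st tm]; case: (ltngtP s t) st => // [st|<-] _; last by rewrite dtv.
case: (ltngtP t (s + m)) tm => // [tm|->] _; first by rewrite ltW // ev_dt // st.
by rewrite u_m dtNr dtv oppr0.
Qed.

Lemma dt_lt0 s t : (s + m < t < s + 2 * m)%N -> dt (u s) (u t) < 0.
Proof.
move=> /andP[h1 h2]; have mt : (m <= t)%N by rewrite (leq_trans (leq_addl s m)) // ltnW.
by rewrite -(subnK mt) u_m dtNr oppr_lt0 ev_dt // ltn_subRL addnC h1 ltn_subLR // addnCA addnn -mul2n.
Qed.

Lemma evAB t : A t != B t. Proof. by case/and3P: (ev_h t). Qed.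

(** The lower half of the points while the direction turns from the event
    [t - 1] to the event [t]. *)
Definition low (t : nat) : {set V} := A t |: right_of (A t) (B t).

Lemma tn_u t z : tn (A t) (B t) z = dt (u t) (pt z - pt (A t)).
Proof. exact: turn_dt. Qed.

Lemma tn_neq0 t z : z != A t -> z != B t -> tn (A t) (B t) z != 0.
Proof. by move=> za zb; apply: gp; rewrite ?evAB // eq_sym. Qed.

Lemma low_le t z : z \in low t -> dt (u t) (pt z - pt (A t)) <= 0.
Proof.
by rewrite !inE -tn_u => /orP[/eqP ->|/ltW //]; rewrite turn_aba.
Qed.

Lemma low_lt t z : z \in low t -> z != A t -> dt (u t) (pt z - pt (A t)) < 0.
Proof. by rewrite !inE -tn_u => /orP[/eqP ->|//]; rewrite eqxx. Qed.

Lemma high_ge t z : z \notin low t -> 0 <= dt (u t) (pt z - pt (A t)).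
Proof. by rewrite !inE -tn_u negb_or -leNgt => /andP[]. Qed.

Lemma A_low t : A t \in low t. Proof. by rewrite !inE eqxx. Qed.

Lemma B_low t : B t \notin low t.
Proof. by rewrite !inE turn_abb ltxx orbF eq_sym evAB. Qed.

Lemma card_low t : #|low t| = h.+1.
Proof.
rewrite cardsU1 inE turn_aba ltxx add1n; by have /and3P[_ /eqP -> _] := ev_h t.
Qed.

(** Between two consecutive events no other pair can change sides: the first
    pair to do so would be a halving edge. *)
Lemma low_next t : low t.+1 = B t |: right_of (A t) (B t).
Proof.
set C := _ |: _; have dC : #|C| = h.+1.
  by rewrite cardsU1 inE turn_abb ltxx add1n; have /and3P[_ /eqP -> _] := ev_h t.
have D0 : 0 < dt (u t) (u t.+1) by apply: ev_dt; rewrite ltnS leqnn -addn1 ltn_add2l.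
have C_le z : z \in C -> dt (u t) (pt z - pt (A t)) <= 0.
  by rewrite !inE -tn_u => /orP[/eqP ->|/ltW //]; rewrite turn_abb.
have C_ge z : z \notin C -> 0 <= dt (u t) (pt z - pt (A t)).
  by rewrite !inE -tn_u negb_or -leNgt => /andP[].
pose P (e : V * V) := [&& e.1 \in C, e.2 \notin C & dt (u t.+1) (pt e.2 - pt e.1) <= 0].
apply/esym/eqP; rewrite eqEcard dC card_low leqnn andbT; apply: contraT => /subsetPn[p pC pL].
have [q qL qC] : exists2 q, q \in low t.+1 & q \notin C.
  apply/subsetPn/negP => sub; have /eqP E : low t.+1 == C by rewrite eqEcard sub card_low dC leqnn.
  by rewrite E pC in pL.
have P0 : P (p, q).
  rewrite /P pC qC /=; have := low_le qL; have := high_ge pL; rewrite !dtB.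
  by move=> h1 h2; rewrite subr_le0; lra.
have Ppos e : P e -> 0 < dt (u t) (pt e.2 - pt e.1).
  move=> /and3P[e1 e2 e3]; rewrite lt_neqAle; apply/andP; split; last first.
    by have := C_le _ e1; have := C_ge _ e2; rewrite !dtB; lra.
  apply/negP => /eqP e0.
  have zz2 : dt (u t) (pt e.2 - pt (A t)) = 0 /\ dt (u t) (pt e.1 - pt (A t)) = 0.
    by have := C_le _ e1; have := C_ge _ e2; move: e0; rewrite !dtB; split; lra.
  have on z : dt (u t) (pt z - pt (A t)) = 0 -> z = A t \/ z = B t.
    rewrite -tn_u => zz; case: (eqVneq z (A t)) => [|za]; first by left.
    case: (eqVneq z (B t)) => [|zb]; first by right.
    by have := tn_neq0 za zb; rewrite zz eqxx.
  have BC : B t \in C by rewrite !inE eqxx.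
  have AC : A t \notin C by rewrite !inE turn_aba ltxx (negbTE (evAB t)).
  have e1B : e.1 = B t by case: (on _ zz2.2) => // e1A; rewrite e1A (negbTE AC) in e1.
  have e2A : e.2 = A t by case: (on _ zz2.1) => // e2B; rewrite e2B BC in e2.
  by move: e3; rewrite e1B e2A -[pt (A t) - pt (B t)]opprB dtNr -dtC leNgt D0.
(* [rho e] decreases as the direction of [e] turns away from [u t]. *)
pose rho (e : V * V) := - dt (u t.+1) (pt e.2 - pt e.1) / dt (u t) (pt e.2 - pt e.1).
have [[a b] Pab amax] := @arg_maxP _ _ _ (p, q) P rho P0.
have W1 := Ppos _ Pab; have /and3P[/= aC bC W2] := Pab.
have best c d : c \in C -> d \notin C -> 0 <= dt (pt b - pt a) (pt d - pt c).
  move=> cC dC'; set w := pt b - pt a; set y := pt d - pt c.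
  have E : dt (u t) (u t.+1) * dt w y = dt w (u t.+1) * dt (u t) y + dt (u t) w * dt (u t.+1) y.
    exact: dt_plucker.
  have y1 : 0 <= dt (u t) y.
    by have := C_le _ cC; have := C_ge _ dC'; rewrite /y !dtB; lra.
  rewrite -(pmulr_rge0 _ D0) E [dt w _]dtC.
  case: (lerP (dt (u t.+1) y) 0) => y2.
    have Pcd : P (c, d) by rewrite /P cC dC'.
    have Y1 := Ppos _ Pcd; rewrite /= -/y in Y1.
    have : rho (c, d) <= rho (a, b) := amax _ Pcd.
    rewrite /rho /= -/w -/y ler_pdivrMr // mulrAC ler_pdivlMr //; lra.
  by rewrite addr_ge0 // mulr_ge0 ?oppr_ge0 // ltW.
have ab : a != b by apply: contraTneq aC => ->.
have RC : right_of a b = C :\ a.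
  apply/setP => v; rewrite !inE.
  case: (eqVneq v a) => [->|va] /=; first by rewrite turn_aba ltxx.
  case: (eqVneq v b) => [->|vb] /=.
    by rewrite turn_abb ltxx; move: bC; rewrite !inE => /negbTE ->.
  have n0 : tn a b v != 0 by apply: gp => //; rewrite eq_sym.
  have -> : (v == B t) || (tn (A t) (B t) v < 0) = (v \in C) by rewrite !inE.
  case vC: (v \in C).
    rewrite lt_neqAle n0 /= turn_dt; have := best v b vC bC.
    by have := dtv (pt b - pt a); rewrite !dtB; lra.
  by apply/negbTE; rewrite -leNgt turn_dt; apply: best => //; rewrite vC.
have hab : halving a b.
  by rewrite (halvingE gp Vh) // RC (cardsD1 a C) aC add1n in dC *; case: dC => ->.
have [j /andP[j1 j2] ej] := ev_ex t hab.
have uj : u j = pt b - pt a by rewrite ej.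
have jt : j = t.+1.
  case: (ltngtP j t.+1) => // jt.
    have jt' : j = t by apply/eqP; rewrite eqn_leq j1 -ltnS jt.
    by move: W1; rewrite -uj jt' dtv ltxx.
  case: (ltngtP j (t + m)) => jm.
  - have d1 : 0 < dt (u t.+1) (u j) by apply: ev_dt; rewrite jt addSn ltnS ltnW.
    by move: d1; rewrite uj ltNge W2.
  - have d1 : dt (u t) (u j) < 0 by apply: dt_lt0; rewrite jm j2.
    by move: d1; rewrite uj ltNge (ltW W1).
  - by move: W1; rewrite -uj jm u_m dtNr dtv oppr0 ltxx.
by case/negP: pL; rewrite /low -jt ej /= RC setD1K.
Qed.
End Tokens.

(** * Tokens and common tangents *)

Lemma dt_seg (R : realFieldType) (w a b : R * R) k : dt w (seg a b k - a) = k * dt w (b - a).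
Proof. rewrite seg.unlock /dt /=; ring. Qed.

Lemma subn_split s t e : (s <= t)%N -> (t <= e)%N -> (e - s = (t - s) + (e - t))%N.
Proof. lia. Qed.

Section Tokens.
Variables (R : realFieldType) (V : finType) (pt : V -> R * R).
Hypothesis gp : gen_pos pt.
Notation x v := ((pt v).1).
Notation tn a b c := (turn (pt a) (pt b) (pt c)).
Notation cr a b c d := (cross (pt a) (pt b) (pt c) (pt d)).
Notation right_of := (right_of pt).
Variable h : nat.
Hypothesis Vh : #|V| = (2 * h + 2)%N.
Notation halving := (halving pt h).
Variables (m : nat) (ev : nat -> V * V).
Hypothesis m2 : (1 < m)%N.
Notation A t := (ev t).1.
Notation B t := (ev t).2.
Notation u t := (pt (B t) - pt (A t)).
Hypothesis ev_m : forall t, ev (t + m)%N = (B t, A t).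
Hypothesis ev_h : forall t, halving (A t) (B t).
Hypothesis ev_dt : forall s t, (s < t < s + m)%N -> 0 < dt (u s) (u t).
Hypothesis ev_ex : forall a b N, halving a b -> exists2 t, (N <= t < N + 2 * m)%N & ev t = (a, b).
Notation low := (low pt ev).

Let dt_ge0 := dt_ge0 ev_m ev_dt.
Let dt_lt0 := dt_lt0 ev_m ev_dt.

Lemma low_S t : low t.+1 = B t |: (low t :\ A t).
Proof.
rewrite (low_next gp Vh m2 ev_m ev_h ev_dt ev_ex) /low setU1K // inE turn_aba ltxx //.
Qed.

(** A token sits on a point of the lower half, and moves along an edge when that
    point leaves the lower half. *)
Definition step (t : nat) (z : V) : V := if z == A t then B t else z.

Fixpoint run (K : nat) (z : V) (j : nat) : V :=
  if j is j'.+1 then step (K + j') (run K z j') else z.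

Lemma step_low t z : z \in low t -> step t z \in low t.+1.
Proof.
move=> zl; rewrite low_S /step in_setU1 in_setD1.
case: (eqVneq z (A t)) => [_|za] /=; first by rewrite eqxx.
by rewrite za zl orbT.
Qed.

Lemma step_inj t y z : y \in low t -> z \in low t -> step t y = step t z -> y = z.
Proof.
have Bl := B_low ev_h t.
rewrite /step => yl zl; case: eqP => [->|_]; case: eqP => [->|_] // e.
  by rewrite -e (negbTE Bl) in zl.
by rewrite e (negbTE Bl) in yl.
Qed.

Lemma step_surj t z : z \in low t.+1 -> exists2 y, y \in low t & step t y = z.
Proof.
rewrite low_S in_setU1 in_setD1 => /orP[/eqP ->|/andP[za zl]].
  by exists (A t); rewrite ?A_low // /step eqxx.
by exists z => //; rewrite /step (negbTE za).
Qed.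

Lemma run_low K z j : z \in low K -> run K z j \in low (K + j)%N.
Proof. by move=> zl; elim: j => [|j IH]; rewrite ?addn0 // addnS; apply: step_low. Qed.

Lemma run_inj K y z j : y \in low K -> z \in low K -> run K y j = run K z j -> y = z.
Proof.
by move=> yl zl; elim: j => //= j IH /step_inj e; apply/IH/e; apply: run_low.
Qed.

Lemma run_surj K z j : z \in low (K + j)%N -> exists2 y, y \in low K & run K y j = z.
Proof.
elim: j z => [|j IH] z; first by rewrite addn0; exists z.
by rewrite addnS => /step_surj[y /IH[y' yl <-] <-]; exists y'.
Qed.

Lemma run_add K z i j : run K z (i + j) = run (K + i) (run K z i) j.
Proof. by elim: j => [|j IH]; rewrite ?addn0 // addnS /= IH addnA. Qed.

Lemma dt_step w t y z : dt w (u t) = 0 -> dt w (pt (step t y) - pt (step t z)) = dt w (pt y - pt z).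
Proof. by rewrite /step !dtB; case: eqP => [->|_]; case: eqP => [->|_]; lra. Qed.

Lemma run_ge w K z j : (forall i, (K <= i < K + j)%N -> 0 <= dt w (u i)) ->
  0 <= dt w (pt (run K z j) - pt z).
Proof.
elim: j => [|j IH] H; first by rewrite subrr /dt /= !mulr0 subrr.
have H1 : 0 <= dt w (pt (run K z j) - pt z).
  by apply: IH => i /andP[i1 i2]; apply: H; rewrite i1 addnS ltnS ltnW.
have H2 : 0 <= dt w (u (K + j)) by apply: H; rewrite leq_addr addnS /=.
rewrite /= /step; case: eqP H1 => [->|//]; move: H2; rewrite !dtB; lra.
Qed.

(** A token moves on a convex chain: as long as all its moves go to the left of the
    direction [w], it only gets further to the left. The parameters [k] and [k']
    mark points inside the first and the last edge. *)
Lemma chain_ge w t t' (k k' : R) : (t < t')%N -> run t.+1 (B t) (t' - t.+1) = A t' ->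
  0 < k < 1 -> 0 < k' < 1 -> (forall i, (t <= i <= t')%N -> 0 <= dt w (u i)) ->
  0 <= dt w (seg (pt (A t')) (pt (B t')) k' - seg (pt (A t)) (pt (B t)) k) /\
  (0 < dt w (u t) -> 0 < dt w (seg (pt (A t')) (pt (B t')) k' - seg (pt (A t)) (pt (B t)) k)).
Proof.
move=> tt' e /andP[k0 k1] /andP[k0' k1'] H.
have h1 : 0 <= dt w (u t) by apply: H; rewrite leqnn ltnW.
have h2 : 0 <= dt w (u t') by apply: H; rewrite leqnn ltnW.
have h3 : 0 <= dt w (pt (A t') - pt (B t)).
  by rewrite -e; apply: run_ge => i /andP[i1 i2]; apply: H; rewrite subnKC // in i2; rewrite (ltnW i1) (ltnW i2).
have E : dt w (seg (pt (A t')) (pt (B t')) k' - seg (pt (A t)) (pt (B t)) k) =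
    (1 - k) * dt w (u t) + dt w (pt (A t') - pt (B t)) + k' * dt w (u t').
  by rewrite -dt_seg; have := dt_seg w (pt (A t)) (pt (B t)) k; rewrite !dtB; lra.
have h4 : 0 <= (1 - k) * dt w (u t) by rewrite mulr_ge0 // subr_ge0 ltW.
have h5 : 0 <= k' * dt w (u t') by rewrite mulr_ge0 // ltW.
split=> [|h6]; rewrite E; first by lra.
have h7 : 0 < (1 - k) * dt w (u t) by rewrite mulr_gt0 // subr_gt0.
lra.
Qed.

(** [p q] is the common tangent, found just after the event [e], of the chains of
    two tokens; the edges [t] and [t'] of these chains cross. *)
Definition tangent (e : nat) (p q : V) (t t' : nat) : Prop :=
  [/\ [/\ (t <= e)%N, (e < t')%N & (t' < t + m)%N],
   p \in low e.+1,
   run e.+1 p (t' - e.+1) = A t' /\ run t.+1 (B t) (e - t) = q,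
   0 < dt (u e) (pt q - pt p) /\ dt (u e.+1) (pt q - pt p) <= 0 &
   cr (A t) (B t) (A t') (B t')].

Lemma low_B t : B t \in low t.+1.
Proof. by rewrite low_S in_setU1 eqxx. Qed.

(** Just after [t] the token on [B t] is the leftmost of the lower half; just before
    [t'] the leftmost is the one on [A t']. In between their order is reversed. *)
Lemma tangent_exists t t' : (t < t' < t + m)%N -> cr (A t) (B t) (A t') (B t') ->
  exists e p q, tangent e p q t t'.
Proof.
move=> /andP[tt' t'm] c.
have tut : 0 < dt (u t) (u t') by rewrite ev_dt // tt'.
pose d := (t' - t.+1)%N; have ed : t' = (t.+1 + d)%N by rewrite subnKC.
have [x0 x0l ex0] : exists2 y, y \in low t.+1 & run t.+1 y d = A t'.
  by apply: run_surj; rewrite -ed A_low.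
(* A single token stays to the left of its edge [t], and [A t'] is on the right. *)
have x0B : x0 != B t.
  apply: contraTneq c => x0B; rewrite /cross !turn_dt negb_and -!leNgt.
  have d1 : 0 <= dt (u t) (pt (A t') - pt (A t)).
    have : 0 <= dt (u t) (pt (A t') - pt (B t)).
      rewrite -ex0 x0B; apply: run_ge => i /andP[i1 i2]; apply: dt_ge0.
      by rewrite ltnW // ltnW // (ltn_trans _ t'm) // ed.
    by have := dtv (u t); rewrite !dtB; lra.
  rewrite mulr_ge0 //.
  by move: tut; rewrite !dtB in d1 *; lra.
pose f k := run t.+1 x0 k; pose g k := run t.+1 (B t) k.
have fg k : f k != g k by apply/eqP => /run_inj; rewrite x0l low_B => /(_ isT isT) e; rewrite e eqxx in x0B.
have last_neg : dt (u (t + d).+1) (pt (g d) - pt (f d)) <= 0.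
  have gl : g d \in low t' by rewrite ed; apply: run_low; exact: low_B.
  have gA : g d != A t' by rewrite -ex0 eq_sym; apply: fg.
  by rewrite -addSn -ed /f ex0; apply/ltW/(low_lt gl gA).
have exk : exists k, dt (u (t + k).+1) (pt (g k) - pt (f k)) <= 0 by exists d.
case: (ex_minnP exk) => k kneg kmin.
have kd : (k <= d)%N by apply: kmin.
have kpos : 0 < dt (u (t + k)) (pt (g k) - pt (f k)).
  case: k kneg kmin {kd} => [|k] _ kmin.
    rewrite addn0 /f /g /=.
    have : x0 \in right_of (A t) (B t).
      by move: x0l; rewrite (low_next gp Vh m2 ev_m ev_h ev_dt ev_ex) in_setU1 (negbTE x0B).
    by rewrite inE turn_dt; have := dtv (u t); rewrite !dtB; lra.
  have : ~~ (dt (u (t + k).+1) (pt (g k) - pt (f k)) <= 0).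
    by apply/negP => /kmin; rewrite ltnn.
  by rewrite -ltNge addnS /f /g /= addSn dt_step // dtv.
exists (t + k)%N, (f k), (g k); split=> //.
- split; [exact: leq_addr | by rewrite ed addSn ltnS leq_add2l | by []].
- by rewrite -addSn run_low.
- split; last by rewrite addKn.
  rewrite -ex0 ed -addSn subnDl -{2}(subnKC kd) run_add //.
Qed.

Section Direction.
Variables (e : nat) (s : R * R).
Hypothesis s1 : 0 < dt (u e) s.
Hypothesis s2 : dt (u e.+1) s <= 0.

Let D0 : 0 < dt (u e) (u e.+1).
Proof. by apply: ev_dt; rewrite ltnS leqnn -addn1 ltn_add2l. Qed.

Lemma turn_later j : (e < j < e + m)%N -> 0 <= dt s (u j).
Proof.
move=> /andP[ej je]; rewrite -(pmulr_rge0 _ D0) dt_plucker.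
have a1 : 0 <= dt (u e) (u j) by apply/ltW/ev_dt; rewrite ej je.
have a2 : 0 <= dt (u e.+1) (u j) by apply: dt_ge0; rewrite ej addSn ltnW // ltnW.
have a3 : 0 <= dt s (u e.+1) * dt (u e) (u j) by rewrite mulr_ge0 // dtC oppr_ge0.
have a4 : 0 <= dt (u e) s * dt (u e.+1) (u j) by rewrite mulr_ge0 // ltW.
by rewrite addr_ge0.
Qed.

Lemma turn_earlier j : (j <= e)%N -> (e.+1 < j + m)%N -> dt s (u j) < 0.
Proof.
move=> je ej; rewrite -(pmulr_rlt0 _ D0) dt_plucker.
have a1 : 0 <= - dt (u e) (u j) by rewrite -dtC dt_ge0 // je /= ltnW // ltnW.
have a2 : 0 < - dt (u e.+1) (u j) by rewrite -dtC ev_dt // ltnS je.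
have a3 : 0 <= dt s (u e.+1) * - dt (u e) (u j) by rewrite mulr_ge0 // dtC oppr_ge0.
have a4 : 0 < dt (u e) s * - dt (u e.+1) (u j) by rewrite mulr_gt0.
lra.
Qed.

(** A direction lies in one sector between consecutive events only. *)
Lemma stage_unique e' : (e < e' < e + 2 * m)%N ->
  0 < dt (u e') s -> dt (u e'.+1) s <= 0 -> False.
Proof.
move=> /andP[ee' e'm] p1 p2; case: (ltnP e' (e + m)) => h1.
  by have := @turn_later e'; rewrite ee' h1 dtC => /(_ isT); lra.
case: (ltngtP e' (e + m)) h1 => // [h1|h1] _; last first.
  by move: p1; rewrite h1 (u_m pt ev_m) dtNl oppr_gt0 => p1; have := lt_trans p1 s1; rewrite ltxx.
have a1 : 0 < dt (u e'.+1) (u e.+1).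
  by rewrite dtC oppr_gt0; apply: dt_lt0; rewrite !addSn !ltnS h1 e'm.
have a2 : 0 <= dt (u e'.+1) (u e).
  case: (ltngtP e'.+1 (e + 2 * m)) e'm => // [h2|h2] _.
    by rewrite dtC oppr_ge0 ltW // dt_lt0 // h2 (ltn_trans h1).
  by rewrite h2 (ev_2m ev_m) dtv.
have := dt_plucker (u e) (u e.+1) (u e'.+1) s.
have b0 : dt (u e) (u e.+1) * dt (u e'.+1) s <= 0 by rewrite pmulr_rle0.
have b1 : 0 < dt (u e'.+1) (u e.+1) * dt (u e) s by rewrite mulr_gt0.
have b2 : 0 <= dt (u e) (u e'.+1) * dt (u e.+1) s.
  by rewrite -mulrNN -dtC mulr_ge0 // oppr_ge0.
lra.
Qed.

End Direction.

Lemma low_injB s t e : (s < t)%N -> (t <= e)%N -> run s.+1 (B s) (e - s) = run t.+1 (B t) (e - t) ->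
  run s.+1 (B s) (t - s.+1) = A t.
Proof.
move=> st te.
rewrite (subn_split (ltnW st) te) run_add addSn subnKC ?(ltnW st) // => E.
have sl : run s.+1 (B s) (t - s.+1) \in low t.
  by rewrite -{2}(subnKC st); apply: run_low; exact: low_B.
have rl : run s.+1 (B s) (t - s) = step t (run s.+1 (B s) (t - s.+1)).
  by rewrite subnS -{1}(prednK (_ : 0 < t - s)%N) ?subn_gt0 //= -subnS subnKC.
have := run_inj _ (low_B t) E; rewrite rl => /(_ (step_low sl)).
rewrite /step; case: eqP => // _ h0.
by move: (B_low ev_h t); rewrite -h0 sl.
Qed.

Lemma run_next e p t' s' : (e < t')%N -> (t' < s')%N -> run e.+1 p (t' - e.+1) = A t' ->
  run e.+1 p (s' - e.+1) = A s' -> run t'.+1 (B t') (s' - t'.+1) = A s'.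
Proof.
move=> et ts h1 <-.
rewrite (@subn_split e.+1 t'.+1 s') // ?ltnS 1?ltnW // subSn // run_add /= h1 /step subnKC // eqxx.
by rewrite addnS subnKC.
Qed.

(** Seen from [p q], one chain rises turning left and the other turning right.
    They may meet twice, but in opposite orientations. The directions of [p q] and
    of the edge [s'] give contradictory positions of two points of crossing. *)
Lemma tangent_unique e p q t t' s s' :
  tangent e p q t t' -> tangent e p q s s' -> t = s /\ t' = s'.
Proof.
wlog: t t' s s' / (t' <= s')%N.
  by move=> wl T S; case: (leqP t' s') => l; [exact: wl | have [] := wl _ _ _ _ (ltnW l) S T].
move=> t's' [[te et tm] pl [ft gt] [s1 s2] ct] [[se es sm] _ [fs gs] _ cs].
have [k1 [k1' [k10 k10' z]]] := cross_meet ct.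
have [k2 [k2' [k20 k20' z']]] := cross_meet cs.
have later j : (t' <= j <= s')%N -> 0 <= dt (pt q - pt p) (u j).
  move=> /andP[j1 j2]; apply: (turn_later s1 s2); rewrite (leq_trans et j1) (leq_ltn_trans j2) //.
  by rewrite (leq_trans sm) // leq_add2r.
have earlier j : (t <= j <= e)%N || (s <= j <= e)%N -> 0 < dt (- (pt q - pt p)) (u j).
  rewrite dtNl oppr_gt0 => /orP[] /andP[j1 j2]; apply: (turn_earlier s1 s2) => //.
    by rewrite (leq_ltn_trans et) // (leq_trans tm) // leq_add2r.
  by rewrite (leq_ltn_trans es) // (leq_trans sm) // leq_add2r.
have before r j : (s' < r + m)%N -> (r <= j <= s')%N -> 0 <= dt (- u s') (u j).
  by move=> rm /andP[j1 j2]; rewrite dtNl -dtC dt_ge0 // j2 (leq_trans (ltnW rm)) // leq_add2r.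
have before' r j : (s' < r + m)%N -> (r <= j < s')%N -> 0 < dt (- u s') (u j).
  by move=> rm /andP[j1 j2]; rewrite dtNl -dtC ev_dt // j2 (leq_trans rm) // leq_add2r.
have gE : run t.+1 (B t) (e - t) = run s.+1 (B s) (e - s) by rewrite gt gs.
have same w r k k' : dt w (seg (pt (A r)) (pt (B r)) k - seg (pt (A r)) (pt (B r)) k') =
    (k - k') * dt w (u r).
  have := dt_seg w (pt (A r)) (pt (B r)) k; have := dt_seg w (pt (A r)) (pt (B r)) k'.
  by rewrite !dtB; lra.
have back_s : (s < t)%N -> 0 < dt (- u s') (seg (pt (A t)) (pt (B t)) k1 - seg (pt (A s)) (pt (B s)) k2).
  move=> st; have [_] := chain_ge (w := - u s') st (low_injB st te (esym gE)) k20 k10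
    (fun i h => before s i sm (introT andP (conj (andP h).1 (leq_trans (andP h).2 (leq_trans te (ltnW es)))))).
  by apply; apply: (before' s); rewrite ?leqnn //= (leq_ltn_trans se).
move: t's'; rewrite leq_eqVlt => /orP[/eqP t's'|t's'].
  split=> //; case: (ltngtP s t) => // st.
    by have := back_s st; rewrite z z' t's' same dtNl dtv oppr0 mulr0 ltxx.
  rewrite t's' in tm et.
  have [_] := chain_ge (w := - u s') st (low_injB st se gE) k10 k20
    (fun i h => before t i tm (introT andP (conj (andP h).1 (leq_trans (andP h).2 (leq_trans se (ltnW es)))))).
  move=> h0; have : false; last by [].
  suff : 0 < dt (- u s') (u t).
    by move=> /h0; rewrite z z' t's' same dtNl dtv oppr0 mulr0 ltxx.
  by apply: (before' t) => //; rewrite leqnn /= (leq_ltn_trans te).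
have fc := run_next et t's' ft fs.
have st' : (s <= t')%N by rewrite (leq_trans se) // ltnW.
have [_ F1] := chain_ge (w := - u s') t's' fc k10' k20'
  (fun i h => before s i sm (introT andP (conj (leq_trans st' (andP h).1) (andP h).2))).
have {}F1 := F1 (before' s t' sm (introT andP (conj st' t's'))).
have [F2 _] := chain_ge t's' fc k10' k20' later.
rewrite -z -z' in F1 F2.
case: (ltngtP s t) => st.
- by have := back_s st; move: F1; rewrite !dtB => f1 f2; have := addr_gt0 f1 f2; rewrite addrA subrK subrr ltxx.
- have [_] := chain_ge (w := - (pt q - pt p)) st (low_injB st se gE) k10 k20
    (fun i h => ltW (earlier i (introT orP (or_introl (introT andP (conj (andP h).1 (leq_trans (andP h).2 se))))))).
  move=> h0; have : false; last by [].
  suff : 0 < dt (- (pt q - pt p)) (u t) by move=> /h0; rewrite dtNl oppr_gt0 ltNge F2.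
  by apply: earlier; rewrite leqnn te.
- rewrite st in z' F1 F2; rewrite z z' -z -z' !same in F1 F2.
  have c1 : dt (pt q - pt p) (u t) < 0 by rewrite -oppr_gt0 -dtNl; apply: earlier; rewrite leqnn te.
  have c2 : 0 < dt (- u s') (u t) by apply: (before' s) => //; rewrite st leqnn /= (leq_ltn_trans te) // (ltn_trans et).
  move: F1 F2; rewrite pmulr_lgt0 // subr_gt0 nmulr_lge0 // subr_le0 leNgt => -> //.
Qed.
(** The points outside the lower half are to the left of all directions between
    the events [e] and [e.+1]. *)
Lemma tangent_right e p q t t' : tangent e p q t t' -> p != q /\ (#|right_of p q| < h)%N.
Proof.
move=> [[te et tm] pl [_ gt] [s1 s2] _].
have pq : p != q by apply: contraTneq s1 => ->; rewrite subrr /dt /= !mulr0 subrr ltxx.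
have ql : q \in low e.+1.
  by rewrite -gt (_ : e.+1 = t.+1 + (e - t))%N; [apply: run_low; exact: low_B | rewrite addSn subnKC].
split=> //.
have D0 : 0 < dt (u e) (u e.+1) by apply: ev_dt; rewrite ltnS leqnn -addn1 ltn_add2l.
have sub : right_of p q \subset low e.+1 :\: [set p; q].
  apply/subsetP => r rR; rewrite !in_setD in_set2 negb_or.
  have rp : r != p by apply: contraTneq rR => ->; rewrite inE turn_aba ltxx.
  have rq : r != q by apply: contraTneq rR => ->; rewrite inE turn_abb ltxx.
  rewrite rp rq /=; apply: contraLR rR => rl; rewrite inE turn_dt -leNgt.
  have lowN := low_next gp Vh m2 ev_m ev_h ev_dt ev_ex e.
  have a1 : 0 <= dt (u e) (pt r - pt p).
    have r1 : 0 <= dt (u e) (pt r - pt (A e)).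
      by move: rl; rewrite lowN !inE -turn_dt negb_or -leNgt => /andP[].
    have p1 : dt (u e) (pt p - pt (A e)) <= 0.
      by move: pl; rewrite lowN !inE -turn_dt => /orP[/eqP ->|/ltW //]; rewrite turn_abb.
    by move: r1 p1; rewrite !dtB; lra.
  have a2 : 0 <= dt (u e.+1) (pt r - pt p).
    by have := low_le pl; have := high_ge rl; rewrite !dtB; lra.
  have a3 : 0 <= dt (pt q - pt p) (u e.+1) by rewrite dtC oppr_ge0.
  by rewrite -(pmulr_rge0 _ D0) dt_plucker addr_ge0 // mulr_ge0 // ltW.
apply: leq_ltn_trans (subset_leq_card sub) _.
have pql : [set p; q] \subset low e.+1 by rewrite subUset !sub1set pl ql.
rewrite -ltnS -(card_low ev_h e.+1) -(cardsID [set p; q] (low e.+1)) (setIidPr pql) cards2 pq.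
by rewrite addSn add1n.
Qed.

Lemma ev_shift t c : ev (t + c * (2 * m))%N = ev t.
Proof.
by elim: c => [|c IH]; rewrite ?addn0 // mulSn addnA addnAC ev_2m.
Qed.

Lemma run_shift K z j c : run (K + c * (2 * m)) z j = run K z j.
Proof. by elim: j => //= j ->; rewrite /step addnAC ev_shift. Qed.

Lemma tangent_shift e p q t t' c : tangent e p q t t' ->
  tangent (e + c * (2 * m)) p q (t + c * (2 * m)) (t' + c * (2 * m)).
Proof.
move=> [[te et tm] pl [ft gt] [s1 s2] ct]; split.
- by split; rewrite ?leq_add2r ?ltn_add2r // addnAC ltn_add2r.
- by rewrite -addSn /low ev_shift.
- by rewrite -!addSn !subnDr !run_shift !ev_shift.
- by rewrite -!addSn !ev_shift.
- by rewrite !ev_shift.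
Qed.

(** The events recur after [2 * m] steps, so the two stages may be taken equal. *)
Lemma tangent_determines e p q t t' e' s s' :
  tangent e p q t t' -> tangent e' p q s s' -> ev t = ev s /\ ev t' = ev s'.
Proof.
wlog ee' : e t t' e' s s' / (e <= e')%N.
  move=> wl T S; case: (leqP e e') => l; first exact: wl l T S.
  by have [-> ->] := wl _ _ _ _ _ _ (ltnW l) S T.
move=> T S; pose c := ((e' - e) %/ (2 * m))%N; pose r := ((e' - e) %% (2 * m))%N.
have m0 : (0 < 2 * m)%N by rewrite muln_gt0 (ltnW m2).
have E : e' = (e + c * (2 * m) + r)%N by rewrite -addnA -divn_eq subnKC.
have T' := tangent_shift c T.
have [r0|r0] := posnP r.
  rewrite E r0 addn0 in S; have [<- <-] := tangent_unique T' S.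
  by rewrite !ev_shift.
have [_ _ _ [a1 a2] _] := T'; have [_ _ _ [b1 b2] _] := S.
exfalso; apply: (stage_unique a1 a2 _ b1 b2).
by rewrite E -addn1 leq_add2l r0 ltn_add2l ltn_pmod.
Qed.
End Tokens.

(** * Crossings of halving edges *)

Lemma leq_card_rel (I J : finType) (S : {set I}) (D : {set J}) (P : I -> J -> Prop) :
  (forall i, i \in S -> exists2 j, j \in D & P i j) ->
  (forall i i' j, P i j -> P i' j -> i = i') -> (#|S| <= #|D|)%N.
Proof.
move=> ex inj; pose f i := [pick j in D | `[< P i j >]].
have fP i : i \in S -> exists j, [/\ f i = Some j, j \in D & P i j].
  move=> /ex[j jD Pij]; rewrite /f; case: pickP => [j' /andP[j'D /asboolP Pj']|/(_ j)].
    by exists j'.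
  by rewrite jD; move/asboolP: Pij => ->.
rewrite -(card_in_imset (f := f) (D := mem S)); last first.
  move=> i i' /fP[j [e jD Pj]] /fP[j' [e' jD' Pj']]; rewrite e e' => -[jj].
  by apply: inj Pj _; rewrite jj.
rewrite -(card_imset (mem D) (@Some_inj _)).
by apply/subset_leq_card/subsetP => _ /imsetP[i /fP[j [-> jD _]] ->]; apply: imset_f.
Qed.

Section Final.
Variables (R : realFieldType) (V : finType) (pt : V -> R * R).
Hypothesis xI : injective (fun v => (pt v).1).
Hypothesis gp : gen_pos pt.
Notation x v := ((pt v).1).
Notation cr a b c d := (cross (pt a) (pt b) (pt c) (pt d)).
Notation right_of := (right_of pt).
Variable h : nat.
Hypothesis Vh : #|V| = (2 * h + 2)%N.
Notation G := (halving_edges pt h).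
Notation dir_vec e := (pt e.2 - pt e.1).

Definition shallow_pairs : {set V * V} :=
  [set e | (e.1 != e.2) && (#|right_of e.1 e.2| < h)%N].

(** A pair of points is shallow in at most one direction, and then not halving. *)
Lemma shallow_or_halving : (#|shallow_pairs| + #|G| <= 'C(#|V|, 2))%N.
Proof.
have dis : [disjoint shallow_pairs & G].
  apply/pred0Pn => -[e /andP[]] /=; rewrite !inE => /andP[_ lt] /andP[_ /and3P[_ /eqP e1 _]].
  by rewrite e1 ltnn in lt.
rewrite -(card_disjointU dis) -card_draws.
rewrite -(card_in_imset (f := fun e : V * V => [set e.1; e.2])).
  apply/subset_leq_card/subsetP => _ /imsetP[e eU ->]; rewrite inE cards2.
  suff -> : e.1 != e.2 by [].
  by move: eU; rewrite !inE => /orP[/andP[]|/andP[_ /and3P[]]].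
have sw a b : a != b -> (a, b) \in shallow_pairs :|: G -> (b, a) \in shallow_pairs :|: G -> False.
  move=> ab; have sum := right_of_sum gp Vh ab; rewrite !inE /=.
  move=> /orP[/andP[_ l1]|/andP[x1 /and3P[_ /eqP e1 /eqP e2]]]
         /orP[/andP[_ l2]|/andP[x2 /and3P[_ /eqP e3 /eqP e4]]].
  - by have := leq_add l1 l2; rewrite addSn addnS sum; lia.
  - by rewrite e4 ltnn in l1.
  - by rewrite e2 ltnn in l2.
  - by have := lt_trans x1 x2; rewrite ltxx.
move=> [a b] [c d] abU cdU /= E.
have ab : a != b by move: abU; rewrite !inE => /orP[/andP[]|/andP[_ /and3P[]]].
have : c \in [set a; b] by rewrite E !inE eqxx.
have : d \in [set a; b] by rewrite E !inE eqxx orbT.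
have cd : c != d by move: cdU; rewrite !inE => /orP[/andP[]|/andP[_ /and3P[]]].
rewrite !inE => /orP[] /eqP hd /orP[] /eqP hc; rewrite hd hc ?eqxx // in cd cdU *.
by case: (sw a b ab abU cdU).
Qed.

Definition directed_crossings : {set (V * V) * (V * V)} :=
  [set p | [&& adj G p.1.1 p.1.2, adj G p.2.1 p.2.2, cr p.1.1 p.1.2 p.2.1 p.2.2 &
     0 < dt (dir_vec p.1) (dir_vec p.2)]].

Lemma cross_dt a b c d : cr a b c d -> dt (pt b - pt a) (pt d - pt c) != 0.
Proof.
move=> /andP[c1 _]; apply: contraTneq c1 => e.
have -> : turn (pt a) (pt b) (pt d) = turn (pt a) (pt b) (pt c).
  by rewrite !turn_dt; move: e; rewrite !dtB; lra.
by rewrite -expr2 -leNgt sqr_ge0.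
Qed.

(** Of the four ways to direct two crossing edges, two make the second edge turn
    to the left of the first. *)
Lemma directed_crossings_card : (2 * #|crossings pt G| <= #|directed_crossings|)%N.
Proof.
pose sw (e : V * V) := (e.2, e.1).
pose pos (p : (V * V) * (V * V)) := 0 < dt (dir_vec p.1) (dir_vec p.2).
pose f p := (p.1, if pos p then p.2 else sw p.2).
pose g p := (sw p.1, if pos p then sw p.2 else p.2).
have oG e : e \in G -> x e.1 < x e.2 by rewrite inE => /andP[].
have swG e : e \in G -> sw e \in G -> False.
  by move=> /oG h1 /oG h2; have := lt_trans h1 h2; rewrite ltxx.
have swK e : sw (sw e) = e by rewrite /sw -surjective_pairing.
have cP p : p \in crossings pt G -> [/\ p.1 \in G, p.2 \in G & cr p.1.1 p.1.2 p.2.1 p.2.2].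
  by rewrite inE => /and3P[].
have pick (b c : bool) e e' : e \in G -> e' \in G ->
    (if b then e else sw e) = (if c then e' else sw e') -> e = e'.
  move=> eG e'G; case: b; case: c => // h0.
  - by case: (swG e') => //; rewrite -h0.
  - by case: (swG e) => //; rewrite h0.
  - by rewrite -[e]swK h0 swK.
have fI : {in crossings pt G &, injective f}.
  move=> [e e1] [e' e1'] /cP[/= _ h1 _] /cP[/= _ h2 _] [-> h0].
  by rewrite (pick _ _ _ _ h1 h2 h0).
have gI : {in crossings pt G &, injective g}.
  move=> [e e1] [e' e1'] /cP[/= eG h1 _] /cP[/= e'G h2 _] [h3 h4 h0].
  have -> : e = e' by rewrite [e]surjective_pairing h3 h4 -surjective_pairing.
  rewrite (pick (~~ pos (e, e1)) (~~ pos (e', e1')) _ _ h1 h2) //.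
  by rewrite !if_neg.
have dis : [disjoint f @: crossings pt G & g @: crossings pt G].
  apply/pred0Pn => -[_ /andP[/imsetP[p /cP[pG _ _] ->] /imsetP[q /cP[qG _ _] [h0 _]]]].
  by apply: (swG q.1 qG); rewrite -h0.
rewrite mul2n -addnn -{1}(card_in_imset fI) -(card_in_imset gI) -(card_disjointU dis).
have dtsw u e : dt u (dir_vec (sw e)) = - dt u (dir_vec e) by rewrite -dtNr opprB.
have dtswl u e : dt (dir_vec (sw e)) u = - dt (dir_vec e) u by rewrite -dtNl opprB.
have adjs e : e \in G -> adj G e.1 e.2 /\ adj G (sw e).1 (sw e).2.
  by rewrite /adj /= -surjective_pairing => ->; rewrite orbT.
have npos p : p \in crossings pt G -> ~~ pos p -> 0 < - dt (dir_vec p.1) (dir_vec p.2).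
  by move=> /cP[_ _ /cross_dt h0]; rewrite /pos -leNgt oppr_gt0 lt_neqAle h0.
apply/subset_leq_card/subsetP => _ /setUP[] /imsetP[p pC ->]; have [p1 p2 c] := cP _ pC;
  have [q1 q1'] := adjs _ p1; have [q2 q2'] := adjs _ p2; rewrite inE.
- rewrite /f; case h0 : (pos p) => /=; first by rewrite q1 q2 c.
  by rewrite q1 q2' cross_swapr c (dtsw _ p.2) npos ?h0.
- rewrite /g; case h0 : (pos p) => /=.
    by rewrite q1' q2' cross_swapl cross_swapr c (dtsw _ p.2) (dtswl _ p.1) opprK.
  by rewrite q1' q2 cross_swapl c (dtswl _ p.1) npos ?h0.
Qed.

(** Every crossing, directed in its four ways, has four common tangents, none of
    which is halving. *)
Theorem halving_crossings : (2 * #|crossings pt G| + #|G| <= 'C(#|V|, 2))%N.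
Proof.
apply: leq_trans shallow_or_halving; rewrite leq_add2r.
apply: leq_trans directed_crossings_card _.
have [->|[p0 p0Q]] := set_0Vmem directed_crossings; first by rewrite cards0.
have m2 : (1 < #|G|)%N.
  have [p pC] : exists p, p \in crossings pt G.
    move: p0Q; rewrite inE => /and4P[a1 a2 c _].
    exists (ed pt p0.1.1 p0.1.2, ed pt p0.2.1 p0.2.2); rewrite inE -!(ed_adj _ _ (oG pt h)) a1 a2 /=.
    by rewrite ed_cross crossC ed_cross crossC.
  move: pC; rewrite inE => /and3P[p1 p2 c]; apply/card_gt1P; exists p.1, p.2; split=> //.
  by apply: contraTneq c => ->; rewrite /cross turn_aba mul0r ltxx.
have [ev [ev_m ev_h ev_dt ev_ex]] := events_exist xI gp Vh (ltnW m2).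
apply: (@leq_card_rel _ _ _ _ (fun p q => exists e t t', [/\ ev t = p.1, ev t' = p.2 &
    tangent pt #|G| ev e q.1 q.2 t t'])); last first.
  move=> [p1 p2] [p1' p2'] q [e [t [t' [/= <- <- T]]]] [e' [s [s' [/= <- <- S]]]].
  by have [-> ->] := tangent_determines gp Vh m2 ev_m ev_h ev_dt ev_ex T S.
move=> [[a b] [c d]]; rewrite inE /= !(adjG xI) => /and4P[hab hcd cr0 pos].
have [t _ et] := ev_ex a b 0 hab.
have [t' /andP[t1 t2] et'] := ev_ex c d t hcd.
have tt' : (t < t' < t + #|G|)%N.
  have ut : dt (dir_vec (ev t)) (dir_vec (ev t')) > 0 by rewrite et et'.
  case: (ltngtP t t') t1 => // [t1 _|tt']; last by rewrite tt' dtv ltxx in ut.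
  rewrite /=; case: (ltngtP t' (t + #|G|)) => // t3.
    by have := dt_lt0 ev_m ev_dt (introT andP (conj t3 t2)); rewrite ltNge ltW.
  by rewrite t3 (u_m pt ev_m) dtNr dtv oppr0 ltxx in ut.
have cr1 : cr (ev t).1 (ev t).2 (ev t').1 (ev t').2 by rewrite et et'.
have [e [p [q T]]] := tangent_exists gp Vh m2 ev_m ev_h ev_dt ev_ex tt' cr1.
have [pq lt] := tangent_right gp Vh m2 ev_m ev_h ev_dt ev_ex T.
exists (p, q); first by rewrite inE /= pq.
by exists e, t, t'.
Qed.
End Final.

(** * Numerical conclusion *)

Section Arithmetic.
Local Open Scope nat_scope.
(** The linear inequalities [c e <= M + 8 b n] that removal gives for the number
    [e] of edges on [n = 2 h + 2] points, with [M = n (n - 1)]. *)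
Definition removal_bounds : seq (N * N) :=
  [:: (2, 0)%num; (10, 3)%num; (18, 7)%num; (26, 12)%num; (34, 18)%num; (42, 25)%num].

Definition few_points_check (h : nat) : bool :=
  let n := (2 * N.of_nat h + 2)%num in let M := (n * (2 * N.of_nat h + 1))%num in
  has (fun cb => let e := N.div (M + 8 * cb.2 * n) cb.1 in
    N.leb (32 * (e * e * e)) (135 * (n * n) * M))%num removal_bounds.

Lemma few_points_checked : all few_points_check (iota 0 50).
Proof. by vm_compute. Qed.

(** The quotients of the linear bounds, rounded down, are small enough; for eight
    points the rounding is essential. *)
Lemma few_points (h e : nat) : h < 50 ->
  8 * ((e - 3 * (2 * h + 2)) + (e - 4 * (2 * h + 2)) + (e - 5 * (2 * h + 2)) +
    (e - 6 * (2 * h + 2)) + (e - 7 * (2 * h + 2))) + 2 * e <= (2 * h + 2) * (2 * h + 1) ->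
  32 * (e * e * e) <= 135 * ((2 * h + 2) * (2 * h + 2)) * ((2 * h + 2) * (2 * h + 1)).
Proof.
move=> h50 H.
have /allP/(_ h) := few_points_checked; rewrite mem_iota h50 => /(_ isT).
move=> /hasP[[c b] cb]; cbn [fst snd]; set E := N.div _ c => /N.leb_spec0 C.
have cb' : N.lt 0 c /\ N.le (c * N.of_nat e) ((2 * N.of_nat h + 2) * (2 * N.of_nat h + 1) +
   8 * b * (2 * N.of_nat h + 2)).
  clear C E h50; move: cb; rewrite !inE !xpair_eqE.
  by do 5 (case/orP; first by move=> /andP[/eqP -> /eqP ->]; split; lia);
    move=> /andP[/eqP -> /eqP ->]; split; lia.
have leE : N.le (N.of_nat e) E by case: cb' => c0 le; apply: N.div_le_lower_bound => //; apply/N.neq_0_lt_0.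
clearbody E; clear cb cb' H h50.
have leE3 : N.le (N.of_nat e * N.of_nat e * N.of_nat e) (E * E * E).
  by do 2 apply: N.mul_le_mono => //.
have := N.le_trans _ _ _ (N.mul_le_mono_l _ _ 32 leE3) C.
by clear; lia.
Qed.
End Arithmetic.

Section Conclusion.
Local Open Scope nat_scope.
Lemma dense_case (e n X C : nat) : 8 * e ^ 3 <= 135 * n ^ 2 * X -> 2 * X + e <= C ->
  16 * e ^ 3 <= 135 * n ^ 2 * C.
Proof.
move=> h1 h2; apply: (@leq_trans (135 * n ^ 2 * (2 * X))); last by rewrite leq_mul2l (leq_trans (leq_addr _ _) h2) orbT.
by rewrite mulnCA [(16)%N](_ : _ = 2 * 8) // -mulnA leq_mul2l.
Qed.

Lemma sparse_case (e h C : nat) : 2 * e < 15 * (2 * h + 2) -> 50 <= h ->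
  2 * C = (2 * h + 2) * (2 * h + 1) -> 16 * e ^ 3 <= 135 * (2 * h + 2) ^ 2 * C.
Proof.
move=> h1 h2 h3; rewrite -(leq_pmul2l (isT : 0 < 2)).
set n := (2 * h + 2) in h1 h3 *.
have -> : 2 * (135 * n ^ 2 * C) = 135 * n ^ 3 * (2 * h + 1) by rewrite mulnCA h3 expnS; lia.
have l3 : (2 * e) ^ 3 <= (15 * n) ^ 3 by rewrite leq_exp2r // ltnW.
rewrite !expnMn in l3.
have l4 : 135 * n ^ 3 * 100 <= 135 * n ^ 3 * (2 * h + 1) by rewrite leq_mul2l; apply/orP; right; lia.
apply: leq_trans l4; move: l3; move: (e ^ 3) (n ^ 3) => E N; clear; lia.
Qed.

Section Bound.
Variables (R : realFieldType) (V : finType) (pt : V -> R * R).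
Hypothesis xI : injective (fun v => (pt v).1).
Hypothesis gp : gen_pos pt.
Variable h : nat.
Hypothesis Vh : #|V| = (2 * h + 2)%N.
Notation G := (halving_edges pt h).

(** Dense graphs compare the two estimates of the number of crossings. For sparse
    ones the claim is immediate beyond a hundred points, and below it follows from
    the removal bounds alone. *)
Theorem halving_edges_bound : 16 * #|G| ^ 3 <= 135 * #|V| ^ 2 * 'C(#|V|, 2).
Proof.
have hc := halving_crossings xI gp Vh.
have C2 : 2 * 'C(#|V|, 2) = (2 * h + 2) * (2 * h + 1).
  by rewrite -mul_bin_diag bin1 Vh addn2 addn1.
case: (leqP (15 * #|V|) (2 * #|G|)) => dense.
  exact: dense_case (crossing_lemma xI gp (oG pt h) dense) hc.
case: (leqP 50 h) => h50.
  by have := @sparse_case #|G| h _ _ h50 C2; rewrite -Vh; apply.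
have cs := crossings_sum xI gp (oG pt h).
have := @few_points h #|G| h50; rewrite -C2.
have -> : 32 * (#|G| * #|G| * #|G|) = 2 * (16 * #|G| ^ 3) by rewrite !expnS expn0; lia.
have -> : 135 * ((2 * h + 2) * (2 * h + 2)) * (2 * 'C(#|V|, 2)) = 2 * (135 * #|V| ^ 2 * 'C(#|V|, 2)).
  by rewrite Vh mulnCA.
rewrite leq_pmul2l //; apply.
move: cs hc; rewrite Vh !big_ord_recr big_ord0 /=.
move: #|crossings _ _| #|G| 'C(_, 2) => X e C; clear; lia.
Qed.
End Bound.
End Conclusion.

From mathcomp Require Import finmap.
From mathcomp Require Import all_classical all_reals all_analysis.

Local Open Scope fset_scope.
Local Open Scope ring_scope.

(** * From lines to edges *)

Lemma orient_turn (R : realType) (p q r : R * R) : orient p q r = turn p q r.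
Proof. by rewrite turn.unlock. Qed.

(** A shear keeps orientations and separates abscissae. *)
Definition shear (R : realType) (k : R) (p : R * R) : R * R := (p.1 + k * p.2, p.2).

Lemma turn_shear (R : realType) (k : R) p q r :
  turn (shear k p) (shear k q) (shear k r) = turn p q r.
Proof. rewrite turn.unlock /shear /=; ring. Qed.

(** [k] exceeds every value at which two abscissae agree. *)
Lemma shear_generic (R : realType) (V : finType) (pt : V -> R * R) : injective pt ->
  exists k, injective (fun v => (shear k (pt v)).1).
Proof.
move=> ptI.
pose F (e : V * V) := `|((pt e.2).1 - (pt e.1).1) / ((pt e.1).2 - (pt e.2).2)|.
(* [F (a, b)] is the only coefficient, up to sign, that can identify [a] and [b]. *)
exists (1 + \sum_e F e) => a b /= E; apply: ptI; set k := 1 + _ in E.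
have E' : k * ((pt a).2 - (pt b).2) = (pt b).1 - (pt a).1 by move: E; lra.
case: (eqVneq (pt a).2 (pt b).2) => y.
  move: E'; rewrite y subrr mulr0 => /esym/eqP; rewrite subr_eq0 => /eqP x.
  by rewrite [pt a]surjective_pairing [pt b]surjective_pairing x y.
have y0 : (pt a).2 - (pt b).2 != 0 by rewrite subr_eq0.
have Fk : F (a, b) = k.
  rewrite /F /= -E' mulfK // ger0_norm // addr_ge0 // sumr_ge0 // => e _; exact: normr_ge0.
have : F (a, b) <= \sum_e F e.
  by rewrite (bigD1 (a, b)) //= lerDl sumr_ge0 // => e _; exact: normr_ge0.
by rewrite Fk /k gerDr ler10.
Qed.

Section Lines.
Variables (R : realType) (S : {fset R * R}).
Hypothesis gpS : general_position S.

Let pt0 (v : S) : R * R := val v.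

Lemma gen_pos_val : gen_pos pt0.
Proof.
move=> a b c ab ac bc; apply/eqP => t0.
apply: (gpS (valP a) (valP b) (valP c)); rewrite ?(inj_eq val_inj) //.
by rewrite /line /= orient_turn.
Qed.

Lemma line_swap (p q : R * R) : line p q = line q p.
Proof.
by apply/seteqP; split=> r; rewrite /line /= !orient_turn => h; rewrite turn_swap h oppr0.
Qed.

Lemma card_filter_val (P : pred (R * R)) : #|` [fset r in S | P r]| = #|[set v : S | P (val v)]|.
Proof.
rewrite cardE -(size_map val); apply/perm_size/uniq_perm; first exact: fset_uniq.
  by rewrite map_inj_uniq ?enum_uniq //; exact: val_inj.
move=> r; rewrite !inE /=; apply/idP/mapP => [/andP[rS Pr]|[v]].
  by exists [` rS]; rewrite ?mem_enum ?inE.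
by rewrite mem_enum inE => Pv ->; rewrite (valP v).
Qed.

(** A halving line is the line of a halving edge, read from left to right. *)
Lemma halving_lines_le (k : R) (h : nat) (Sh : #|` S| = (2 * h + 2)%N) :
  injective (fun v => (shear k (pt0 v)).1) ->
  (num_halving_lines S <= #|halving_edges (shear k \o pt0) h|)%N.
Proof.
move=> xI; set G := halving_edges _ _.
pose ls := [seq line (val e.1) (val e.2) | e <- enum G].
have sub : fset_set [set L | halving_line S L] `<=` [fset L in ls].
  apply/fsubsetP => L; rewrite in_fset_set; last exact: finite_halving_lines.
  rewrite !inE => /= -[p [q [[pS qS pq ->] [c1 c2]]]].
  have hE : ((#|` S| - 2) %/ 2 = h)%N by rewrite Sh addnK mulKn.
  rewrite hE in c1 c2.
  pose a : S := [` pS]; pose b : S := [` qS].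
  have c1' : #|right_of (shear k \o pt0) b a| = h.
    rewrite -c1 card_filter_val; apply: eq_card => v; rewrite !inE /= turn_shear orient_turn.
    by rewrite [turn (pt0 b) _ _]turn_swap oppr_lt0.
  have c2' : #|right_of (shear k \o pt0) a b| = h.
    by rewrite -c2 card_filter_val; apply: eq_card => v; rewrite !inE /= turn_shear orient_turn.
  have ab : a != b by rewrite -(inj_eq val_inj).
  have ha : halving (shear k \o pt0) h a b by rewrite /halving ab c1' c2' eqxx.
  case: (ltgtP (shear k (pt0 a)).1 (shear k (pt0 b)).1) => x.
  - apply/mapP; exists (a, b) => //; by rewrite mem_enum inE /= x.
  - apply/mapP; exists (b, a); last by rewrite line_swap.
    by rewrite mem_enum inE /= x halving_sym.
  - by move/xI: x ab => ->; rewrite eqxx.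
apply: leq_trans (fsubset_leq_card sub) _.
by rewrite card_fseq (leq_trans (size_undup _)) // size_map -cardE.
Qed.
End Lines.

Theorem theorem7p6 (R : realType) (n : nat) (n_gt0 : (0 < n)%N)
    (n_even : ~~ odd n) (S : {fset R * R}) (card_S : #|` S | = n)
    (gpS : general_position S) :
  (num_halving_lines S)%:R <=
    ('C(n, 2)%:R * (135 * n%:R ^+ 2 / 16)) `^ (3^-1) :> R.
Proof.
pose h := (n - 2)./2.
have nh : n = (2 * h + 2)%N.
  have n2 : (1 < n)%N by case: n n_gt0 n_even {card_S h} => [|[|n]].
  by rewrite mul2n halfK oddB // (negbTE n_even) subn0 subnK.
pose pt0 (v : S) : R * R := val v.
have [k xI] := shear_generic (pt := pt0) val_inj.
have gp : gen_pos (shear k \o pt0).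
  by move=> a b c ab ac bc; rewrite /= turn_shear; apply: gen_pos_val.
have Vn : #|{: S}| = n by rewrite -cardfE.
have le1 := halving_lines_le (etrans card_S nh) xI.
have := halving_edges_bound xI gp (etrans Vn nh); rewrite Vn => le2.
set e := #|halving_edges _ _| in le1 le2.
have X0 : (0 : R) <= 'C(n, 2)%:R * (135 * n%:R ^+ 2 / 16).
  by rewrite !mulr_ge0 // exprn_ge0.
have cube : (e%:R : R) ^+ 3 <= 'C(n, 2)%:R * (135 * n%:R ^+ 2 / 16).
  have E1 : ((16 * e ^ 3)%N%:R : R) = 16 * e%:R ^+ 3 by rewrite natrM natrX.
  have E2 : ((135 * n ^ 2 * 'C(n, 2))%N%:R : R) = 135 * n%:R ^+ 2 * 'C(n, 2)%:R.
    by rewrite natrM [X in X * _]natrM natrX.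
  move: le2; rewrite -(ler_nat R) E1 E2; clear; lra.
apply: (@le_trans _ _ (e%:R)); first by rewrite ler_nat.
have -> : (e%:R : R) = (e%:R ^+ 3) `^ 3^-1.
  by rewrite -powR_mulrn // -powRrM mulfV ?powRr1.
by apply: ge0_ler_powR; rewrite ?invr_ge0 ?nnegrE ?exprn_ge0.
Qed.
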